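(* Let $v$ be a quasi-normal typical weight on the unit disk $\mathbb{D}$. For every nontrivial semigroup of analytic functions $\{\varphi_t\}$ with Denjoy-Wolff point $b\in\mathbb{T}$ (for which the operators $T_tf=\varphi_t'\,(f\circ\varphi_t)$ are bounded on $H_v^\infty$ with $\sup_{0\le t\le1}\|T_t\|<\infty$) we have $$H_v^0\subsetneq[\varphi_t',H_v^\infty].$$
   Context: A semigroup of analytic functions is a family $\{\varphi_t:t\ge 0\}$ of analytic self-maps of $\mathbb{D}$ such that $\varphi_0$ is the identity, $\varphi_{t+s}=\varphi_t\circ\varphi_s$ for all $t,s\ge0$, and $\varphi_t\to\varphi_0$ uniformly on compact subsets of $\mathbb{D}$ as $t\to0$; it is nontrivial if some $\varphi_t$ is not the identity. $\varphi_t'=\partial\varphi_t/\partial z$. Its infinitesimal generator is $G(z)=\lim_{t\to0^+}\frac{\varphi_t(z)-z}{t}$, which for a nontrivial semigroup has a unique representation $G(z)=(\overline{b}z-1)(z-b)P(z)$ with $P$ analytic on $\mathbb{D}$, $\operatorname{Re}P\ge0$, and $b\in\overline{\mathbb{D}}$; $b$ is the Denjoy-Wolff point of the semigroup. $\mathbb{T}=\partial\mathbb{D}$ is the unit circle. A weight is a bounded, continuous, positive, radial function $v:\mathbb{D}\to\mathbb{R}_+$ (we write $v(r)=v(z)$ for $|z|=r$); it is typical if $\lim_{|z|\to1}v(z)=0$. $H_v^\infty$ is the Banach space of analytic $f$ on $\mathbb{D}$ with $\|f\|_v=\sup_{z\in\mathbb{D}}v(z)|f(z)|<\infty$, and $H_v^0$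 is its subspace of functions with $\lim_{|z|\to1}v(z)|f(z)|=0$. A weight $v$ is quasi-normal if, for analytic $f$ on $\mathbb{D}$, $f\in H_v^\infty$ if and only if $\sup_{z\in\mathbb{D}}(1-|z|^2)v(z)|f'(z)|<\infty$. For a Banach space $X$ of analytic functions on $\mathbb{D}$ on which the $T_t$ are bounded, $[\varphi_t',X]=\{f\in X:\lim_{t\to0^+}\|\varphi_t'(f\circ\varphi_t)-f\|_X=0\}$. *)

(* Defs.v *)
From Stdlib Require Import Reals List.
From Coquelicot Require Export Coquelicot.

Open Scope R_scope.

(* Functions on the unit disk are total functions on [C]; every notion below
   only looks at their values on [disk], so functions agreeing there are
   interchangeable. *)
Definition disk (z : C) : Prop := Cmod z < 1.

(* Complex differentiability: both the field and the module are [C]. *)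
Definition analytic (f : C -> C) : Prop :=
  forall z : C, disk z -> ex_derive (K := C_AbsRing) (V := C_NormedModule) f z.

Definition analytic_self_map (f : C -> C) : Prop :=
  analytic f /\ forall z : C, disk z -> disk (f z).

(* The filter of |z| -> 1 from inside the disk. *)
Definition to_circle (P : C -> Prop) : Prop :=
  at_left 1 (fun r : R => forall z : C, Cmod z = r -> P z).

Definition compact_set {T : UniformSpace} (K : T -> Prop) : Prop :=
  forall (I : Type) (U : I -> T -> Prop),
    (forall i, open (U i)) ->
    (forall x, K x -> exists i, U i x) ->
    exists l : list I, forall x, K x -> exists i, In i l /\ U i x.

Definition weight (v : C -> R) : Prop :=
  (exists M : R, forall z, disk z -> v z <= M) /\
  (forall z, disk z -> continuous v z) /\
  (forall z, disk z -> 0 < v z) /\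
  (forall z w, disk z -> disk w -> Cmod z = Cmod w -> v z = v w).

Definition typical (v : C -> R) : Prop :=
  filterlim v to_circle (locally 0).

(* The supremum is taken in [Rbar], so it is [p_infty] when unbounded. *)
Definition weighted_norm (v : C -> R) (f : C -> C) : Rbar :=
  Lub_Rbar (fun x : R => exists z : C, disk z /\ x = v z * Cmod (f z)).

Definition Hv_infty (v : C -> R) (f : C -> C) : Prop :=
  analytic f /\ Rbar_lt (weighted_norm v f) p_infty.

Definition Hv_zero (v : C -> R) (f : C -> C) : Prop :=
  Hv_infty v f /\
  filterlim (fun z : C => v z * Cmod (f z)) to_circle (locally 0).

Definition quasi_normal (v : C -> R) : Prop :=
  forall f : C -> C, analytic f ->
    (Hv_infty v f <->
     Rbar_lt (weighted_norm (fun z : C => (1 - Cmod z ^ 2) * v z) (C_derive f))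
             p_infty).

(* Semigroups of analytic functions, indexed by t >= 0; the values of
   [phi t] for t < 0 are never used. *)

Definition semigroup (phi : R -> C -> C) : Prop :=
  (forall t, 0 <= t -> analytic_self_map (phi t)) /\
  (forall z, disk z -> phi 0 z = z) /\
  (forall t s, 0 <= t -> 0 <= s ->
     forall z, disk z -> phi (t + s) z = phi t (phi s z)) /\
  (forall K : C -> Prop, compact_set K -> (forall z, K z -> disk z) ->
     forall eps : posreal,
       at_right 0 (fun t : R => forall z, K z -> Cmod (phi t z - phi 0 z) < eps)).

Definition nontrivial (phi : R -> C -> C) : Prop :=
  exists t : R, 0 <= t /\ exists z : C, disk z /\ phi t z <> z.

Definition infinitesimal_generator (phi : R -> C -> C) (G : C -> C) : Prop :=
  forall z, disk z ->
    filterlim (fun t : R => ((phi t z - z) / RtoC t)%C) (at_right 0)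
              (locally (G z)).

(* The point b of the Berkson-Porta representation of the generator. *)
Definition denjoy_wolff_point (phi : R -> C -> C) (b : C) : Prop :=
  Cmod b <= 1 /\
  exists G P : C -> C,
    infinitesimal_generator phi G /\
    analytic P /\
    (forall z, disk z -> 0 <= Re (P z)) /\
    (forall z, disk z -> G z = ((Cconj b * z - 1) * (z - b) * P z)%C).

(* [C_derive] is the complex derivative only where it exists, which is the case
   on [disk] for the maps of a semigroup. *)
Definition weighted_comp (phi : R -> C -> C) (t : R) (f : C -> C) : C -> C :=
  fun z : C => (C_derive (phi t) z * f (phi t z))%C.

Definition op_norm (v : C -> R) (T : (C -> C) -> C -> C) : Rbar :=
  Rbar_lub (fun y : Rbar => exists f : C -> C,
    Hv_infty v f /\ Rbar_le (weighted_norm v f) 1 /\ y = weighted_norm v (T f)).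

Definition bounded_operator (v : C -> R) (T : (C -> C) -> C -> C) : Prop :=
  (forall f, Hv_infty v f -> Hv_infty v (T f)) /\ Rbar_lt (op_norm v T) p_infty.

(* The space [phi_t', X] for X = Hv_infty v. *)
Definition strong_continuity_space
    (phi : R -> C -> C) (v : C -> R) (f : C -> C) : Prop :=
  Hv_infty v f /\
  forall eps : posreal,
    at_right 0 (fun t : R =>
      Rbar_lt (weighted_norm v (fun z : C => (weighted_comp phi t f z - f z)%C))
              eps).

(* Main.v *)
(* Since |b| = 1, the generator is G z = conj b (z - b)^2 P z with Re P >= 0, and the
   Herglotz bound |P z| = O(1 / (1 - |z|)) gives |G (r b)| = O(1 - r): along the radius
   ending at b the flow has bounded hyperbolic speed.

   Inclusion. The T_t are uniformly bounded for t <= 1 and dilations f (rho z) approximate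
   f in H_v^0, so it is enough to treat bounded Lipschitz g. Inside a compact disk phi_t is
   uniformly close to the identity. Near the circle v |phi_t'| is uniformly small: testing
   T_t on a monomial a z^n of norm at most 1 that is large at phi_t z gives
   v z |phi_t' z| = O(v r) as soon as |phi_t z| >= r, and points close enough to the circle
   cannot enter {|z| <= r} within a short time.

   Strictness. For h in H_v^infty with primitive H, the function
   f = (H o phi_d - H) / G, which is the integral of T_t h over 0 <= t <= d, always lies in
   [phi_t', H_v^infty]. Take for h a lacunary series of normalized monomials with peaks at
   |z| = r_k, so that v |h| >= 1/4 there. Quasi-normality makes h comparable with its peak
   value on {|z| <= (1 + r_k) / 2}, hence T_t h differs little from h at r_k b for t <= d
   with d independent of k, and v |f| >= d / 8 at all the points r_k b. *)

Require Import Defs.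
From Stdlib Require Import Reals Lra Lia Classical ClassicalEpsilon.
From Coquelicot Require Import Coquelicot.
Open Scope R_scope.

(** * Limits and derivatives *)

(** The generator is a limit from the right, so an orbit t -> phi_t z only comes with right
    derivatives. Left continuity is recovered from the equi-Lipschitz property of self-maps of the
    disk, and every estimate in time is a mean value inequality for right derivatives. For the same
    reason the integral of T_t h is never formed: (H o phi_d - H) / G stands for it, through the
    identity phi_t' G = G o phi_t. Averaging h over [0, d] is what creates strong continuity, since
    T_t f - f reduces to two averages over intervals of length t. The danger is that it also
    destroys the size of h near the circle. On the radius ending at b it does not, because there the
    orbit moves by a small hyperbolic distance during a time d that does not depend on the point.
    The division by G is legitimate because G has no zero in the disk: by the Herglotz bound, a zero
    of P forces P = 0, and then the semigroup is trivial. *)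

Lemma ball_C_Cmod (z w : C) (e : posreal) : ball z e w -> Cmod (w - z) < 2 * e.
Proof.
(* Balls of [C] are those of the product [R * R], that is squares, hence a factor sqrt 2. *)
intros H. apply Rlt_trans with (sqrt 2 * e).
- exact (C_NormedModule_mixin_compat2 z w e H).
- apply Rmult_lt_compat_r; [apply cond_pos|].
  assert (H1 : sqrt 2 * sqrt 2 = 2) by (apply sqrt_sqrt; lra). assert (H2 := sqrt_pos 2). nra.
Qed.

Lemma Cmod_ball_C (z w : C) (e : posreal) : Cmod (w - z) < e -> ball z e w.
Proof. exact (C_NormedModule_mixin_compat1 z w e). Qed.

Lemma locally_Cmod (z : C) (P : C -> Prop) :
  locally z P <-> exists d, 0 < d /\ forall w : C, Cmod (w - z) < d -> P w.
Proof.
split.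
- intros [d Hd]. exists d; split; [apply cond_pos|].
  intros w Hw. now apply Hd, Cmod_ball_C.
- intros [d [Hd H]]. assert (Hd2 : 0 < d / 2) by lra.
  exists (mkposreal _ Hd2). intros w Hw. apply H.
  apply ball_C_Cmod in Hw. simpl in Hw. lra.
Qed.

Lemma filterlim_C {T : Type} (F : (T -> Prop) -> Prop) {FF : Filter F}
  (f : T -> C) (l : C) :
  filterlim f F (locally l) <->
  forall e, 0 < e -> F (fun x => Cmod (f x - l) < e).
Proof.
split.
- intros H e He. apply (H (fun w => Cmod (w - l) < e)).
  apply locally_Cmod. exists e; split; auto.
- intros H P HP. apply locally_Cmod in HP. destruct HP as [d [Hd HP]].
  change (F (fun x => P (f x))).
  generalize (H d Hd). apply filter_imp. intros x Hx. now apply HP.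
Qed.

Section limits.
Context {T : Type} {F : (T -> Prop) -> Prop} {FF : Filter F}.
Implicit Types (f g : T -> C) (a b : C).

Lemma filterlim_Cplus f g a b :
  filterlim f F (locally a) -> filterlim g F (locally b) ->
  filterlim (fun x => (f x + g x)%C) F (locally (a + b)%C).
Proof.
intros Hf Hg. apply (filterlim_C F). intros e He.
assert (Hf' := proj1 (filterlim_C F f a) Hf).
assert (Hg' := proj1 (filterlim_C F g b) Hg).
assert (He2 : 0 < e / 2) by lra.
generalize (filter_and _ _ (Hf' _ He2) (Hg' _ He2)).
apply filter_imp. intros x [H1 H2].
replace (f x + g x - (a + b))%C with ((f x - a) + (g x - b))%C by ring.
eapply Rle_lt_trans; [apply Cmod_triangle|]. lra.
Qed.

Lemma filterlim_Cmult f g a b :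
  filterlim f F (locally a) -> filterlim g F (locally b) ->
  filterlim (fun x => (f x * g x)%C) F (locally (a * b)%C).
Proof.
intros Hf Hg. apply (filterlim_C F). intros e He.
assert (Hf' := proj1 (filterlim_C F f a) Hf).
assert (Hg' := proj1 (filterlim_C F g b) Hg).
assert (Ha := Cmod_ge_0 a). assert (Hb := Cmod_ge_0 b).
(* With both increments below d <= 1, the three terms of the expanded product add up to less than d
   (1 + |a| + |b|). *)
set (d := Rmin 1 (e / (1 + Cmod a + Cmod b))).
assert (Hq : 0 < e / (1 + Cmod a + Cmod b)) by (apply Rdiv_lt_0_compat; lra).
assert (Hd : 0 < d) by (apply Rmin_pos; lra).
assert (Hd1 : d <= 1) by apply Rmin_l.
assert (Hd2 : d * (1 + Cmod a + Cmod b) <= e).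
{ apply Rle_trans with (e / (1 + Cmod a + Cmod b) * (1 + Cmod a + Cmod b)).
  - apply Rmult_le_compat_r; [lra | apply Rmin_r].
  - right; field; lra. }
generalize (filter_and _ _ (Hf' d Hd) (Hg' d Hd)).
apply filter_imp. intros x [H1 H2].
replace (f x * g x - a * b)%C
  with ((f x - a) * (g x - b) + (a * (g x - b) + b * (f x - a)))%C by ring.
eapply Rle_lt_trans; [apply Cmod_triangle|].
eapply Rle_lt_trans; [apply Rplus_le_compat_l, Cmod_triangle|].
rewrite !Cmod_mult.
assert (H3 := Cmod_ge_0 (f x - a)). assert (H4 := Cmod_ge_0 (g x - b)).
assert (Cmod (f x - a) * Cmod (g x - b) < d * 1) by (apply Rmult_le_0_lt_compat; lra).
assert (Cmod a * Cmod (g x - b) <= Cmod a * d) by (apply Rmult_le_compat_l; lra).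
assert (Cmod b * Cmod (f x - a) <= Cmod b * d) by (apply Rmult_le_compat_l; lra).
lra.
Qed.

Lemma filterlim_Copp f a :
  filterlim f F (locally a) -> filterlim (fun x => (- f x)%C) F (locally (- a)%C).
Proof.
intros H. apply (filterlim_C F). intros e He.
generalize (proj1 (filterlim_C F f a) H e He). apply filter_imp. intros x Hx.
replace (- f x - - a)%C with (- (f x - a))%C by ring. now rewrite Cmod_opp.
Qed.

Lemma filterlim_Cminus f g a b :
  filterlim f F (locally a) -> filterlim g F (locally b) ->
  filterlim (fun x => (f x - g x)%C) F (locally (a - b)%C).
Proof. intros Hf Hg. now apply filterlim_Cplus, filterlim_Copp. Qed.

Lemma filterlim_RtoC (f : T -> R) (a : R) :
  filterlim f F (locally a) ->
  filterlim (fun x => RtoC (f x)) F (locally (RtoC a)).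
Proof.
intros H. apply (filterlim_C F). intros e He.
generalize (proj1 (filterlim_locally f a) H (mkposreal e He)). apply filter_imp.
intros x Hx. now rewrite <- RtoC_minus, Cmod_R.
Qed.

Lemma filterlim_Cinv f a :
  a <> 0 -> filterlim f F (locally a) ->
  filterlim (fun x => (/ f x)%C) F (locally (/ a)%C).
Proof.
intros Ha Hf. apply (filterlim_C F). intros e He.
assert (Ha' := proj1 (Cmod_gt_0 a) Ha).
(* The first bound keeps |f x| >= |a| / 2, so the denominator |f x| |a| is at least |a|^2 / 2, which
   the second bound absorbs. *)
set (d := Rmin (Cmod a / 2) (e * (Cmod a * Cmod a / 2))).
assert (Hd : 0 < d).
{ apply Rmin_pos; [lra|]. apply Rmult_lt_0_compat; nra. }
generalize (proj1 (filterlim_C F f a) Hf d Hd). apply filter_imp. intros x Hx.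
assert (H1 : d <= Cmod a / 2) by apply Rmin_l.
assert (H2 : d <= e * (Cmod a * Cmod a / 2)) by apply Rmin_r.
assert (H3 := Cmod_triangle (a - f x) (f x)).
replace (a - f x + f x)%C with a in H3 by ring.
replace (a - f x)%C with (- (f x - a))%C in H3 by ring. rewrite Cmod_opp in H3.
assert (Hfx : 0 < Cmod (f x)) by lra.
assert (f x <> 0) by now apply Cmod_gt_0.
replace (/ f x - / a)%C with (- (f x - a) / (f x * a))%C by (field; split; auto).
rewrite Cmod_div, Cmod_opp, Cmod_mult by now apply Cmult_neq_0.
assert (Hp : 0 < Cmod (f x) * Cmod a) by (apply Rmult_lt_0_compat; lra).
apply Rmult_lt_reg_r with (Cmod (f x) * Cmod a); auto.
unfold Rdiv. rewrite Rmult_assoc, Rinv_l, Rmult_1_r by lra.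
eapply Rlt_le_trans; [exact Hx|]. eapply Rle_trans; [exact H2|].
apply Rmult_le_compat_l; [lra|].
replace (Cmod a * Cmod a / 2) with (Cmod a / 2 * Cmod a) by field.
apply Rmult_le_compat_r; lra.
Qed.

End limits.

(** * Derivatives along a filter *)

(* Caratheodory's formulation of [f' (x) = l], the increment of the variable
   being measured by [i] and the limit taken along [F]: this covers complex
   derivatives ([i] the identity) as well as two-sided and one-sided derivatives
   of curves ([i = RtoC]). *)
Definition deriv_along {T : Type} (F : (T -> Prop) -> Prop) (i f : T -> C)
  (x : T) (l : C) : Prop :=
  exists q : T -> C, filterlim q F (locally l) /\
    F (fun y => (f y - f x = q y * (i y - i x))%C).

Definition cderiv (f : C -> C) (z l : C) : Prop :=
  deriv_along (locally z) (fun w => w) f z l.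

Section deriv_along_rules.
Context {T : Type} {F : (T -> Prop) -> Prop} {FF : Filter F} {i : T -> C} {x : T}.
Hypothesis i_cont : filterlim i F (locally (i x)).
Implicit Types f g : T -> C.

Lemma deriv_along_cont f l :
  deriv_along F i f x l -> filterlim f F (locally (f x)).
Proof using FF i_cont.
intros [q [Hq E]].
apply filterlim_ext_loc with (fun y => f x + q y * (i y - i x))%C.
- revert E. apply filter_imp. intros y Hy. rewrite <- Hy. ring.
- assert (Hx : (f x + l * (i x - i x))%C = f x) by ring.
  rewrite <- Hx at 1.
  apply filterlim_Cplus; [apply filterlim_const|].
  apply filterlim_Cmult; auto. apply filterlim_Cminus; auto. apply filterlim_const.
Qed.

Lemma deriv_along_const (c : C) : deriv_along F i (fun _ => c) x 0.
Proof using FF.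
exists (fun _ => RtoC 0). split; [apply filterlim_const|].
apply filter_forall. intros y. ring.
Qed.

Lemma deriv_along_id : deriv_along F i i x 1.
Proof using FF.
exists (fun _ => RtoC 1). split; [apply filterlim_const|].
apply filter_forall. intros y. ring.
Qed.

Lemma deriv_along_plus f g l m :
  deriv_along F i f x l -> deriv_along F i g x m ->
  deriv_along F i (fun y => f y + g y)%C x (l + m)%C.
Proof using FF.
intros [q [Hq E]] [p [Hp D]]. exists (fun y => q y + p y)%C.
split; [now apply filterlim_Cplus|].
generalize (filter_and _ _ E D). apply filter_imp. intros y [H1 H2].
replace (f y + g y - (f x + g x))%C with ((f y - f x) + (g y - g x))%C by ring.
rewrite H1, H2. ring.
Qed.

Lemma deriv_along_mult f g l m :
  deriv_along F i f x l -> deriv_along F i g x m ->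
  deriv_along F i (fun y => f y * g y)%C x (l * g x + f x * m)%C.
Proof using FF i_cont.
intros Hf Hg. assert (Hc := deriv_along_cont g m Hg).
destruct Hf as [q [Hq E]]. destruct Hg as [p [Hp D]].
exists (fun y => q y * g y + f x * p y)%C. split.
- apply filterlim_Cplus; apply filterlim_Cmult; auto. apply filterlim_const.
- generalize (filter_and _ _ E D). apply filter_imp. intros y [H1 H2].
  replace (f y * g y - f x * g x)%C
    with ((f y - f x) * g y + f x * (g y - g x))%C by ring.
  rewrite H1, H2. ring.
Qed.

Lemma deriv_along_comp (h : C -> C) g l m :
  cderiv h (g x) l -> deriv_along F i g x m ->
  deriv_along F i (fun y => h (g y)) x (l * m)%C.
Proof using FF i_cont.
intros [q [Hq E]] Hg. assert (Hc := deriv_along_cont g m Hg).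
destruct Hg as [p [Hp D]].
exists (fun y => q (g y) * p y)%C. split.
- apply filterlim_Cmult; auto. exact (filterlim_comp _ _ _ g q _ _ _ Hc Hq).
- assert (E' : F (fun y => (h (g y) - h (g x))%C = (q (g y) * (g y - g x))%C))
    by exact (Hc _ E).
  generalize (filter_and _ _ E' D). apply filter_imp. intros y [H1 H2].
  rewrite H1, H2. ring.
Qed.

Lemma deriv_along_eq f l m : l = m -> deriv_along F i f x l -> deriv_along F i f x m.
Proof. now intros ->. Qed.

Lemma deriv_along_ext f g l :
  F (fun y => f y = g y) -> f x = g x ->
  deriv_along F i f x l -> deriv_along F i g x l.
Proof using FF.
intros H Hx [q [Hq E]]. exists q. split; auto.
generalize (filter_and _ _ H E). apply filter_imp. intros y [H1 H2].
now rewrite <- H1, <- Hx.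
Qed.

End deriv_along_rules.

Lemma cderiv_const (c z : C) : cderiv (fun _ => c) z 0.
Proof. apply deriv_along_const. Qed.

Lemma cderiv_id (z : C) : cderiv (fun w => w) z 1.
Proof. apply (deriv_along_id (F := locally z) (i := fun w : C => w)). Qed.

Lemma cderiv_cont f z l : cderiv f z l -> filterlim f (locally z) (locally (f z)).
Proof.
intros H. eapply (deriv_along_cont (F := locally z) (i := fun w => w)); eauto.
apply filterlim_id.
Qed.

Lemma cderiv_plus f g z l m : cderiv f z l -> cderiv g z m ->
  cderiv (fun w => f w + g w)%C z (l + m)%C.
Proof. apply deriv_along_plus. Qed.

Lemma cderiv_mult f g z l m : cderiv f z l -> cderiv g z m ->
  cderiv (fun w => f w * g w)%C z (l * g z + f z * m)%C.
Proof. apply deriv_along_mult, filterlim_id. Qed.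

Lemma cderiv_comp f g z l m : cderiv f (g z) l -> cderiv g z m ->
  cderiv (fun w => f (g w)) z (l * m)%C.
Proof. apply deriv_along_comp, filterlim_id. Qed.

Lemma cderiv_eq f z l m : l = m -> cderiv f z l -> cderiv f z m.
Proof. now intros ->. Qed.

Lemma cderiv_scal c f z l : cderiv f z l -> cderiv (fun w => c * f w)%C z (c * l)%C.
Proof.
intros H. apply (cderiv_eq _ _ (0 * f z + c * l)%C); [ring|].
apply (cderiv_mult (fun _ => c)); auto. apply cderiv_const.
Qed.

Lemma cderiv_minus f g z l m : cderiv f z l -> cderiv g z m ->
  cderiv (fun w => f w - g w)%C z (l - m)%C.
Proof.
intros Hf Hg. apply (deriv_along_ext (fun w => f w + (-(1)) * g w)%C).
- apply filter_forall. intros y; ring.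
- ring.
- replace (l - m)%C with (l + (-(1)) * m)%C by ring.
  apply cderiv_plus; auto. now apply cderiv_scal.
Qed.

Lemma cderiv_inv (z : C) : z <> 0 -> cderiv (fun w => / w)%C z (- / (z * z))%C.
Proof.
intros Hz. exists (fun w => - / (w * z))%C. split.
- apply filterlim_Copp, filterlim_Cinv; [now apply Cmult_neq_0|].
  apply filterlim_Cmult; [apply filterlim_id | apply filterlim_const].
- apply locally_Cmod. exists (Cmod z). split; [now apply Cmod_gt_0|].
  intros w Hw. assert (w <> 0).
  { intros ->. replace (0 - z)%C with (- z)%C in Hw by ring.
    rewrite Cmod_opp in Hw. lra. }
  field. auto.
Qed.

Lemma cderiv_pow (n : nat) (z : C) :
  cderiv (fun w => w ^ n)%C z (INR n * z ^ (pred n))%C.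
Proof.
induction n as [|n IH].
- apply (cderiv_eq _ _ 0); [simpl; ring|]. apply (cderiv_const 1).
- apply (cderiv_eq _ _ (1 * z ^ n + z * (INR n * z ^ (pred n)))%C).
  + rewrite S_INR, RtoC_plus. destruct n as [|n]; [simpl; ring|].
    change (pred (S (S n))) with (S n). change (pred (S n)) with n.
    rewrite !(Cpow_S z n). ring.
  + apply (cderiv_mult (fun w => w) (fun w => w ^ n)%C); auto. apply cderiv_id.
Qed.

(** The slope form suits the algebraic rules, this form suits estimates. Conversely the slope is the
    difference quotient, completed by l at z itself. *)
Lemma cderiv_eps f z l :
  cderiv f z l <->
  forall e, 0 < e -> exists d, 0 < d /\
    forall w, Cmod (w - z) < d -> Cmod (f w - f z - l * (w - z)) <= e * Cmod (w - z).
Proof.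
split.
- intros [q [Hq E]] e He.
  assert (H := filter_and _ _ (proj1 (filterlim_C _ _ _) Hq e He) E).
  apply locally_Cmod in H. destruct H as [d [Hd H]].
  exists d; split; auto. intros w Hw. destruct (H w Hw) as [H1 H2].
  rewrite H2. replace (q w * (w - z) - l * (w - z))%C with ((q w - l) * (w - z))%C by ring.
  rewrite Cmod_mult. apply Rmult_le_compat_r; [apply Cmod_ge_0 | lra].
- intros H.
  exists (fun w => if excluded_middle_informative (w = z) then l
                   else (f w - f z) / (w - z))%C.
  split.
  + apply filterlim_C; [typeclasses eauto|]. intros e He.
    apply locally_Cmod. destruct (H (e / 2)) as [d [Hd H1]]; [lra|].
    exists d; split; auto. intros w Hw.
    destruct (excluded_middle_informative (w = z)) as [->|Hn].
    * replace (l - l)%C with (RtoC 0) by ring. now rewrite Cmod_0.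
    * assert (Hz : (w - z)%C <> 0) by now apply Cminus_eq_contra.
      replace ((f w - f z) / (w - z) - l)%C
        with ((f w - f z - l * (w - z)) / (w - z))%C by (field; auto).
      rewrite Cmod_div by auto. apply Rle_lt_trans with (e / 2); [|lra].
      apply Rmult_le_reg_r with (Cmod (w - z)); [now apply Cmod_gt_0|].
      unfold Rdiv at 1. rewrite Rmult_assoc, Rinv_l, Rmult_1_r; auto.
      apply Rgt_not_eq. now apply Cmod_gt_0.
  + apply filter_forall. intros w. change C in w.
    destruct (excluded_middle_informative (w = z)) as [->|Hn]; [ring|].
    assert (Hz : (w - z)%C <> 0) by now apply Cminus_eq_contra.
    field; auto.
Qed.

Lemma is_derive_cderiv (f : C -> C) (z l : C) :
  is_derive (K := C_AbsRing) (V := C_NormedModule) f z l <-> cderiv f z l.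
Proof.
rewrite cderiv_eps. split.
- intros [_ H] e He.
  specialize (H z (fun P HP => HP) (mkposreal e He)).
  destruct H as [d Hd]. exists d; split; [apply cond_pos|].
  intros w Hw. specialize (Hd w Hw). simpl in Hd.
  replace (l * (w - z))%C with ((w - z) * l)%C by ring. exact Hd.
- intros H. split.
  + apply is_linear_scal_l.
  + intros y Hy e.
    assert (Hyz : z = y) by exact (is_filter_lim_locally_unique
      (V := AbsRing_NormedModule C_AbsRing) z y Hy).
    subst y. destruct (H e (cond_pos e)) as [d [Hd H1]].
    exists (mkposreal d Hd). intros w Hw. specialize (H1 w Hw).
    replace (l * (w - z))%C with ((w - z) * l)%C in H1 by ring. exact H1.
Qed.

(** * Integrals of complex-valued functions *)

Definition CInt (f : R -> C) (a b : R) : C :=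
  RInt (V := C_R_CompleteNormedModule) f a b.

Definition is_CInt (f : R -> C) (a b : R) (l : C) : Prop :=
  is_RInt (V := C_R_NormedModule) f a b l.

Definition ccont_on (f : R -> C) (a b : R) : Prop :=
  forall t, Rmin a b <= t <= Rmax a b -> filterlim f (locally t) (locally (f t)).

Lemma CInt_correct f a b : ccont_on f a b -> is_CInt f a b (CInt f a b).
Proof.
intros H. apply (RInt_correct (V := C_R_CompleteNormedModule)).
now apply (ex_RInt_continuous (V := C_R_CompleteNormedModule)).
Qed.

Lemma is_CInt_unique f a b l : is_CInt f a b l -> CInt f a b = l.
Proof. apply (is_RInt_unique (V := C_R_CompleteNormedModule)). Qed.

Lemma is_CInt_pair f a b l :
  is_CInt f a b l <->
  is_RInt (fun t => Re (f t)) a b (Re l) /\ is_RInt (fun t => Im (f t)) a b (Im l).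
Proof.
split.
- intros H. split.
  + exact (is_RInt_fct_extend_fst f a b l H).
  + exact (is_RInt_fct_extend_snd f a b l H).
- intros [H1 H2]. exact (is_RInt_fct_extend_pair (U := R_NormedModule) (V := R_NormedModule)
    f a b (fst l) (snd l) H1 H2).
Qed.

(** The integral is taken in the real normed space underlying [C], so it is real linear by
    construction. Complex linearity has to go through real and imaginary parts. *)
Lemma is_CInt_mult (c : C) f a b l :
  is_CInt f a b l -> is_CInt (fun t => c * f t)%C a b (c * l)%C.
Proof.
rewrite !is_CInt_pair. intros [H1 H2]. split; simpl.
- apply (is_RInt_minus (fun t => fst c * Re (f t)) (fun t => snd c * Im (f t))).
  + exact (is_RInt_scal _ _ _ (fst c) _ H1).
  + exact (is_RInt_scal _ _ _ (snd c) _ H2).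
- apply (is_RInt_plus (fun t => fst c * Im (f t)) (fun t => snd c * Re (f t))).
  + exact (is_RInt_scal _ _ _ (fst c) _ H2).
  + exact (is_RInt_scal _ _ _ (snd c) _ H1).
Qed.

Lemma is_CInt_plus f g a b l m :
  is_CInt f a b l -> is_CInt g a b m -> is_CInt (fun t => f t + g t)%C a b (l + m)%C.
Proof. intros H1 H2. exact (is_RInt_plus (V := C_R_NormedModule) f g a b l m H1 H2). Qed.

Lemma is_CInt_minus f g a b l m :
  is_CInt f a b l -> is_CInt g a b m -> is_CInt (fun t => f t - g t)%C a b (l - m)%C.
Proof. intros H1 H2. exact (is_RInt_minus (V := C_R_NormedModule) f g a b l m H1 H2). Qed.

Lemma is_CInt_conj f a b l :
  is_CInt f a b l -> is_CInt (fun t => Cconj (f t)) a b (Cconj l).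
Proof.
rewrite !is_CInt_pair. intros [H1 H2]. split; simpl; auto.
exact (is_RInt_opp _ _ _ _ H2).
Qed.

Lemma is_CInt_ext f g a b l :
  (forall t, Rmin a b <= t <= Rmax a b -> f t = g t) ->
  is_CInt f a b l -> is_CInt g a b l.
Proof.
intros H. apply (is_RInt_ext (V := C_R_NormedModule)). intros x Hx. apply H. lra.
Qed.

Lemma is_CInt_const (c : C) a b : is_CInt (fun _ => c) a b (RtoC (b - a) * c)%C.
Proof.
rewrite <- scal_R_Cmult. exact (is_RInt_const (V := C_R_NormedModule) a b c).
Qed.

Lemma norm_C_R (z : C) : norm (V := C_R_NormedModule) z = Cmod z.
Proof.
change (sqrt (Rabs (fst z) ^ 2 + Rabs (snd z) ^ 2) = sqrt (fst z ^ 2 + snd z ^ 2)).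
now rewrite !pow2_abs.
Qed.

Lemma is_CInt_bound f a b l (g : R -> R) m :
  a <= b -> (forall t, a <= t <= b -> Cmod (f t) <= g t) ->
  is_CInt f a b l -> is_RInt g a b m -> Cmod l <= m.
Proof.
intros Hab H Hl Hm. rewrite <- norm_C_R.
apply (norm_RInt_le (V := C_R_NormedModule) f g a b l m Hab); auto.
intros x Hx. rewrite norm_C_R. auto.
Qed.

Lemma is_CInt_bound_const f a b l M :
  a <= b -> (forall t, a <= t <= b -> Cmod (f t) <= M) ->
  is_CInt f a b l -> Cmod l <= (b - a) * M.
Proof.
intros Hab H Hl. apply (is_CInt_bound f a b l (fun _ => M) _ Hab H Hl).
exact (is_RInt_const a b M).
Qed.

Lemma is_CInt_derive (f df : R -> C) a b :
  (forall t, Rmin a b <= t <= Rmax a b ->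
     deriv_along (locally t) RtoC f t (df t)) ->
  ccont_on df a b -> is_CInt df a b (f b - f a)%C.
Proof.
intros Hd Hc.
apply (is_RInt_derive (V := C_R_CompleteNormedModule) f df a b); auto.
intros t Ht. destruct (Hd t Ht) as [q [Hq E]].
split; [apply is_linear_scal_l|].
intros y Hy e.
assert (Hyz : t = y) by exact (is_filter_lim_locally_unique
      (V := R_NormedModule) t y Hy).
subst y.
generalize (filter_and _ _ (proj1 (filterlim_C _ _ _) Hq e (cond_pos e)) E).
apply filter_imp. intros s [H1 H2].
change (norm (V := C_R_NormedModule)
  (f s - f t - scal (V := C_R_NormedModule) (s - t)%R (df t))%C <= e * Rabs (s - t)).
rewrite norm_C_R, H2, scal_R_Cmult, <- RtoC_minus.
replace (q s * RtoC (s - t)%R - RtoC (s - t)%R * df t)%C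
  with ((q s - df t) * RtoC (s - t)%R)%C by ring.
rewrite Cmod_mult, Cmod_R. apply Rmult_le_compat_r; [apply Rabs_pos | lra].
Qed.

Lemma deriv_R_cont (g : R -> C) t l :
  deriv_along (locally t) RtoC g t l -> filterlim g (locally t) (locally (g t)).
Proof.
apply (deriv_along_cont (F := locally t) (i := RtoC)).
apply (filterlim_RtoC (F := locally t) (fun s : R => s)). apply filterlim_id.
Qed.

Lemma deriv_R_comp (f : C -> C) (g : R -> C) t l m :
  cderiv f (g t) l -> deriv_along (locally t) RtoC g t m ->
  deriv_along (locally t) RtoC (fun s => f (g s)) t (l * m)%C.
Proof.
apply (deriv_along_comp (F := locally t) (i := RtoC)).
apply (filterlim_RtoC (F := locally t) (fun s : R => s)). apply filterlim_id.
Qed.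

Lemma deriv_R_line (a d : C) t :
  deriv_along (locally t) RtoC (fun s => a + RtoC s * d)%C t d.
Proof.
exists (fun _ => d). split; [apply filterlim_const|].
apply filter_forall. intros s. ring.
Qed.

(** * Goursat's theorem and primitives *)

Lemma RtoC_neq (x y : R) : x <> y -> RtoC x <> RtoC y.
Proof. intros H E. now apply H, RtoC_inj. Qed.

Lemma Cmod_minus_sym (a b : C) : Cmod (a - b) = Cmod (b - a).
Proof. rewrite <- Cmod_opp. f_equal. ring. Qed.

Lemma Cmod_le_plus (a b : C) (x y : R) :
  Cmod a <= x -> Cmod b <= y -> Cmod (a + b) <= x + y.
Proof. intros. eapply Rle_trans; [apply Cmod_triangle|]. lra. Qed.

Lemma Cmod_dist_triangle (a b c : C) : Cmod (a - c) <= Cmod (a - b) + Cmod (b - c).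
Proof. replace (a - c)%C with ((a - b) + (b - c))%C by ring. apply Cmod_triangle. Qed.

Lemma Cmod_segment (a b p : C) (t r : R) :
  0 <= t <= 1 -> Cmod (a - p) <= r -> Cmod (b - p) <= r ->
  Cmod (a + RtoC t * (b - a) - p) <= r.
Proof.
intros Ht Ha Hb.
replace (a + RtoC t * (b - a) - p)%C
  with (RtoC (1 - t) * (a - p) + RtoC t * (b - p))%C by (rewrite RtoC_minus; ring).
eapply Rle_trans; [apply Cmod_triangle|].
rewrite !Cmod_mult, !Cmod_R, !Rabs_pos_eq by lra. nra.
Qed.

Lemma Cmod_limit_le (x : nat -> C) (p q : C) (M : R) (N : nat) :
  filterlim x eventually (locally p) -> (forall n, (N <= n)%nat -> Cmod (x n - q) <= M) ->
  Cmod (p - q) <= M.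
Proof.
intros Hx H. apply le_epsilon. intros e He.
destruct (proj1 (filterlim_C eventually x p) Hx e He) as [K HK].
specialize (HK (Nat.max K N) (Nat.le_max_l _ _)).
specialize (H (Nat.max K N) (Nat.le_max_r _ _)).
eapply Rle_trans; [apply (Cmod_dist_triangle p (x (Nat.max K N)) q)|].
rewrite Cmod_minus_sym. lra.
Qed.

(** Completeness enters through the telescoping series of the increments, which is dominated by a
    geometric one. *)
Lemma geometric_limit (x : nat -> C) (d : R) :
  (forall n, Cmod (x (S n) - x n) <= d * (1 / 2) ^ n) ->
  exists p, forall n, Cmod (p - x n) <= 2 * d * (1 / 2) ^ n.
Proof.
intros H.
assert (Hs : ex_series (K := R_AbsRing) (V := C_R_CompleteNormedModule)
  (fun n => x (S n) - x n)%C).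
{ apply (ex_series_le _ (fun n => d * (1 / 2) ^ n)).
  - intros n. change (norm (V := C_R_NormedModule) (x (S n) - x n)%C <= d * (1 / 2) ^ n).
    now rewrite norm_C_R.
  - apply (ex_series_scal_l d (fun n => (1 / 2) ^ n)). apply ex_series_geom.
    rewrite Rabs_pos_eq; lra. }
destruct Hs as [l Hl]. exists (x O + l)%C.
assert (Hsum : forall n, sum_n (G := C_R_CompleteNormedModule)
   (fun n => x (S n) - x n)%C n = (x (S n) - x O)%C).
{ induction n; [now rewrite sum_O|]. rewrite sum_Sn, IHn.
  change ((x (S n) - x O) + (x (S (S n)) - x (S n)) = x (S (S n)) - x O)%C. ring. }
(* The subtracted tail makes the induction on m close exactly. *)
assert (Hd : forall n m, Cmod (x (n + m)%nat - x n) <=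
   2 * d * (1 / 2) ^ n - 2 * d * (1/2) ^ (n + m)).
{ intros n. induction m as [|m IH].
  - rewrite Nat.add_0_r. replace (x n - x n)%C with (RtoC 0) by ring. rewrite Cmod_0. lra.
  - rewrite Nat.add_succ_r.
    eapply Rle_trans; [apply (Cmod_dist_triangle _ (x (n + m)%nat))|].
    specialize (H (n + m)%nat).
    change ((1 / 2) ^ S (n + m)) with (1 / 2 * (1 / 2) ^ (n + m)). lra. }
intros n.
assert (Hlim : filterlim (fun m => x (S m)) eventually (locally (x O + l)%C)).
{ apply (filterlim_ext (fun m => x O + (x (S m) - x O))%C).
  - intros m. ring.
  - apply filterlim_Cplus; [apply filterlim_const|].
    eapply filterlim_ext; [|exact Hl]. intros m. apply Hsum. }
apply (Cmod_limit_le _ _ _ _ n Hlim). intros m Hm.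
specialize (Hd n (S m - n)%nat). replace (n + (S m - n))%nat with (S m) in Hd by lia.
assert (0 <= (1 / 2) ^ S m) by (apply pow_le; lra).
assert (0 <= d). { specialize (H O). simpl in H. assert (Hc := Cmod_ge_0 (x 1%nat - x 0%nat)). lra. }
nra.
Qed.

Definition holo (rho : R) (f : C -> C) : Prop :=
  forall z, Cmod z < rho -> exists l, cderiv f z l.

(** The line integral of f along the oriented segment from a to b. *)
Definition seg (f : C -> C) (a b : C) : C :=
  ((b - a) * CInt (fun t => f (a + RtoC t * (b - a)))%C 0 1)%C.

Lemma holo_cont rho f z : holo rho f -> Cmod z < rho -> filterlim f (locally z) (locally (f z)).
Proof. intros H Hz. destruct (H z Hz) as [l Hl]. now apply cderiv_cont with l. Qed.

Lemma holo_segment_cont rho f a b :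
  holo rho f -> Cmod a < rho -> Cmod b < rho ->
  ccont_on (fun t => f (a + RtoC t * (b - a)))%C 0 1.
Proof.
intros Hf Ha Hb t Ht. rewrite Rmin_left, Rmax_right in Ht by lra.
assert (Hz : Cmod (a + RtoC t * (b - a)) < rho).
{ apply Rle_lt_trans with (Rmax (Cmod a) (Cmod b)); [|now apply Rmax_lub_lt].
  replace (a + RtoC t * (b - a))%C with (a + RtoC t * (b - a) - 0)%C by ring.
  apply Cmod_segment; auto.
  - replace (a - 0)%C with a by ring. apply Rmax_l.
  - replace (b - 0)%C with b by ring. apply Rmax_r. }
destruct (Hf _ Hz) as [l Hl].
apply deriv_R_cont with (l * (b - a))%C.
apply (deriv_R_comp f (fun s => a + RtoC s * (b - a))%C); auto. apply deriv_R_line.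
Qed.

Lemma seg_unique f a b l :
  is_CInt (fun t => f (a + RtoC t * (b - a)))%C 0 1 l -> seg f a b = ((b - a) * l)%C.
Proof. intros H. unfold seg. now rewrite (is_CInt_unique _ _ _ _ H). Qed.

Lemma is_CInt_comp_lin (g : R -> C) (u v p q : R) l :
  p = v -> q = u + v -> is_CInt g p q l -> is_CInt (fun t => RtoC u * g (u * t + v)%R)%C 0 1 l.
Proof.
intros -> -> H. apply (is_CInt_ext (fun t => scal (V := C_R_NormedModule) u (g (u * t + v)))).
- intros t _. now rewrite scal_R_Cmult.
- apply (is_RInt_comp_lin (V := C_R_NormedModule) g u v 0 1).
  now rewrite Rmult_0_r, Rmult_1_r, Rplus_0_l.
Qed.

Lemma seg_rev rho f a b :
  holo rho f -> Cmod a < rho -> Cmod b < rho -> seg f b a = (- seg f a b)%C.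
Proof.
intros Hf Ha Hb.
assert (H := CInt_correct _ _ _ (holo_segment_cont rho f a b Hf Ha Hb)).
unfold seg at 2. set (L := CInt _ 0 1) in *.
apply (is_RInt_swap (V := C_R_NormedModule)) in H.
change (is_CInt (fun t => f (a + RtoC t * (b - a)))%C 1 0 (- L)%C) in H.
apply (is_CInt_comp_lin _ (-1) 1) in H; [|ring|ring]. apply (is_CInt_mult (-(1))%C) in H.
replace (- ((b - a) * L))%C with ((a - b) * (-(1) * -L))%C by ring.
apply seg_unique. revert H. apply is_CInt_ext. intros t _.
rewrite RtoC_plus, RtoC_mult.
replace (a + (RtoC (-1) * RtoC t + 1) * (b - a))%C with (b + RtoC t * (a - b))%C
  by (change (-1) with (- (1)); rewrite RtoC_opp; ring).
change (-1) with (- (1)); rewrite RtoC_opp; ring.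
Qed.

Lemma seg_mid rho f a b :
  holo rho f -> Cmod a < rho -> Cmod b < rho ->
  seg f a b = (seg f a ((a + b) / 2) + seg f ((a + b) / 2) b)%C.
Proof.
intros Hf Ha Hb.
assert (Hc := holo_segment_cont rho f a b Hf Ha Hb).
set (g := fun t : R => (f (a + RtoC t * (b - a)))%C) in *.
assert (H1 : is_CInt g 0 (1 / 2) (CInt g 0 (1 / 2))).
{ apply CInt_correct. intros t Ht. apply Hc. revert Ht. unfold Rmin, Rmax.
  repeat destruct Rle_dec; lra. }
assert (H2 : is_CInt g (1 / 2) 1 (CInt g (1 / 2) 1)).
{ apply CInt_correct. intros t Ht. apply Hc. revert Ht. unfold Rmin, Rmax.
  repeat destruct Rle_dec; lra. }
assert (H := is_RInt_Chasles (V := C_R_NormedModule) g 0 (1/2) 1 _ _ H1 H2).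
rewrite (seg_unique f a b _ H).
apply (is_CInt_comp_lin _ (1 / 2) 0) in H1; [|ring|ring].
apply (is_CInt_comp_lin _ (1 / 2) (1 / 2)) in H2; [|field|field].
assert (Eh : RtoC (1 / 2) = (1 / 2)%C) by (rewrite RtoC_div; auto; lra).
assert (E2 : RtoC 2 <> 0) by (apply RtoC_neq; lra).
apply (is_CInt_mult 2%C) in H1. apply (is_CInt_mult 2%C) in H2.
rewrite (seg_unique f a _ (2 * CInt g 0 (1 / 2))%C), (seg_unique f _ b (2 * CInt g (1 / 2) 1)%C).
- change (plus (CInt g 0 (1 / 2)) (CInt g (1 / 2) 1))
    with (CInt g 0 (1 / 2) + CInt g (1 / 2) 1)%C. field; auto.
- revert H2. apply is_CInt_ext. intros t _. unfold g.
  rewrite RtoC_plus, RtoC_mult, Eh.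
  replace (a + (1 / 2 * RtoC t + 1 / 2) * (b - a))%C
    with ((a + b) / 2 + RtoC t * (b - (a + b) / 2))%C by (field; auto).
  field; auto.
- revert H1. apply is_CInt_ext. intros t _. unfold g.
  rewrite RtoC_plus, RtoC_mult, Eh.
  replace (a + (1 / 2 * RtoC t + 0) * (b - a))%C
    with (a + RtoC t * ((a + b) / 2 - a))%C by (field; auto).
  field; auto.
Qed.

(** The subtracted term is the exact integral of the affine map z -> u + w (z - p). Around a
    triangle these terms cancel, so only the error e times the perimeter survives in Goursat's
    argument; with w = 0 the lemma also differentiates the primitive. *)
Lemma seg_affine_approx rho f a b p u w e :
  holo rho f -> Cmod a < rho -> Cmod b < rho ->
  (forall t, 0 <= t <= 1 ->
     Cmod (f (a + RtoC t * (b - a)) - (u + w * (a + RtoC t * (b - a) - p))) <= e)%C ->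
  Cmod (seg f a b - (u * (b - a) + w * ((b - p) * (b - p) - (a - p) * (a - p)) / 2))%C
  <= e * Cmod (b - a).
Proof.
intros Hf Ha Hb H.
assert (E2 : RtoC 2 <> 0) by (apply RtoC_neq; lra).
assert (H1 := CInt_correct _ _ _ (holo_segment_cont rho f a b Hf Ha Hb)).
assert (H2 : is_CInt (fun t => u + w * (a + RtoC t * (b - a) - p))%C 0 1
   ((RtoC 1 * u + w * (RtoC 1 * (a - p) + RtoC 1 * RtoC 1 * (b - a) / 2))
    - (RtoC 0 * u + w * (RtoC 0 * (a - p) + RtoC 0 * RtoC 0 * (b - a) / 2)))%C).
{ apply (is_CInt_derive
    (fun t => (RtoC t * u + w * (RtoC t * (a - p) + RtoC t * RtoC t * (b - a) / 2)))%C).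
  - intros t _. exists (fun s => u + w * ((a - p) + (RtoC s + RtoC t) * (b - a) / 2))%C.
    split.
    + apply filterlim_Cplus; [apply filterlim_const|].
      apply filterlim_Cmult; [apply filterlim_const|].
      replace (a + RtoC t * (b - a) - p)%C
        with ((a - p) + (RtoC t + RtoC t) * (b - a) * / 2)%C by (field; auto).
      apply filterlim_Cplus; [apply filterlim_const|].
      apply filterlim_Cmult; [|apply filterlim_const].
      apply filterlim_Cmult; [|apply filterlim_const].
      apply filterlim_Cplus; [|apply filterlim_const].
      apply (filterlim_RtoC (F := locally t) (fun s : R => s)). apply filterlim_id.
    + apply filter_forall. intros s. field; auto.
  - intros t _. apply deriv_R_cont with (w * (b - a))%C.
    exists (fun _ => w * (b - a))%C. split; [apply filterlim_const|].
    apply filter_forall. intros s. ring. }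
assert (H3 := is_CInt_minus _ _ _ _ _ _ H1 H2).
apply (is_CInt_bound_const _ _ _ _ e) in H3; [|lra|exact H].
unfold seg. set (L := CInt _ 0 1) in *.
match type of H3 with Cmod ?X <= _ =>
  replace (Cmod _) with (Cmod (b - a) * Cmod X);
  [|rewrite <- Cmod_mult; f_equal; field; auto] end.
rewrite Rmult_comm. apply Rmult_le_compat_r; [apply Cmod_ge_0|]. lra.
Qed.

Definition tri (f : C -> C) (a b c : C) : C := (seg f a b + seg f b c + seg f c a)%C.

Definition perimeter (a b c : C) : R := Cmod (b - a) + Cmod (c - b) + Cmod (a - c).

Lemma tri_split rho f a b c :
  holo rho f -> Cmod a < rho -> Cmod b < rho -> Cmod c < rho ->
  Cmod ((a + b) / 2) < rho -> Cmod ((b + c) / 2) < rho -> Cmod ((c + a) / 2) < rho ->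
  tri f a b c = (tri f a ((a + b) / 2) ((c + a) / 2) + tri f ((a + b) / 2) b ((b + c) / 2)
    + tri f ((c + a) / 2) ((b + c) / 2) c + tri f ((a + b) / 2) ((b + c) / 2) ((c + a) / 2))%C.
Proof.
intros Hf Ha Hb Hc Hab Hbc Hca. unfold tri.
rewrite (seg_mid rho f a b), (seg_mid rho f b c), (seg_mid rho f c a) by auto.
rewrite (seg_rev rho f ((a + b) / 2) ((b + c) / 2)),
  (seg_rev rho f ((b + c) / 2) ((c + a) / 2)),
  (seg_rev rho f ((c + a) / 2) ((a + b) / 2)) by auto.
ring.
Qed.

Lemma Cmod_midpoint (a b : C) r : Cmod a <= r -> Cmod b <= r -> Cmod ((a + b) / 2) <= r.
Proof.
intros Ha Hb. assert (E2 : RtoC 2 <> 0) by (apply RtoC_neq; lra).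
rewrite Cmod_div, Cmod_R, Rabs_pos_eq by (auto; lra).
assert (H := Cmod_triangle a b). lra.
Qed.

Lemma Cmod_half (a b : C) : (a = b / 2)%C -> Cmod a = Cmod b / 2.
Proof.
intros ->. rewrite Cmod_div, Cmod_R, Rabs_pos_eq; try lra.
apply RtoC_neq; lra.
Qed.

(** Of the four triangles cut out by the midpoints, one carries at least a quarter of the integral.
    The last clause makes the first vertices of the nested triangles converge. *)
Lemma tri_step rho f r a b c :
  holo rho f -> r < rho -> Cmod a <= r -> Cmod b <= r -> Cmod c <= r ->
  exists a' b' c', (Cmod a' <= r /\ Cmod b' <= r /\ Cmod c' <= r) /\
    perimeter a' b' c' = perimeter a b c / 2 /\
    Cmod (tri f a b c) / 4 <= Cmod (tri f a' b' c') /\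
    Cmod (a' - a) <= perimeter a b c.
Proof.
intros Hf Hr Ha Hb Hc.
assert (E2 : RtoC 2 <> 0) by (apply RtoC_neq; lra).
assert (Hab := Cmod_midpoint a b r Ha Hb). assert (Hbc := Cmod_midpoint b c r Hb Hc).
assert (Hca := Cmod_midpoint c a r Hc Ha).
assert (S := tri_split rho f a b c Hf ltac:(lra) ltac:(lra) ltac:(lra)
  ltac:(lra) ltac:(lra) ltac:(lra)).
set (m := ((a + b) / 2)%C) in *. set (n := ((b + c) / 2)%C) in *.
set (k := ((c + a) / 2)%C) in *.
assert (P1 := Cmod_ge_0 (b - a)). assert (P2 := Cmod_ge_0 (c - b)).
assert (P3 := Cmod_ge_0 (a - c)).
assert (D1 : Cmod (m - a) = Cmod (b - a) / 2)
  by (apply Cmod_half; unfold m; field; auto).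
assert (D2 : Cmod (k - a) = Cmod (a - c) / 2)
  by (rewrite (Cmod_minus_sym a c); apply Cmod_half; unfold k; field; auto).
assert (Q : Cmod (tri f a b c) / 4 <= Cmod (tri f a m k) \/
  Cmod (tri f a b c) / 4 <= Cmod (tri f m b n) \/
  Cmod (tri f a b c) / 4 <= Cmod (tri f k n c) \/
  Cmod (tri f a b c) / 4 <= Cmod (tri f m n k)).
{ assert (Cmod (tri f a b c) <= Cmod (tri f a m k) + Cmod (tri f m b n)
     + Cmod (tri f k n c) + Cmod (tri f m n k)).
  { rewrite S. repeat (apply Cmod_le_plus; [|lra]). lra. }
  lra. }
assert (Hper : forall x y z, Cmod x = Cmod (b - a) / 2 -> Cmod y = Cmod (c - b) / 2 ->
  Cmod z = Cmod (a - c) / 2 -> Cmod x + Cmod y + Cmod z = perimeter a b c / 2).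
{ intros x y z -> -> ->. unfold perimeter. lra. }
destruct Q as [Q|[Q|[Q|Q]]].
- exists a, m, k. repeat split; auto.
  + apply Hper; [auto | apply Cmod_half; unfold k, m; field; auto
                | rewrite Cmod_minus_sym; auto].
  + replace (a - a)%C with (RtoC 0) by ring. rewrite Cmod_0. unfold perimeter. lra.
- exists m, b, n. repeat split; auto.
  + apply Hper; apply Cmod_half; unfold m, n; field; auto.
  + unfold perimeter. lra.
- exists k, n, c. repeat split; auto.
  + apply Hper; apply Cmod_half; unfold k, n; field; auto.
  + unfold perimeter. lra.
- exists m, n, k. repeat split; auto.
  + unfold perimeter.
    rewrite (Cmod_minus_sym n m), (Cmod_minus_sym k n), (Cmod_minus_sym m k).
    rewrite (Cmod_half (m - n) (a - c)), (Cmod_half (n - k) (b - a)),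
      (Cmod_half (k - m) (c - b)); [lra| | |]; unfold k, m, n; field; auto.
  + unfold perimeter. lra.
Qed.

Lemma goursat rho f a b c :
  holo rho f -> Cmod a < rho -> Cmod b < rho -> Cmod c < rho -> tri f a b c = 0.
Proof.
intros Hf Ha Hb Hc.
set (r := Rmax (Cmod a) (Rmax (Cmod b) (Cmod c))).
assert (Hr : r < rho) by (repeat apply Rmax_lub_lt; auto).
assert (Har : Cmod a <= r) by apply Rmax_l.
assert (Hbr : Cmod b <= r)
  by (eapply Rle_trans; [|apply Rmax_r]; apply Rmax_l).
assert (Hcr : Cmod c <= r)
  by (eapply Rle_trans; [|apply Rmax_r]; apply Rmax_r).
(* The triangles are packed with the invariant that they stay in the closed disk of radius r < rho,
   so that the bisection can be iterated by choice and its limit point lies where f is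
   differentiable. *)
set (ok := fun t : C * C * C => let '(x, y, z) := t in
  Cmod x <= r /\ Cmod y <= r /\ Cmod z <= r).
set (vtx := fun t : C * C * C => fst (fst t)).
set (per := fun t : C * C * C => perimeter (fst (fst t)) (snd (fst t)) (snd t)).
set (val := fun t : C * C * C => Cmod (tri f (fst (fst t)) (snd (fst t)) (snd t))).
assert (step : forall s : {t | ok t}, {s' : {t | ok t} |
  per (proj1_sig s') = per (proj1_sig s) / 2 /\
  val (proj1_sig s) / 4 <= val (proj1_sig s') /\
  Cmod (vtx (proj1_sig s') - vtx (proj1_sig s)) <= per (proj1_sig s)}).
{ intros [[[x y] z] Hok]. apply constructive_indefinite_description.
  destruct Hok as [Hx [Hy Hz]].
  destruct (tri_step rho f r x y z Hf Hr Hx Hy Hz) as [x' [y' [z' [H1 H2]]]].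
  exists (exist ok (x', y', z') H1). exact H2. }
set (s := nat_rect (fun _ => {t | ok t}) (exist ok (a, b, c) (conj Har (conj Hbr Hcr)))
  (fun _ t => proj1_sig (step t))).
set (T := fun n => proj1_sig (s n)).
assert (HT : forall n, per (T (S n)) = per (T n) / 2 /\ val (T n) / 4 <= val (T (S n)) /\
   Cmod (vtx (T (S n)) - vtx (T n)) <= per (T n)).
{ intros n. exact (proj2_sig (step (s n))). }
assert (Hok : forall n, ok (T n)) by (intros n; exact (proj2_sig (s n))).
set (d := perimeter a b c).
assert (Hper : forall n, per (T n) = d * (1 / 2) ^ n).
{ induction n; [change (per (T 0%nat)) with d; simpl; ring|].
  rewrite (proj1 (HT n)), IHn. simpl. field. }
assert (Hval : forall n, Cmod (tri f a b c) * ((1 / 2) ^ n * (1 / 2) ^ n) <= val (T n)).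
{ induction n; [change (val (T 0%nat)) with (Cmod (tri f a b c)); simpl; lra|].
  eapply Rle_trans; [|apply (HT n)]. simpl. lra. }
destruct (geometric_limit (fun n => vtx (T n)) d) as [p Hp].
{ intros n. rewrite <- Hper. apply HT. }
assert (Hd : 0 <= d).
{ unfold d, perimeter. assert (P1 := Cmod_ge_0 (b - a)).
  assert (P2 := Cmod_ge_0 (c - b)). assert (P3 := Cmod_ge_0 (a - c)). lra. }
assert (Hpow : forall e, 0 < e -> exists n, d * (1 / 2) ^ n < e).
{ intros e He. destruct (pow_lt_1_zero (1 / 2)) with (y := e / (d + 1)) as [N HN].
  - rewrite Rabs_pos_eq; lra.
  - apply Rdiv_lt_0_compat; lra.
  - exists N. specialize (HN N (Nat.le_refl _)).
    assert (0 <= (1 / 2) ^ N) by (apply pow_le; lra).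
    rewrite Rabs_pos_eq in HN by auto.
    apply Rle_lt_trans with ((d + 1) * (1 / 2) ^ N); [nra|].
    apply Rmult_lt_reg_r with (/ (d + 1)); [apply Rinv_0_lt_compat; lra|].
    replace ((d + 1) * (1 / 2) ^ N * / (d + 1)) with ((1 / 2) ^ N) by (field; lra).
    exact HN. }
assert (Hpr : Cmod p <= r).
{ apply le_epsilon. intros e He. destruct (Hpow (e / 2)) as [n Hn]; [lra|].
  specialize (Hp n). specialize (Hok n). destruct (T n) as [[x y] z].
  destruct Hok as [Hx _]. change (vtx (x, y, z)) with x in Hp.
  replace p with ((p - x) + x)%C by ring.
  eapply Rle_trans; [apply Cmod_triangle|]. lra. }
destruct (Hf p) as [l Hl]; [lra|].
rewrite cderiv_eps in Hl.
apply Cmod_eq_0. apply Rle_antisym; [|apply Cmod_ge_0].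
apply le_epsilon. intros e He. rewrite Rplus_0_l.
(* With D = d / 2^n, the n-th triangle lies within 3 D of p: 2 D for the first vertex and D for the
   perimeter. Its integral is then at most e' (3 D) D and at least |tri| / 4^n, so |tri| <= 3 d^2
   e'. The added 1 covers d = 0. *)
destruct (Hl (e / (3 * d * d + 1))) as [h [Hh Hl']].
{ apply Rdiv_lt_0_compat; nra. }
destruct (Hpow (h / 3)) as [n Hn]; [lra|].
specialize (Hp n). specialize (Hval n). specialize (Hper n). specialize (Hok n).
destruct (T n) as [[x y] z]. destruct Hok as [Hx [Hy Hz]].
change (vtx (x, y, z)) with x in Hp. change (per (x, y, z)) with (perimeter x y z) in Hper.
change (val (x, y, z)) with (Cmod (tri f x y z)) in Hval.
set (D := d * (1 / 2) ^ n) in *. set (e' := e / (3 * d * d + 1)) in *.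
assert (P1 := Cmod_ge_0 (y - x)). assert (P2 := Cmod_ge_0 (z - y)).
assert (P3 := Cmod_ge_0 (x - z)). unfold perimeter in Hper.
assert (He' : 0 < e') by (apply Rdiv_lt_0_compat; nra).
rewrite Cmod_minus_sym in Hp.
assert (Hxp : Cmod (x - p) <= 3 * D) by (unfold D in *; lra).
assert (Hyp : Cmod (y - p) <= 3 * D).
{ eapply Rle_trans; [apply (Cmod_dist_triangle y x p)|]. unfold D in *; lra. }
assert (Hzp : Cmod (z - p) <= 3 * D).
{ eapply Rle_trans; [apply (Cmod_dist_triangle z x p)|].
  rewrite (Cmod_minus_sym z x). unfold D in *; lra. }
assert (Hseg : forall u v, Cmod (u - p) <= 3 * D -> Cmod (v - p) <= 3 * D ->
  forall t, 0 <= t <= 1 ->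
  Cmod (f (u + RtoC t * (v - u)) - (f p + l * (u + RtoC t * (v - u) - p)))%C <= e' * (3 * D)).
{ intros u v Hu Hv t Ht. assert (Hs := Cmod_segment u v p t _ Ht Hu Hv).
  replace (f (u + RtoC t * (v - u)) - (f p + l * (u + RtoC t * (v - u) - p)))%C
    with (f (u + RtoC t * (v - u)) - f p - l * (u + RtoC t * (v - u) - p))%C by ring.
  eapply Rle_trans; [apply Hl'; lra|]. apply Rmult_le_compat_l; lra. }
assert (B1 := seg_affine_approx rho f x y p _ _ _ Hf ltac:(lra) ltac:(lra) (Hseg x y Hxp Hyp)).
assert (B2 := seg_affine_approx rho f y z p _ _ _ Hf ltac:(lra) ltac:(lra) (Hseg y z Hyp Hzp)).
assert (B3 := seg_affine_approx rho f z x p _ _ _ Hf ltac:(lra) ltac:(lra) (Hseg z x Hzp Hxp)).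
assert (Hb3 := Cmod_le_plus _ _ _ _ (Cmod_le_plus _ _ _ _ B1 B2) B3).
match type of Hb3 with Cmod ?X <= _ => replace X with (tri f x y z) in Hb3 end.
2:{ unfold tri. field. }
assert (Hfin : Cmod (tri f a b c) * ((1 / 2) ^ n * (1 / 2) ^ n) <= e' * (3 * D) * D).
{ eapply Rle_trans; [exact Hval|]. eapply Rle_trans; [exact Hb3|].
  rewrite <- !Rmult_plus_distr_l, Hper. lra. }
assert (Hpos : 0 < (1 / 2) ^ n) by (apply pow_lt; lra).
apply Rmult_le_reg_r with ((1 / 2) ^ n * (1 / 2) ^ n); [now apply Rmult_lt_0_compat|].
eapply Rle_trans; [exact Hfin|]. unfold D.
replace (e' * (3 * (d * (1 / 2) ^ n)) * (d * (1 / 2) ^ n))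
  with (e' * (3 * d * d) * ((1 / 2) ^ n * (1 / 2) ^ n)) by ring.
apply Rmult_le_compat_r; [apply Rlt_le; now apply Rmult_lt_0_compat|].
apply Rle_trans with (e' * (3 * d * d + 1)); [nra|].
unfold e'. right. field. nra.
Qed.

(** The primitive is the integral along the segment from 0. Goursat on the triangle 0, z, w turns
    its increment into the integral over [z, w]. *)
Lemma holo_primitive rho f : holo rho f ->
  exists F, forall z, Cmod z < rho -> cderiv F z (f z).
Proof.
intros Hf. exists (seg f 0). intros z Hz. apply (proj2 (cderiv_eps _ _ _)). intros e He.
destruct (Hf z Hz) as [l Hl]. apply cderiv_cont in Hl.
assert (Hl' := proj1 (filterlim_C _ _ _) Hl e He).
destruct (proj1 (locally_Cmod _ _) Hl') as [d [Hd H]].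
exists (Rmin d (rho - Cmod z)). split; [apply Rmin_pos; lra|].
intros w Hw.
assert (Hw1 : Cmod (w - z) < d) by (eapply Rlt_le_trans; [exact Hw|apply Rmin_l]).
assert (Hw2 : Cmod (w - z) < rho - Cmod z) by (eapply Rlt_le_trans; [exact Hw|apply Rmin_r]).
assert (HwR : Cmod w < rho).
{ replace w with ((w - z) + z)%C by ring.
  eapply Rle_lt_trans; [apply Cmod_triangle|]. lra. }
assert (H0 : Cmod 0 < rho) by (rewrite Cmod_0; assert (H2 := Cmod_ge_0 z); lra).
assert (G := goursat rho f 0 z w Hf H0 Hz HwR). unfold tri in G.
rewrite (seg_rev rho f 0 w Hf H0 HwR) in G.
assert (E : (seg f 0 w - seg f 0 z)%C = seg f z w).
{ replace (seg f 0 w - seg f 0 z)%C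
    with (seg f z w - (seg f 0 z + seg f z w + - seg f 0 w))%C by ring.
  rewrite G. ring. }
rewrite E.
assert (B := seg_affine_approx rho f z w z (f z) 0 e Hf Hz HwR).
replace (f z * (w - z) + 0 * ((w - z) * (w - z) - (z - z) * (z - z)) / 2)%C
  with (f z * (w - z))%C in B by (field; apply RtoC_neq; lra).
apply B. intros t Ht.
replace (f z + 0 * (z + RtoC t * (w - z) - z))%C with (f z) by ring.
apply Rlt_le, H.
replace (z + RtoC t * (w - z) - z)%C with (RtoC t * (w - z))%C by ring.
rewrite Cmod_mult, Cmod_R, Rabs_pos_eq by lra.
assert (Hc := Cmod_ge_0 (w - z)). nra.
Qed.

(** * Circle integrals *)

Definition cis (t : R) : C := (cos t, sin t).

(** Circle integrals are taken against dt = d zeta / (i zeta). This is why the Cauchy kernel appears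
    as zeta / (zeta - z) and the total mass is 2 pi. *)
Definition circ (r t : R) : C := (RtoC r * cis t)%C.

Lemma Cmod_cis t : Cmod (cis t) = 1.
Proof.
unfold Cmod, cis, fst, snd. transitivity (sqrt 1); [f_equal|apply sqrt_1].
assert (H := sin2_cos2 t). unfold Rsqr in H. lra.
Qed.

Lemma Cmod_circ r t : 0 <= r -> Cmod (circ r t) = r.
Proof. intros H. unfold circ. rewrite Cmod_mult, Cmod_cis, Cmod_R, Rabs_pos_eq; lra. Qed.

Lemma Cmod_le_Re_Im (z : C) : Cmod z <= Rabs (Re z) + Rabs (Im z).
Proof.
replace z with (RtoC (Re z) + RtoC (Im z) * Ci)%C at 1.
- eapply Rle_trans; [apply Cmod_triangle|].
  rewrite Cmod_mult, !Cmod_R, Cmod_Ci. lra.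
- destruct z as [x y]. unfold Ci, RtoC, Cplus, Cmult. simpl. f_equal; ring.
Qed.

Lemma deriv_R_pair (f : R -> C) (t : R) (l : C) :
  is_derive (fun s => Re (f s)) t (Re l) -> is_derive (fun s => Im (f s)) t (Im l) ->
  deriv_along (locally t) RtoC f t l.
Proof.
intros [_ H1] [_ H2].
specialize (H1 t (fun P HP => HP)). specialize (H2 t (fun P HP => HP)).
exists (fun s => if excluded_middle_informative (s = t) then l
                 else (f s - f t) / (RtoC s - RtoC t))%C. split.
- apply (filterlim_C (locally t)). intros e He.
  assert (He4 : 0 < e / 4) by lra.
  generalize (filter_and _ _ (H1 (mkposreal _ He4)) (H2 (mkposreal _ He4))).
  apply filter_imp. intros s [K1 K2]. change R in s.
  destruct (excluded_middle_informative (s = t)) as [->|Hn].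
  + replace (l - l)%C with (RtoC 0) by ring. now rewrite Cmod_0.
  + change (Rabs (Re (f s) - Re (f t) - (s - t) * Re l) <= e / 4 * Rabs (s - t)) in K1.
    change (Rabs (Im (f s) - Im (f t) - (s - t) * Im l) <= e / 4 * Rabs (s - t)) in K2.
    assert (Hz : (RtoC s - RtoC t)%C <> 0)
      by (rewrite <- RtoC_minus; apply RtoC_neq; lra).
    replace ((f s - f t) / (RtoC s - RtoC t) - l)%C
      with ((f s - f t - (RtoC s - RtoC t) * l) / (RtoC s - RtoC t))%C by (field; auto).
    rewrite Cmod_div by auto.
    assert (Hp : 0 < Cmod (RtoC s - RtoC t)) by now apply Cmod_gt_0.
    apply Rmult_lt_reg_r with (Cmod (RtoC s - RtoC t)); auto.
    unfold Rdiv. rewrite Rmult_assoc, Rinv_l, Rmult_1_r by lra.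
    eapply Rle_lt_trans; [apply Cmod_le_Re_Im|].
    rewrite <- RtoC_minus in *. rewrite Cmod_R in *.
    replace (Re (f s - f t - RtoC (s - t) * l)%C)
      with (Re (f s) - Re (f t) - (s - t) * Re l)
      by (unfold Re, Cminus, Cplus, Copp, Cmult, RtoC; simpl; ring).
    replace (Im (f s - f t - RtoC (s - t) * l)%C)
      with (Im (f s) - Im (f t) - (s - t) * Im l)
      by (unfold Im, Cminus, Cplus, Copp, Cmult, RtoC; simpl; ring).
    nra.
- apply filter_forall. intros s. change R in s.
  destruct (excluded_middle_informative (s = t)) as [->|Hn]; [ring|].
  assert (Hz : (RtoC s - RtoC t)%C <> 0)
    by (rewrite <- RtoC_minus; apply RtoC_neq; lra).
  field; auto.
Qed.

Lemma deriv_R_Re_Im (f : R -> C) (t : R) (l : C) :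
  deriv_along (locally t) RtoC f t l ->
  is_derive (fun s => Re (f s)) t (Re l) /\ is_derive (fun s => Im (f s)) t (Im l).
Proof.
intros [q [Hq E]].
assert (K : forall e, 0 < e -> locally t (fun s : R =>
   Cmod (f s - f t - RtoC (s - t)%R * l) <= e * Rabs (s - t)%R)).
{ intros e He. generalize (filter_and _ _ (proj1 (filterlim_C _ _ _) Hq e He) E).
  apply filter_imp. intros s [H1 H2]. rewrite H2, <- RtoC_minus.
  replace (q s * RtoC (s - t)%R - RtoC (s - t)%R * l)%C
    with ((q s - l) * RtoC (s - t)%R)%C by ring.
  rewrite Cmod_mult, Cmod_R. apply Rmult_le_compat_r; [apply Rabs_pos|lra]. }
split; (split; [apply is_linear_scal_l|]); intros y Hy e;
  assert (Hyz : t = y) by exact (is_filter_lim_locally_unique (V := R_NormedModule) t y Hy);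
  subst y; generalize (K e (cond_pos e)); apply filter_imp; intros s Hs;
  eapply Rle_trans; [|exact Hs| |exact Hs].
- change (Rabs (Re (f s) - Re (f t) - (s - t) * Re l)
    <= Cmod (f s - f t - RtoC (s - t)%R * l)).
  replace (Re (f s) - Re (f t) - (s - t) * Re l)
    with (Re (f s - f t - RtoC (s - t) * l)%C)
    by (unfold Re, Cminus, Cplus, Copp, Cmult, RtoC; simpl; ring).
  apply re_le_Cmod.
- change (Rabs (Im (f s) - Im (f t) - (s - t) * Im l)
    <= Cmod (f s - f t - RtoC (s - t)%R * l)).
  replace (Im (f s) - Im (f t) - (s - t) * Im l)
    with (Im (f s - f t - RtoC (s - t) * l)%C)
    by (unfold Im, Cminus, Cplus, Copp, Cmult, RtoC; simpl; ring).
  eapply Rle_trans; [apply Rmax_r | apply Rmax_Cmod].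
Qed.

Lemma deriv_R_cis t : deriv_along (locally t) RtoC cis t (Ci * cis t)%C.
Proof.
apply deriv_R_pair; unfold cis, Ci, Cmult; simpl; auto_derive; auto; ring.
Qed.

Lemma deriv_R_circ r t : deriv_along (locally t) RtoC (circ r) t (Ci * circ r t)%C.
Proof.
destruct (deriv_R_cis t) as [q [Hq E]]. exists (fun s => RtoC r * q s)%C. split.
- unfold circ. replace (Ci * (RtoC r * cis t))%C with (RtoC r * (Ci * cis t))%C by ring.
  apply filterlim_Cmult; auto. apply filterlim_const.
- revert E. apply filter_imp. intros s Hs. unfold circ.
  rewrite <- Cmult_assoc, <- Hs. ring.
Qed.

Lemma circ_cont r t : filterlim (circ r) (locally t) (locally (circ r t)).
Proof. eapply deriv_R_cont, deriv_R_circ. Qed.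

Lemma circ_2PI r : circ r (2 * PI) = circ r 0.
Proof. unfold circ, cis. now rewrite sin_2PI, cos_2PI, sin_0, cos_0. Qed.

(** On (0, 1] the quotient j s / s equals i s and has derivative (i s * s - s * i s) / s^2 = 0, so i
    is constant there. The value at 0 is reached through j' (0) = i 0, the limit of j s / s. *)
Lemma scaling_derivative_const (j i : R -> R) :
  (forall s, 0 <= s <= 1 -> j s = s * i s) ->
  (forall s, 0 <= s <= 1 -> is_derive j s (i s)) -> i 1 = i 0.
Proof.
intros Hj Hd.
assert (Hc : forall x, 0 < x <= 1 -> i x = i 1).
{ intros x Hx.
  destruct (MVT_gen (fun s => j s / s) x 1 (fun _ => 0)) as [c [_ Hc]].
  - rewrite Rmin_left, Rmax_right by lra. intros s Hs.
    replace 0 with ((i s * s - j s * 1) / s ^ 2)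
      by (rewrite Hj by lra; field; lra).
    apply is_derive_div; [apply Hd; lra | apply (is_derive_id (K := R_AbsRing)) | lra].
  - rewrite Rmin_left, Rmax_right by lra. intros s Hs.
    apply continuity_pt_filterlim.
    apply (ex_derive_continuous (V := R_NormedModule) (fun s => j s / s)).
    eexists. apply is_derive_div; [apply Hd; lra | apply (is_derive_id (K := R_AbsRing)) | lra].
  - rewrite (Hj x), (Hj 1) in Hc by lra.
    replace (x * i x / x) with (i x) in Hc by (field; lra). lra. }
destruct (Hd 0) as [_ H0]; [lra|]. specialize (H0 0 (fun P HP => HP)).
apply cond_eq. intros e He. assert (He2 : 0 < e / 2) by lra.
destruct (H0 (mkposreal _ He2)) as [d Hd0].
set (x := Rmin 1 (d / 2)). assert (Hdp := cond_pos d).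
assert (Hx : 0 < x <= 1) by (split; [apply Rmin_pos; lra | apply Rmin_l]).
assert (Hx2 : x <= d / 2) by apply Rmin_r.
assert (Hb : ball (0 : R_UniformSpace) d x).
{ change (Rabs (x - 0) < d). rewrite Rminus_0_r, Rabs_pos_eq; lra. }
specialize (Hd0 x Hb).
change (Rabs (j x - j 0 - (x - 0) * i 0) <= e / 2 * Rabs (x - 0)) in Hd0.
rewrite (Hj x), (Hj 0), (Hc x) in Hd0 by lra. rewrite Rminus_0_r in Hd0.
replace (x * i 1 - 0 * i 0 - x * i 0) with (x * (i 1 - i 0)) in Hd0 by ring.
rewrite Rabs_mult, (Rabs_pos_eq x) in Hd0 by lra.
assert (Rabs (i 1 - i 0) <= e / 2) by nra. lra.
Qed.

Lemma CInt_param (K K' : R -> R -> C) (a b x : R) :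
  locally x (fun u => forall t, deriv_along (locally u) RtoC (fun v => K v t) u (K' u t)) ->
  (forall t, filterlim (fun p : R * R => K' (fst p) (snd p)) (locally (x, t)) (locally (K' x t))) ->
  locally x (fun u => ccont_on (K u) a b) ->
  ccont_on (K' x) a b ->
  is_derive (fun u => Re (CInt (K u) a b)) x (Re (CInt (K' x) a b)) /\
  is_derive (fun u => Im (CInt (K u) a b)) x (Im (CInt (K' x) a b)).
Proof.
intros H1 H2 H3 H4.
assert (Hloc : forall t, locally (x, t) (fun p : R * R =>
   deriv_along (locally (fst p)) RtoC (fun v => K v (snd p)) (fst p) (K' (fst p) (snd p)))).
{ intros t. destruct H1 as [d Hd]. exists d. intros [u v] [Hu Hv]. now apply Hd. }
assert (H4' := proj1 (is_CInt_pair _ _ _ _) (CInt_correct _ _ _ H4)).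
assert (H3' : locally x (fun u =>
  is_RInt (fun t => Re (K u t)) a b (Re (CInt (K u) a b)) /\
  is_RInt (fun t => Im (K u t)) a b (Im (CInt (K u) a b)))).
{ revert H3. apply filter_imp. intros u Hu. now apply is_CInt_pair, CInt_correct. }
assert (Hcomp : forall (pr : C -> R),
  (forall z : C, continuous pr z) ->
  (forall f t l, deriv_along (locally t) RtoC f t l -> is_derive (fun s => pr (f s)) t (pr l)) ->
  locally x (fun u => is_RInt (fun t => pr (K u t)) a b (pr (CInt (K u) a b))) ->
  is_RInt (fun t => pr (K' x t)) a b (pr (CInt (K' x) a b)) ->
  is_derive (fun u => pr (CInt (K u) a b)) x (pr (CInt (K' x) a b))).
{ intros pr Hpr Hder HI HI'.
  apply (is_derive_ext_loc (fun u => RInt (fun t => pr (K u t)) a b)).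
  { revert HI. apply filter_imp. intros u Hu. now apply is_RInt_unique. }
  assert (HD : forall t, Derive (fun u => pr (K u t)) x = pr (K' x t)).
  { intros t. apply is_derive_unique. apply (Hder (fun u => K u t)).
    now apply locally_singleton in H1. }
  replace (pr (CInt (K' x) a b))
    with (RInt (fun t => Derive (fun u => pr (K u t)) x) a b).
  - apply is_derive_RInt_param.
    + revert H1. apply filter_imp. intros u Hu t _. eexists.
      exact (Hder (fun v => K v t) _ _ (Hu t)).
    + intros t _. apply continuity_2d_pt_filterlim.
      apply (filterlim_ext_loc (fun p : R * R => pr (K' (fst p) (snd p)))).
      * generalize (Hloc t). apply filter_imp. intros p Hp. symmetry.
        apply is_derive_unique. exact (Hder (fun v => K v (snd p)) _ _ Hp).
      * rewrite HD. eapply filterlim_comp; [apply H2 | apply Hpr].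
    + revert HI. apply filter_imp. intros u Hu. eexists; exact Hu.
  - apply is_RInt_unique. apply (is_RInt_ext (fun t => pr (K' x t))); auto. }
split.
- apply (Hcomp Re); [intros z; apply continuous_fst | | | apply H4'].
  + intros f t l Hf. now apply deriv_R_Re_Im.
  + revert H3'. apply filter_imp. tauto.
- apply (Hcomp Im); [intros z; apply continuous_snd | | | apply H4'].
  + intros f t l Hf. now apply deriv_R_Re_Im.
  + revert H3'. apply filter_imp. tauto.
Qed.

Lemma circ_minus_neq r t z : Cmod z < r -> (circ r t - z)%C <> 0.
Proof.
intros Hz E. apply (f_equal (fun w => Cmod (w + z))) in E.
replace (circ r t - z + z)%C with (circ r t) in E by ring.
assert (H := Cmod_ge_0 z).
rewrite Cplus_0_l, Cmod_circ in E; lra.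
Qed.

(* With [F' = f], the integral [J s] of [F (z + s (ζ - z)) ζ / (ζ - z)^2] over the
   circle satisfies [J' = I] by differentiation and [J = s I] by parts, where [I s]
   is the integral of [f (z + s (ζ - z)) ζ / (ζ - z)]; hence [I 1 = I 0]. *)
Lemma cauchy_homotopy rho f r z :
  holo rho f -> 0 < r < rho -> Cmod z < r ->
  CInt (fun t => f (circ r t) * (circ r t / (circ r t - z)))%C 0 (2 * PI) =
  CInt (fun t => f z * (circ r t / (circ r t - z)))%C 0 (2 * PI).
Proof.
intros Hf Hr Hz.
destruct (holo_primitive rho f Hf) as [F HF].
assert (Hne := fun t => circ_minus_neq r t z Hz).
set (w := fun s t => (z + RtoC s * (circ r t - z))%C).
set (K := fun s t => (F (w s t) * (circ r t / ((circ r t - z) * (circ r t - z))))%C).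
set (K' := fun s t => (f (w s t) * (circ r t / (circ r t - z)))%C).
(* Two-sided derivatives at s = 0 and s = 1 require parameters slightly outside [0, 1]. As |zeta -
   z| <= 2 r, an excess below eta moves the point by at most (rho - r) / 2. *)
set (eta := (rho - r) / (4 * r)).
assert (Heta : 0 < eta) by (apply Rdiv_lt_0_compat; lra).
assert (Hw : forall s u t, 0 <= s <= 1 -> Rabs (u - s) < eta -> Cmod (w u t) < rho).
{ intros s u t Hs Hu. unfold w.
  replace (z + RtoC u * (circ r t - z))%C
    with ((z + RtoC s * (circ r t - z) - 0) + RtoC (u - s) * (circ r t - z))%C
    by (rewrite RtoC_minus; ring).
  eapply Rle_lt_trans; [apply Cmod_triangle|].
  assert (H1 : Cmod (z + RtoC s * (circ r t - z) - 0) <= r).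
  { apply Cmod_segment; auto.
    - replace (z - 0)%C with z by ring. lra.
    - replace (circ r t - 0)%C with (circ r t) by ring. rewrite Cmod_circ; lra. }
  assert (H2 : Cmod (circ r t - z) <= 2 * r).
  { eapply Rle_trans; [apply Cmod_triangle|]. rewrite Cmod_opp, Cmod_circ; lra. }
  rewrite Cmod_mult, Cmod_R.
  assert (Rabs (u - s) * Cmod (circ r t - z) <= eta * (2 * r)).
  { apply Rmult_le_compat; try lra; [apply Rabs_pos | apply Cmod_ge_0]. }
  assert (eta * (2 * r) = (rho - r) / 2) by (unfold eta; field; lra). lra. }
assert (Hw0 : forall s t, 0 <= s <= 1 -> Cmod (w s t) < rho).
{ intros s t Hs. apply (Hw s s t Hs). rewrite Rminus_diag, Rabs_R0. auto. }
assert (wt : forall s t, deriv_along (locally t) RtoC (w s) t (RtoC s * (Ci * circ r t))%C).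
{ intros s t. destruct (deriv_R_circ r t) as [q [Hq E]].
  exists (fun v => RtoC s * q v)%C. split.
  - apply filterlim_Cmult; auto. apply filterlim_const.
  - revert E. apply filter_imp. intros v Hv. unfold w.
    rewrite <- Cmult_assoc, <- Hv. ring. }
assert (kt : forall t, filterlim (fun v => circ r v / (circ r v - z))%C (locally t)
    (locally (circ r t / (circ r t - z))%C)).
{ intros t. apply filterlim_Cmult; [apply circ_cont|].
  apply filterlim_Cinv; auto. apply filterlim_Cminus; [apply circ_cont | apply filterlim_const]. }
assert (cK' : forall s, 0 <= s <= 1 -> ccont_on (K' s) 0 (2 * PI)).
{ intros s Hs t _. apply filterlim_Cmult; [|apply kt].
  apply (filterlim_comp _ _ _ (w s) f _ (locally (w s t))).
  - eapply deriv_R_cont, wt.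
  - apply (holo_cont rho); auto. }
assert (dF : forall s u t, 0 <= s <= 1 -> Rabs (u - s) < eta ->
   deriv_along (locally t) RtoC (fun v => F (w u v)) t (f (w u t) * (RtoC u * (Ci * circ r t)))%C).
{ intros s u t Hs Hu. apply deriv_R_comp; [|apply wt]. apply HF. now apply (Hw s). }
assert (cK : forall s u, 0 <= s <= 1 -> Rabs (u - s) < eta -> ccont_on (K u) 0 (2 * PI)).
{ intros s u Hs Hu t _. apply filterlim_Cmult.
  - eapply deriv_R_cont, (dF s); auto.
  - apply filterlim_Cmult; [apply circ_cont|].
    apply filterlim_Cinv; [now apply Cmult_neq_0|].
    apply filterlim_Cmult; (apply filterlim_Cminus; [apply circ_cont | apply filterlim_const]). }
assert (near : forall s, locally s (fun u : R => Rabs (u - s) < eta)).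
{ intros s. exists (mkposreal eta Heta). intros u Hu. exact Hu. }
assert (HJ' : forall s, 0 <= s <= 1 ->
  is_derive (fun u => Re (CInt (K u) 0 (2 * PI))) s (Re (CInt (K' s) 0 (2 * PI))) /\
  is_derive (fun u => Im (CInt (K u) 0 (2 * PI))) s (Im (CInt (K' s) 0 (2 * PI)))).
{ intros s Hs. apply CInt_param; auto.
  - generalize (near s). apply filter_imp. intros u Hu t.
    apply (deriv_along_ext (F := locally u)
      (fun v => circ r t / ((circ r t - z) * (circ r t - z)) * F (w v t))%C).
    + apply filter_forall. intros v. unfold K. ring.
    + unfold K. ring.
    + assert (HFw := HF _ (Hw s u t Hs Hu)).
      assert (D := deriv_R_comp F (fun v => w v t) u _ _ HFw (deriv_R_line z (circ r t - z)%C u)).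
      destruct D as [q [Hq E]].
      exists (fun v => circ r t / ((circ r t - z) * (circ r t - z)) * q v)%C. split.
      * replace (K' u t) with (circ r t / ((circ r t - z) * (circ r t - z))
           * (f (w u t) * (circ r t - z)))%C by (unfold K'; field; auto).
        apply filterlim_Cmult; auto. apply filterlim_const.
      * revert E. apply filter_imp. intros v Hv.
        rewrite <- Cmult_assoc, <- Hv. ring.
  - intros t.
    assert (Hfst : filterlim (fun p : R * R => RtoC (fst p)) (locally (s, t)) (locally (RtoC s))).
    { apply filterlim_RtoC. apply (continuous_fst (U := R_UniformSpace) (V := R_UniformSpace)). }
    assert (Hsnd : filterlim (fun p : R * R => circ r (snd p)) (locally (s, t)) (locally (circ r t))).
    { eapply filterlim_comp; [|apply circ_cont].
      apply (continuous_snd (U := R_UniformSpace) (V := R_UniformSpace)). }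
    apply filterlim_Cmult.
    + apply (filterlim_comp _ _ _ (fun p : R * R => w (fst p) (snd p)) f _ (locally (w s t))).
      * apply filterlim_Cplus; [apply filterlim_const|].
        apply filterlim_Cmult; auto. apply filterlim_Cminus; auto. apply filterlim_const.
      * apply (holo_cont rho); auto.
    + apply filterlim_Cmult; auto. apply filterlim_Cinv; auto.
      apply filterlim_Cminus; auto. apply filterlim_const.
  - generalize (near s). apply filter_imp. intros u Hu. now apply (cK s). }
assert (HJ : forall s, 0 <= s <= 1 ->
  CInt (K s) 0 (2 * PI) = (RtoC s * CInt (K' s) 0 (2 * PI)%R)%C).
{ intros s Hs.
  assert (Hs' : Rabs (s - s) < eta) by (rewrite Rminus_diag, Rabs_R0; auto).
  assert (I1 := CInt_correct _ _ _ (cK' s Hs)).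
  assert (I2 := CInt_correct _ _ _ (cK s s Hs Hs')).
  assert (I3 := is_CInt_mult Ci _ _ _ _
    (is_CInt_minus _ _ _ _ _ _ (is_CInt_mult (RtoC s) _ _ _ _ I1) I2)).
  (* The integrand is the exact t-derivative of F (w s t) / (zeta - z), whose boundary values agree
     because the circle closes up. *)
  assert (I4 : is_CInt (fun t => Ci * (RtoC s * K' s t - K s t))%C 0 (2 * PI)
     (F (w s (2 * PI)%R) * / (circ r (2 * PI)%R - z) - F (w s 0) * / (circ r 0 - z))%C).
  { apply (is_CInt_derive (fun t => F (w s t) * / (circ r t - z))%C).
    - intros t _.
      assert (Dc : deriv_along (locally t) RtoC (fun v => circ r v - z)%C t (Ci * circ r t)%C).
      { destruct (deriv_R_circ r t) as [q [Hq E]]. exists q. split; auto.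
        revert E. apply filter_imp. intros v Hv. rewrite <- Hv. ring. }
      assert (Di := deriv_R_comp (fun y => / y)%C _ _ _ _ (cderiv_inv _ (Hne t)) Dc).
      assert (Hi : filterlim RtoC (locally t) (locally (RtoC t))).
      { apply (filterlim_RtoC (F := locally t) (fun s : R => s)). apply filterlim_id. }
      assert (Dm := deriv_along_mult Hi _ _ _ _ (dF s s t Hs Hs') Di).
      revert Dm. apply deriv_along_eq. unfold K', K. field. auto.
    - intros t Ht. apply filterlim_Cmult; [apply filterlim_const|].
      apply filterlim_Cminus; [|now apply (cK s s Hs Hs')].
      apply filterlim_Cmult; [apply filterlim_const|]. now apply (cK' s Hs). }
  apply is_CInt_unique in I3. apply is_CInt_unique in I4. rewrite I4 in I3.
  unfold w in I3. rewrite circ_2PI in I3.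
  apply Ceq_minus.
  replace (CInt (K s) 0 (2 * PI)%R - RtoC s * CInt (K' s) 0 (2 * PI)%R)%C
    with (Ci * (Ci * (RtoC s * CInt (K' s) 0 (2 * PI)%R - CInt (K s) 0 (2 * PI)%R)))%C.
  - rewrite <- I3. ring.
  - rewrite Cmult_assoc. replace (Ci * Ci)%C with (- (1))%C.
    + ring.
    + unfold Ci, Cmult, Copp, RtoC. simpl. f_equal; ring. }
assert (H10 : CInt (K' 1) 0 (2 * PI) = CInt (K' 0) 0 (2 * PI)).
{ assert (ERe : Re (CInt (K' 1) 0 (2 * PI)) = Re (CInt (K' 0) 0 (2 * PI))).
  { apply (scaling_derivative_const (fun s => Re (CInt (K s) 0 (2 * PI)))
      (fun s => Re (CInt (K' s) 0 (2 * PI)))).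
    - intros s Hs. now rewrite HJ, re_scal_l.
    - intros s Hs. now apply HJ'. }
  assert (EIm : Im (CInt (K' 1) 0 (2 * PI)) = Im (CInt (K' 0) 0 (2 * PI))).
  { apply (scaling_derivative_const (fun s => Im (CInt (K s) 0 (2 * PI)))
      (fun s => Im (CInt (K' s) 0 (2 * PI)))).
    - intros s Hs. now rewrite HJ, im_scal_l.
    - intros s Hs. now apply HJ'. }
  destruct (CInt (K' 1) 0 (2 * PI)), (CInt (K' 0) 0 (2 * PI)). simpl in *. congruence. }
assert (T : forall s, 0 <= s <= 1 -> forall g, (forall t, K' s t = g t) ->
  CInt (K' s) 0 (2 * PI) = CInt g 0 (2 * PI)).
{ intros s Hs g Hg. symmetry. apply is_CInt_unique.
  apply (is_CInt_ext (K' s)); auto. now apply CInt_correct, cK'. }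
rewrite <- (T 1 ltac:(lra) (fun t => f (circ r t) * (circ r t / (circ r t - z)))%C).
- rewrite H10. apply T; [lra|]. intros t. unfold K', w. do 2 f_equal. ring.
- intros t. unfold K', w. do 2 f_equal. ring.
Qed.

(** * Cauchy's formula and its consequences *)

Lemma holo_circ_cont rho f r (k : R -> C) a b :
  holo rho f -> 0 < r < rho -> ccont_on k a b ->
  ccont_on (fun t => f (circ r t) * k t)%C a b.
Proof.
intros Hf Hr Hk t Ht. apply filterlim_Cmult; [|now apply Hk].
apply (filterlim_comp _ _ _ (circ r) f _ (locally (circ r t))); [apply circ_cont|].
apply (holo_cont rho); auto. rewrite Cmod_circ; lra.
Qed.

Lemma cauchy_kernel_cont r z a b :
  Cmod z < r -> ccont_on (fun t => circ r t / (circ r t - z))%C a b.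
Proof.
intros Hz t _. apply filterlim_Cmult; [apply circ_cont|].
apply filterlim_Cinv; [now apply circ_minus_neq|].
apply filterlim_Cminus; [apply circ_cont | apply filterlim_const].
Qed.

Lemma mean_value rho f r :
  holo rho f -> 0 < r < rho ->
  is_CInt (fun t => f (circ r t)) 0 (2 * PI) (RtoC (2 * PI) * f 0)%C.
Proof.
intros Hf Hr.
assert (Hz : Cmod 0 < r) by (rewrite Cmod_0; lra).
assert (Hk : forall t, (circ r t / (circ r t - 0))%C = 1).
{ intros t. assert (H := circ_minus_neq r t 0 Hz). field. intros E. apply H.
  rewrite E. ring. }
assert (H := CInt_correct _ _ _ (holo_circ_cont rho f r _ 0 (2 * PI) Hf Hr
  (cauchy_kernel_cont r 0 0 (2 * PI) Hz))).
cbv beta in H. rewrite (cauchy_homotopy rho f r 0 Hf Hr Hz) in H.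
rewrite (is_CInt_unique _ _ _ (RtoC (2 * PI) * f 0)%C) in H.
- revert H. apply is_CInt_ext. intros t _. rewrite Hk. ring.
- replace (RtoC (2 * PI)) with (RtoC (2 * PI - 0)) by (f_equal; ring).
  apply (is_CInt_ext (fun _ => f 0)); [|apply is_CInt_const].
  intros t _. rewrite Hk. ring.
Qed.

(* On the circle of radius [r] this function is the conjugate of [ζ / (ζ - z)]. *)
Definition reflected_kernel (r : R) (z w : C) : C :=
  (RtoC r * RtoC r / (RtoC r * RtoC r - Cconj z * w))%C.

Lemma reflected_kernel_circ r z t : Cmod z < r ->
  Cconj (reflected_kernel r z (circ r t)) = (circ r t / (circ r t - z))%C.
Proof.
intros Hz. assert (Hr : 0 < r) by (assert (H := Cmod_ge_0 z); lra).
assert (Hne := circ_minus_neq r t z Hz).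
assert (Hc : (circ r t * Cconj (circ r t))%C = (RtoC r * RtoC r)%C).
{ rewrite <- Cmod2_conj, Cmod_circ by lra. rewrite <- RtoC_mult. f_equal. ring. }
assert (Hcn : circ r t <> 0).
{ apply Cmod_gt_0. rewrite Cmod_circ; lra. }
unfold reflected_kernel. rewrite <- Hc.
assert (Hcc : Cconj (circ r t) <> 0) by (apply Cmod_gt_0; rewrite Cmod_conj, Cmod_circ; lra).
assert (Hd : (circ r t * Cconj (circ r t) - Cconj z * circ r t)%C <> 0).
{ replace (circ r t * Cconj (circ r t) - Cconj z * circ r t)%C
    with (circ r t * Cconj (circ r t - z))%C by (rewrite Cminus_conj; ring).
  apply Cmult_neq_0; auto. apply Cmod_gt_0. rewrite Cmod_conj. now apply Cmod_gt_0. }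
rewrite Cdiv_conj, Cminus_conj, !Cmult_conj, !Cconj_conj by auto.
field. split; auto.
replace (Cconj (circ r t) * circ r t - z * Cconj (circ r t))%C
  with (Cconj (circ r t) * (circ r t - z))%C by ring.
now apply Cmult_neq_0.
Qed.

Lemma reflected_kernel_0 r z : 0 < r -> reflected_kernel r z 0 = 1.
Proof.
intros Hr. assert (RtoC r <> 0) by (apply RtoC_neq; lra).
unfold reflected_kernel.
replace (RtoC r * RtoC r - Cconj z * 0)%C with (RtoC r * RtoC r)%C by ring.
field. auto.
Qed.

(** The only pole is at r^2 / conj z, outside the closed disk. The radius 2 r^2 / (|z| + r) lies
    above r, does not exceed |pole|, and makes sense at z = 0 too. *)
Lemma reflected_kernel_holo r z : Cmod z < r ->
  exists rho, r < rho /\ holo rho (reflected_kernel r z).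
Proof.
intros Hz. assert (Hp := Cmod_ge_0 z). assert (Hr : 0 < r) by lra.
exists (2 * r * r / (Cmod z + r)). split.
- apply Rmult_lt_reg_r with (Cmod z + r); [lra|].
  unfold Rdiv. rewrite Rmult_assoc, Rinv_l, Rmult_1_r by lra. nra.
- intros w Hw. unfold reflected_kernel.
  assert (Hw' : Cmod w * (Cmod z + r) < 2 * r * r).
  { apply Rmult_lt_reg_r with (/ (Cmod z + r)); [apply Rinv_0_lt_compat; lra|].
    rewrite Rmult_assoc, Rinv_r, Rmult_1_r by lra. exact Hw. }
  assert (Hne : (RtoC r * RtoC r - Cconj z * w)%C <> 0).
  { intros E. assert (E' : (RtoC r * RtoC r)%C = (Cconj z * w)%C)
      by (rewrite <- (Cplus_0_r (Cconj z * w)), <- E; ring).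
    apply (f_equal Cmod) in E'.
    rewrite !Cmod_mult, Cmod_conj, Cmod_R, Rabs_pos_eq in E' by lra.
    assert (Hw0 := Cmod_ge_0 w). nra. }
  eexists. apply (cderiv_scal (RtoC r * RtoC r)).
  apply (cderiv_comp (fun v => / v)%C (fun w => RtoC r * RtoC r - Cconj z * w)%C).
  + now apply cderiv_inv.
  + apply cderiv_minus; [apply cderiv_const | apply cderiv_scal, cderiv_id].
Qed.

Lemma holo_le rho sigma f : sigma <= rho -> holo rho f -> holo sigma f.
Proof. intros H Hf z Hz. apply Hf. lra. Qed.

Lemma holo_mult rho f g : holo rho f -> holo rho g -> holo rho (fun z => f z * g z)%C.
Proof.
intros Hf Hg z Hz. destruct (Hf z Hz) as [l Hl]. destruct (Hg z Hz) as [m Hm].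
eexists. apply cderiv_mult; eassumption.
Qed.

Lemma holo_pow rho f n : holo rho f -> holo rho (fun z => f z ^ n)%C.
Proof.
intros Hf z Hz. destruct (Hf z Hz) as [l Hl].
eexists. apply (cderiv_comp (fun w => w ^ n)%C); [apply cderiv_pow | eassumption].
Qed.

(** Conjugate the mean value property of f times the reflected kernel: the kernel is 1 at the
    origin, and on the circle its conjugate is the Cauchy kernel. *)
Lemma conj_mean_value rho f r z :
  holo rho f -> r < rho -> Cmod z < r ->
  is_CInt (fun t => Cconj (f (circ r t)) * (circ r t / (circ r t - z)))%C 0 (2 * PI)
    (RtoC (2 * PI) * Cconj (f 0))%C.
Proof.
intros Hf Hr Hz. assert (Hp := Cmod_ge_0 z).
destruct (reflected_kernel_holo r z Hz) as [sigma [Hs Hk]].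
assert (H : holo (Rmin rho sigma) (fun w => f w * reflected_kernel r z w)%C).
{ apply holo_mult; eapply holo_le; try eassumption; [apply Rmin_l | apply Rmin_r]. }
apply mean_value with (r := r) in H; [|split; [lra | now apply Rmin_glb_lt]].
apply is_CInt_conj in H.
rewrite !Cmult_conj, reflected_kernel_0 in H by lra.
replace (Cconj (RtoC (2 * PI))) with (RtoC (2 * PI)) in H
  by (unfold Cconj, RtoC; simpl; f_equal; ring).
replace (Cconj 1) with (RtoC 1) in H by (unfold Cconj, RtoC; simpl; f_equal; ring).
rewrite Cmult_1_r in H.
revert H. apply is_CInt_ext. intros t _.
now rewrite Cmult_conj, reflected_kernel_circ.
Qed.

(** The homotopy replaces f (zeta) by f z, and the remaining integral of the kernel is
    [conj_mean_value] for the constant 1. *)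
Lemma cauchy_formula rho f r z :
  holo rho f -> r < rho -> Cmod z < r ->
  is_CInt (fun t => f (circ r t) * (circ r t / (circ r t - z)))%C 0 (2 * PI)
    (RtoC (2 * PI) * f z)%C.
Proof.
intros Hf Hr Hz. assert (Hp := Cmod_ge_0 z).
assert (H0 : is_CInt (fun t => circ r t / (circ r t - z))%C 0 (2 * PI) (RtoC (2 * PI))).
{ assert (H1 : holo rho (fun _ => 1)) by (intros w _; exists (RtoC 0); apply cderiv_const).
  assert (H := conj_mean_value rho (fun _ => 1) r z H1 Hr Hz). simpl in H.
  replace (Cconj 1) with (RtoC 1) in H by (unfold Cconj, RtoC; simpl; f_equal; ring).
  rewrite Cmult_1_r in H. revert H. apply is_CInt_ext. intros t _. ring. }
assert (Hr' : 0 < r < rho) by lra.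
assert (H := CInt_correct _ _ _ (holo_circ_cont rho f r _ 0 (2 * PI) Hf Hr'
  (cauchy_kernel_cont r z 0 (2 * PI) Hz))).
cbv beta in H. rewrite (cauchy_homotopy rho f r z Hf Hr' Hz) in H.
rewrite (is_CInt_unique _ _ _ _ (is_CInt_mult (f z) _ _ _ _ H0)) in H.
now rewrite Cmult_comm.
Qed.

Lemma Cmod_minus_ge (a b : C) : Cmod a - Cmod b <= Cmod (a - b).
Proof.
assert (H := Cmod_triangle (a - b) b). replace (a - b + b)%C with a in H by ring. lra.
Qed.

Lemma PI2_gt_0 : 0 < 2 * PI.
Proof. assert (H := PI_RGT_0). lra. Qed.

Lemma cauchy_lipschitz rho f r s B z w :
  holo rho f -> s < r < rho -> (forall v, Cmod v = r -> Cmod (f v) <= B) ->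
  Cmod z <= s -> Cmod w <= s ->
  Cmod (f w - f z) <= B * r / ((r - s) * (r - s)) * Cmod (w - z).
Proof.
intros Hf [Hs Hr] HB Hz Hw. assert (Hp := Cmod_ge_0 z).
assert (Hz' : Cmod z < r) by lra. assert (Hw' : Cmod w < r) by lra.
assert (H := is_CInt_minus _ _ _ _ _ _ (cauchy_formula rho f r w Hf Hr Hw')
   (cauchy_formula rho f r z Hf Hr Hz')).
assert (P2 := PI2_gt_0).
apply (is_CInt_bound_const _ _ _ _ (B * r / ((r - s) * (r - s)) * Cmod (w - z))) in H;
  [|lra|].
- replace (RtoC (2 * PI) * f w - RtoC (2 * PI) * f z)%C
    with (RtoC (2 * PI) * (f w - f z))%C in H by ring.
  rewrite Cmod_mult, Cmod_R, Rabs_pos_eq, Rminus_0_r in H by lra.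
  apply Rmult_le_reg_l in H; lra.
- intros t _.
  assert (N1 := circ_minus_neq r t z Hz'). assert (N2 := circ_minus_neq r t w Hw').
  replace (f (circ r t) * (circ r t / (circ r t - w)) -
      f (circ r t) * (circ r t / (circ r t - z)))%C
    with (f (circ r t) * (circ r t * (w - z)) / ((circ r t - w) * (circ r t - z)))%C
    by (field; auto).
  rewrite Cmod_div by now apply Cmult_neq_0. rewrite !Cmod_mult.
  assert (Hc : Cmod (circ r t) = r) by (apply Cmod_circ; lra).
  assert (D1 := Cmod_minus_ge (circ r t) z). assert (D2 := Cmod_minus_ge (circ r t) w).
  rewrite Hc in *. assert (Hfb := HB _ Hc). assert (F0 := Cmod_ge_0 (f (circ r t))).
  assert (W0 := Cmod_ge_0 (w - z)).
  unfold Rdiv. replace (B * r * / ((r - s) * (r - s)) * Cmod (w - z))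
    with (B * (r * Cmod (w - z)) * / ((r - s) * (r - s))) by ring.
  apply Rmult_le_compat.
  + apply Rmult_le_pos; auto. nra.
  + apply Rlt_le, Rinv_0_lt_compat, Rmult_lt_0_compat; lra.
  + apply Rmult_le_compat_r; nra.
  + apply Rinv_le_contravar; [nra|]. apply Rmult_le_compat; lra.
Qed.

Lemma pow_growth_le x b K :
  0 <= x -> 0 <= b -> (forall n, x ^ n <= K * b ^ n) -> x <= b.
Proof.
intros Hx Hb H. destruct (Rle_lt_dec x b) as [|Hlt]; auto. exfalso.
assert (Hx' : 0 < x) by lra.
assert (K1 : 1 <= K) by (specialize (H O); simpl in H; lra).
destruct (pow_lt_1_zero (b / x)) with (y := / (K + 1)) as [N HN].
- rewrite Rabs_pos_eq.
  + apply Rmult_lt_reg_r with x; auto. unfold Rdiv. rewrite Rmult_assoc, Rinv_l; lra.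
  + apply Rmult_le_pos; auto. apply Rlt_le, Rinv_0_lt_compat; auto.
- apply Rinv_0_lt_compat; lra.
- specialize (HN N (Nat.le_refl _)). specialize (H N).
  assert (Hxn : 0 < x ^ N) by now apply pow_lt.
  assert (Hbn : 0 <= b ^ N) by now apply pow_le.
  assert (E : (b / x) ^ N = b ^ N / x ^ N).
  { unfold Rdiv. rewrite Rpow_mult_distr, pow_inv; lra. }
  rewrite E, Rabs_pos_eq in HN.
  2:{ apply Rmult_le_pos; auto. apply Rlt_le, Rinv_0_lt_compat; auto. }
  assert (b ^ N * (K + 1) < x ^ N).
  { apply Rmult_lt_reg_r with (/ (x ^ N) * / (K + 1)).
    - apply Rmult_lt_0_compat; apply Rinv_0_lt_compat; lra.
    - replace (b ^ N * (K + 1) * (/ x ^ N * / (K + 1))) with (b ^ N / x ^ N) by (field; lra).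
      replace (x ^ N * (/ x ^ N * / (K + 1))) with (/ (K + 1)) by (field; lra). auto. }
  nra.
Qed.

(* Cauchy's formula for [f ^ n] gives [|f z| ^ n <= K * B ^ n] with [K] independent of [n]. *)
Lemma max_modulus rho f r B z :
  holo rho f -> 0 < r < rho -> (forall v, Cmod v = r -> Cmod (f v) <= B) ->
  Cmod z <= r -> Cmod (f z) <= B.
Proof.
intros Hf [Hr0 Hr] HB [Hz|Hz]; [|now apply HB]. assert (Hp := Cmod_ge_0 z).
assert (P2 := PI2_gt_0).
assert (HB0 : 0 <= B).
{ eapply Rle_trans; [apply Cmod_ge_0 | apply (HB (circ r 0)), Cmod_circ; lra]. }
apply pow_growth_le with (K := r / (r - Cmod z)); auto; [apply Cmod_ge_0|].
intros n. assert (H := cauchy_formula rho _ r z (holo_pow rho f n Hf) Hr Hz).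
apply (is_CInt_bound_const _ _ _ _ (r / (r - Cmod z) * B ^ n)) in H; [|lra|].
- rewrite Cmod_mult, Cmod_R, Rabs_pos_eq, Rminus_0_r, Cmod_pow in H by lra.
  apply Rmult_le_reg_l in H; lra.
- intros t _. assert (N1 := circ_minus_neq r t z Hz).
  rewrite Cmod_mult, Cmod_div, Cmod_pow by auto.
  assert (Hc : Cmod (circ r t) = r) by (apply Cmod_circ; lra).
  assert (D1 := Cmod_minus_ge (circ r t) z). rewrite Hc in *.
  rewrite Rmult_comm. apply Rmult_le_compat.
  + apply Rmult_le_pos; [lra|]. apply Rlt_le, Rinv_0_lt_compat. lra.
  + apply pow_le, Cmod_ge_0.
  + apply Rmult_le_compat_l; [lra|]. apply Rinv_le_contravar; lra.
  + apply pow_incr. split; [apply Cmod_ge_0 | now apply HB].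
Qed.

(* The Herglotz representation [P z + conj (P 0) = avg (2 Re P(ζ) ζ / (ζ - z))]. *)
Lemma herglotz rho P r z :
  holo rho P -> r < rho -> Cmod z < r -> (forall w, Cmod w < rho -> 0 <= Re (P w)) ->
  Cmod (P z + Cconj (P 0)) <= 2 * Re (P 0) * (r / (r - Cmod z)).
Proof.
intros HP Hr Hz Hpos. assert (Hp := Cmod_ge_0 z). assert (P2 := PI2_gt_0).
assert (H := is_CInt_plus _ _ _ _ _ _ (cauchy_formula rho P r z HP Hr Hz)
   (conj_mean_value rho P r z HP Hr Hz)).
assert (Hr' : 0 < r < rho) by lra.
assert (M := proj1 (proj1 (is_CInt_pair _ _ _ _) (mean_value rho P r HP Hr'))).
apply (is_RInt_scal _ _ _ (2 * (r / (r - Cmod z)))) in M.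
apply (is_CInt_bound _ _ _ _ _ _ (Rlt_le _ _ P2)) with (2 := H) in M.
- replace (RtoC (2 * PI) * P z + RtoC (2 * PI) * Cconj (P 0))%C
    with (RtoC (2 * PI) * (P z + Cconj (P 0)))%C in M by ring.
  rewrite Cmod_mult, Cmod_R, Rabs_pos_eq, re_scal_l in M by lra.
  apply Rmult_le_reg_l with (2 * PI); auto. eapply Rle_trans; [exact M|].
  right. change (2 * (r / (r - Cmod z)) * (2 * PI * Re (P 0)) =
     2 * PI * (2 * Re (P 0) * (r / (r - Cmod z)))). ring.
- intros t _. assert (N1 := circ_minus_neq r t z Hz).
  assert (Hc : Cmod (circ r t) = r) by (apply Cmod_circ; lra).
  assert (Hre : (P (circ r t) + Cconj (P (circ r t)))%C = RtoC (2 * Re (P (circ r t)))).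
  { rewrite RtoC_mult, re_alt. field. }
  replace (P (circ r t) * (circ r t / (circ r t - z)) +
      Cconj (P (circ r t)) * (circ r t / (circ r t - z)))%C
    with (RtoC (2 * Re (P (circ r t))) * (circ r t / (circ r t - z)))%C
    by (rewrite <- Hre; ring).
  assert (Hpp : 0 <= Re (P (circ r t))) by (apply Hpos; lra).
  assert (D1 := Cmod_minus_ge (circ r t) z).
  rewrite Cmod_mult, Cmod_div, Cmod_R, Rabs_pos_eq by (auto; lra). rewrite Hc in *.
  change (2 * Re (P (circ r t)) * (r / Cmod (circ r t - z)) <=
    2 * (r / (r - Cmod z)) * Re (P (circ r t))).
  replace (2 * (r / (r - Cmod z)) * Re (P (circ r t)))
    with (2 * Re (P (circ r t)) * (r / (r - Cmod z))) by ring.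
  apply Rmult_le_compat_l; [lra|]. apply Rmult_le_compat_l; [lra|].
  apply Rinv_le_contravar; lra.
Qed.

Lemma holo_shift rho c f :
  (forall z, Cmod (z - c) < rho -> exists l, cderiv f z l) -> holo rho (fun w => f (c + w)%C).
Proof.
intros H w Hw. destruct (H (c + w)%C) as [l Hl].
- now replace (c + w - c)%C with w by ring.
- exists (l * (0 + 1))%C. apply (cderiv_comp f (fun w => c + w)%C); auto.
  apply cderiv_plus; [apply cderiv_const | apply cderiv_id].
Qed.

Lemma analytic_holo f : analytic f <-> holo 1 f.
Proof.
split; intros H z Hz; destruct (H z Hz) as [l Hl]; exists l; now apply is_derive_cderiv.
Qed.

Lemma analytic_shift f c rho : analytic f -> rho <= 1 - Cmod c ->
  holo rho (fun w => f (c + w)%C).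
Proof.
intros Hf Hr. apply holo_shift. intros z Hz. apply analytic_holo in Hf. apply Hf.
assert (H := Cmod_triangle (z - c) c). replace (z - c + c)%C with z in H by ring. lra.
Qed.

Lemma cderiv_bound f z l K : 0 <= K ->
  cderiv f z l -> (exists d, 0 < d /\ forall w, Cmod (w - z) < d ->
    Cmod (f w - f z) <= K * Cmod (w - z)) -> Cmod l <= K.
Proof.
intros HK Hl [d [Hd H]]. apply le_epsilon. intros e He.
destruct (proj1 (cderiv_eps f z l) Hl e He) as [d' [Hd' H']].
set (h := Rmin d d' / 2). assert (Hm : 0 < Rmin d d') by now apply Rmin_pos.
assert (L1 := Rmin_l d d'). assert (L2 := Rmin_r d d').
assert (Hw : Cmod (z + RtoC h - z) = h).
{ replace (z + RtoC h - z)%C with (RtoC h) by ring. rewrite Cmod_R, Rabs_pos_eq; unfold h; lra. }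
specialize (H (z + RtoC h)%C). specialize (H' (z + RtoC h)%C). rewrite Hw in *.
assert (Hh : 0 < h) by (unfold h; lra).
specialize (H ltac:(unfold h; lra)). specialize (H' ltac:(unfold h; lra)).
assert (E := Cmod_minus_ge (l * (z + RtoC h - z)) (f (z + RtoC h)%C - f z)).
rewrite (Cmod_minus_sym (l * _)), Cmod_mult, Hw in E.
apply Rmult_le_reg_r with h; auto. lra.
Qed.

(** * A mean value inequality for right derivatives *)

Lemma at_right_iff (t : R) (P : R -> Prop) :
  at_right t P <-> exists d, 0 < d /\ forall s, 0 < s < d -> P (t + s).
Proof.
split.
- intros [d Hd]. exists d. split; [apply cond_pos|]. intros s Hs. apply Hd; [|lra].
  change (Rabs (t + s - t) < d). replace (t + s - t) with s by ring.
  rewrite Rabs_pos_eq; lra.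
- intros [d [Hd H]]. exists (mkposreal d Hd). intros s Hs Hts.
  replace s with (t + (s - t)) by ring. apply H.
  change (Rabs (s - t) < d) in Hs. apply Rabs_def2 in Hs. lra.
Qed.

(** A bound of Dini type on the right speed. It is weaker than a right derivative because it is also
    applied to a truncated modulus, which has corners. *)
Definition right_slope_le (u : R -> C) (t M : R) : Prop :=
  forall e, 0 < e -> exists d, 0 < d /\
    forall s, 0 < s < d -> Cmod (u (t + s) - u t) <= (M + e) * s.

(** A slope bound already yields right continuity, so this is the other half. The condition s <= t
    keeps times nonnegative, where the semigroup is meaningful. *)
Definition left_cont (u : R -> C) (t : R) : Prop :=
  forall e, 0 < e -> exists d, 0 < d /\
    forall s, 0 < s < d -> s <= t -> Cmod (u (t - s) - u t) <= e.

(* The slope bound is only required while [u] stays in the ball of radius [r]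
   around its starting point, so no a priori bound on the curve is needed. *)
Lemma right_mean_value_local (u : R -> C) (a b M r : R) :
  0 <= a <= b -> 0 <= M -> M * (b - a) < r ->
  (forall t, a <= t < b -> Cmod (u t - u a) <= r -> right_slope_le u t M) ->
  (forall t, a < t <= b -> left_cont u t) ->
  Cmod (u b - u a) <= M * (b - a).
Proof.
intros [Ha0 Hab] HM Hr HR HL.
assert (Main : forall e, 0 < e -> (M + e) * (b - a) <= r ->
  Cmod (u b - u a) <= (M + e) * (b - a)).
{ intros e He Her.
  (* The bound with slope M + e propagates: left continuity carries it to the supremum m of E, and
     the right slope at m pushes it beyond m unless m = b. *)
  set (E := fun t => a <= t <= b /\
    forall x, a <= x <= t -> Cmod (u x - u a) <= (M + e) * (x - a)).
  assert (Ea : E a).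
  { split; [lra|]. intros x Hx. replace x with a by lra.
    replace (u a - u a)%C with (RtoC 0) by ring. rewrite Cmod_0. lra. }
  destruct (completeness E) as [m [Hub Hlub]].
  { exists b. intros t [Ht _]. lra. }
  { now exists a. }
  assert (Ham : a <= m) by now apply Hub.
  assert (Hmb : m <= b) by (apply Hlub; intros t [Ht _]; lra).
  assert (Hbelow : forall x, a <= x < m -> Cmod (u x - u a) <= (M + e) * (x - a)).
  { intros x Hx. apply NNPP. intros HN. assert (m <= x); [|lra].
    apply Hlub. intros t [Ht HEt]. apply Rnot_lt_le. intros Hxt. apply HN, HEt. lra. }
  assert (Hm : Cmod (u m - u a) <= (M + e) * (m - a)).
  { destruct Ham as [Ham|Ham]; [|subst m; apply Ea; lra].
    apply le_epsilon. intros h Hh.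
    destruct (HL m (conj Ham Hmb) h Hh) as [d [Hd HLd]].
    set (s := Rmin d (m - a) / 2).
    assert (Hp : 0 < Rmin d (m - a)) by (apply Rmin_pos; lra).
    assert (L1 := Rmin_l d (m - a)). assert (L2 := Rmin_r d (m - a)).
    assert (Hs : 0 < s) by (unfold s; lra).
    specialize (HLd s ltac:(unfold s; lra) ltac:(unfold s; lra)).
    specialize (Hbelow (m - s) ltac:(unfold s; lra)).
    rewrite Cmod_minus_sym in HLd.
    eapply Rle_trans; [apply (Cmod_dist_triangle _ (u (m - s)))|].
    assert ((M + e) * (m - s - a) <= (M + e) * (m - a)) by (apply Rmult_le_compat_l; lra).
    lra. }
  destruct Hmb as [Hmb|Hmb]; [|now subst m]. exfalso.
  assert (Hmr : Cmod (u m - u a) <= r).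
  { eapply Rle_trans; [exact Hm|]. eapply Rle_trans; [|exact Her].
    apply Rmult_le_compat_l; lra. }
  destruct (HR m (conj Ham Hmb) Hmr e He) as [d [Hd HRd]].
  set (s := Rmin d (b - m) / 2).
  assert (Hp : 0 < Rmin d (b - m)) by (apply Rmin_pos; lra).
  assert (L1 := Rmin_l d (b - m)). assert (L2 := Rmin_r d (b - m)).
  assert (Hs : 0 < s) by (unfold s; lra).
  assert (HE : E (m + s)).
  { split; [unfold s; lra|]. intros x Hx.
    destruct (Rlt_le_dec x m) as [Hxm|Hxm]; [apply Hbelow; lra|].
    destruct (Rle_lt_or_eq_dec _ _ Hxm) as [Hxm'|Hxm']; [|now subst x].
    specialize (HRd (x - m) ltac:(unfold s in *; lra)).
    replace (m + (x - m)) with x in HRd by ring.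
    eapply Rle_trans; [apply (Cmod_dist_triangle _ (u m))|]. lra. }
  apply Hub in HE. lra. }
destruct (Req_dec a b) as [Heq|Hne].
- subst b. replace (u a - u a)%C with (RtoC 0) by ring. rewrite Cmod_0. lra.
- apply le_epsilon. intros h Hh.
  (* The first bound makes the loss e (b - a) at most h; the second keeps (M + e) (b - a) <= r, so
     the curve stays where its slope is controlled. *)
  set (e := Rmin (h / (b - a)) ((r - M * (b - a)) / (b - a))).
  assert (He : 0 < e) by (apply Rmin_pos; apply Rdiv_lt_0_compat; lra).
  assert (E1 : e * (b - a) <= h).
  { apply Rle_trans with (h / (b - a) * (b - a)).
    - apply Rmult_le_compat_r; [lra | apply Rmin_l].
    - right. field. lra. }
  assert (E2 : e * (b - a) <= r - M * (b - a)).
  { apply Rle_trans with ((r - M * (b - a)) / (b - a) * (b - a)).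
    - apply Rmult_le_compat_r; [lra | apply Rmin_r].
    - right. field. lra. }
  specialize (Main e He). rewrite Rmult_plus_distr_r in Main. lra.
Qed.

Lemma right_mean_value (u : R -> C) (a b M : R) :
  0 <= a <= b -> 0 <= M ->
  (forall t, a <= t < b -> right_slope_le u t M) ->
  (forall t, a < t <= b -> left_cont u t) ->
  Cmod (u b - u a) <= M * (b - a).
Proof.
intros Hab HM HR HL. apply (right_mean_value_local u a b M (M * (b - a) + 1)); auto; lra.
Qed.

Lemma deriv_right_slope (u : R -> C) t l M :
  deriv_along (at_right t) RtoC u t l -> Cmod l <= M -> right_slope_le u t M.
Proof.
intros [q [Hq E]] Hl e He.
destruct (proj1 (at_right_iff _ _)
  (filter_and _ _ (proj1 (filterlim_C _ _ _) Hq e He) E)) as [d [Hd H]].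
exists d. split; auto. intros s Hs. destruct (H s Hs) as [H1 H2].
rewrite H2, <- RtoC_minus. replace (t + s - t) with s by ring.
rewrite Cmod_mult, Cmod_R, (Rabs_pos_eq s) by lra.
apply Rmult_le_compat_r; [lra|].
replace (q (t + s)) with ((q (t + s)%R - l) + l)%C by ring.
eapply Rle_trans; [apply Cmod_triangle|]. lra.
Qed.

Lemma RtoC_at_right t : filterlim RtoC (at_right t) (locally (RtoC t)).
Proof.
apply (filterlim_RtoC (F := at_right t) (fun s => s)).
intros P HP. now apply filter_le_within.
Qed.

(** * The flow of a semigroup *)

Lemma deriv_along_right_unique (u : R -> C) t l m :
  deriv_along (at_right t) RtoC u t l -> deriv_along (at_right t) RtoC u t m -> l = m.
Proof.
intros [q [Hq E]] [p [Hp D]].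
apply Ceq_minus, Cmod_eq_0. apply Rle_antisym; [|apply Cmod_ge_0].
apply le_epsilon. intros e He. rewrite Rplus_0_l. assert (He2 : 0 < e / 2) by lra.
destruct (proj1 (at_right_iff _ _) (filter_and _ _
  (filter_and _ _ (proj1 (filterlim_C _ _ _) Hq _ He2) (proj1 (filterlim_C _ _ _) Hp _ He2))
  (filter_and _ _ E D))) as [d [Hd H]].
destruct (H (d / 2) ltac:(lra)) as [[H1 H2] [H3 H4]].
set (x := t + d / 2) in *.
assert (Hx : (RtoC x - RtoC t)%C <> 0)
  by (rewrite <- RtoC_minus; apply RtoC_neq; unfold x; lra).
assert (Hqp : q x = p x).
{ rewrite H3 in H4. replace (q x) with (q x * (RtoC x - RtoC t) / (RtoC x - RtoC t))%C by (field; auto).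
  rewrite H4. field; auto. }
rewrite Hqp in H1.
eapply Rle_trans; [apply (Cmod_dist_triangle l (p x) m)|].
rewrite (Cmod_minus_sym l). lra.
Qed.

Lemma left_cont_comp (f : C -> C) (u : R -> C) t :
  filterlim f (locally (u t)) (locally (f (u t))) -> left_cont u t ->
  left_cont (fun s => f (u s)) t.
Proof.
intros Hf Hu e He.
destruct (proj1 (locally_Cmod _ _) (proj1 (filterlim_C _ _ _) Hf e He)) as [d [Hd H]].
destruct (Hu (d / 2) ltac:(lra)) as [h [Hh H']].
exists h. split; auto. intros s Hs Hst. apply Rlt_le, H.
specialize (H' s Hs Hst). lra.
Qed.

Lemma left_cont_plus (u v : R -> C) t :
  left_cont u t -> left_cont v t -> left_cont (fun s => u s + v s)%C t.
Proof.
intros Hu Hv e He.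
destruct (Hu (e / 2) ltac:(lra)) as [d [Hd H]].
destruct (Hv (e / 2) ltac:(lra)) as [d' [Hd' H']].
exists (Rmin d d'). split; [now apply Rmin_pos|]. intros s Hs Hst.
assert (L1 := Rmin_l d d'). assert (L2 := Rmin_r d d').
specialize (H s ltac:(lra) Hst). specialize (H' s ltac:(lra) Hst).
replace (u (t - s)%R + v (t - s)%R - (u t + v t))%C
  with ((u (t - s)%R - u t) + (v (t - s)%R - v t))%C by ring.
eapply Rle_trans; [apply Cmod_triangle|]. lra.
Qed.

Lemma left_cont_RtoC t : left_cont RtoC t.
Proof.
intros e He. exists e. split; auto. intros s Hs _.
rewrite <- RtoC_minus, Cmod_R. replace (t - s - t) with (- s) by ring.
rewrite Rabs_Ropp, Rabs_pos_eq; lra.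
Qed.

Lemma Rmin_lipschitz x y m : Rabs (Rmin x m - Rmin y m) <= Rabs (x - y).
Proof.
unfold Rmin, Rabs.
repeat destruct Rle_dec; repeat destruct Rcase_abs; lra.
Qed.

Lemma Cmod_lipschitz (a c : C) : Rabs (Cmod a - Cmod c) <= Cmod (a - c).
Proof.
assert (H1 := Cmod_minus_ge a c). assert (H2 := Cmod_minus_ge c a).
rewrite Cmod_minus_sym in H2. apply Rabs_le. lra.
Qed.

Section semigroup_flow.

Context (phi : R -> C -> C) (G : C -> C).
Hypothesis phi_sg : semigroup phi.
Hypothesis G_gen : infinitesimal_generator phi G.

Lemma semigroup_disk t z : 0 <= t -> disk z -> disk (phi t z).
Proof using phi_sg. intros Ht Hz. destruct phi_sg as [H _]. now apply (H t Ht). Qed.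

Lemma semigroup_0 z : disk z -> phi 0 z = z.
Proof using phi_sg. destruct phi_sg as [_ [H _]]. apply H. Qed.

Lemma semigroup_add t s z : 0 <= t -> 0 <= s -> disk z -> phi (t + s) z = phi t (phi s z).
Proof using phi_sg. destruct phi_sg as [_ [_ [H _]]]. intros; now apply H. Qed.

Lemma semigroup_holo t : 0 <= t -> holo 1 (phi t).
Proof using phi_sg.
intros Ht. apply analytic_holo. destruct phi_sg as [H _]. now apply (H t Ht).
Qed.

Lemma semigroup_cderiv t z : 0 <= t -> disk z -> cderiv (phi t) z (C_derive (phi t) z).
Proof using phi_sg.
intros Ht Hz. destruct (semigroup_holo t Ht z Hz) as [l Hl].
replace (C_derive (phi t) z) with l; auto.
symmetry. apply is_C_derive_unique. now apply is_derive_cderiv.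
Qed.

Lemma generator_right_deriv_0 z : disk z ->
  deriv_along (at_right 0) RtoC (fun t => phi t z) 0 (G z).
Proof using phi_sg G_gen.
intros Hz. exists (fun t => (phi t z - z) / RtoC t)%C. split; [now apply G_gen|].
apply at_right_iff. exists 1. split; [lra|]. intros s Hs.
rewrite Rplus_0_l, semigroup_0 by auto.
assert (RtoC s <> 0) by (apply RtoC_neq; lra). field; auto.
Qed.

Lemma semigroup_right_deriv t z : 0 <= t -> disk z ->
  deriv_along (at_right t) RtoC (fun s => phi s z) t (G (phi t z)).
Proof using phi_sg G_gen.
intros Ht Hz.
destruct (generator_right_deriv_0 (phi t z)) as [q [Hq E]]; [now apply semigroup_disk|].
exists (fun s => q (s - t)). split.
- apply (filterlim_comp _ _ _ (fun s => s - t) q _ (at_right 0)); auto.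
  intros P HP. apply at_right_iff in HP. destruct HP as [d [Hd H]].
  apply at_right_iff. exists d. split; auto. intros s Hs.
  replace (t + s - t) with (0 + s) by ring. now apply H.
- destruct (proj1 (at_right_iff _ _) E) as [d [Hd H]].
  apply at_right_iff. exists d. split; auto. intros s Hs. specialize (H s Hs).
  replace (t + s - t) with (0 + s) by ring.
  rewrite semigroup_0 in H by now apply semigroup_disk.
  rewrite Rplus_0_l in *. rewrite (Rplus_comm t s), semigroup_add, H, RtoC_plus by (auto; lra).
  ring.
Qed.

(** All the maps are bounded by 1, so L does not depend on t. This uniformity is what gives left
    continuity of orbits. *)
Lemma self_map_lipschitz s : 0 <= s < 1 ->
  exists L, 0 <= L /\ forall t z w, 0 <= t -> Cmod z <= s -> Cmod w <= s ->
    Cmod (phi t w - phi t z) <= L * Cmod (w - z).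
Proof using phi_sg.
intros Hs. set (r := (1 + s) / 2).
exists (1 * r / ((r - s) * (r - s))). split.
- apply Rmult_le_pos; [unfold r; lra|]. apply Rlt_le, Rinv_0_lt_compat, Rmult_lt_0_compat;
  unfold r; lra.
- intros t z w Ht Hz Hw. apply (cauchy_lipschitz 1); auto.
  + now apply semigroup_holo.
  + unfold r; lra.
  + intros v Hv. apply Rlt_le, semigroup_disk; auto. unfold disk, r in *; lra.
Qed.

Lemma semigroup_left_cont t z : 0 < t -> disk z -> left_cont (fun s => phi s z) t.
Proof using phi_sg G_gen.
intros Ht Hz e He. unfold disk in Hz. assert (Hz0 := Cmod_ge_0 z).
destruct (self_map_lipschitz ((1 + Cmod z) / 2)) as [L [HL HLip]]; [lra|].
assert (Hc := deriv_along_cont (RtoC_at_right 0) _ _ (generator_right_deriv_0 z Hz)).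
cbv beta in Hc. rewrite semigroup_0 in Hc by auto.
(* phi_t z - phi_(t-s) z compares phi_(t-s) at phi_s z and at z. The second bound keeps phi_s z in
   the disk of the Lipschitz estimate, the first makes L h <= e. *)
set (h := Rmin (e / (L + 1)) ((1 - Cmod z) / 2)).
assert (Hh : 0 < h) by (apply Rmin_pos; [apply Rdiv_lt_0_compat|]; lra).
destruct (proj1 (at_right_iff _ _) (proj1 (filterlim_C _ _ _) Hc h Hh)) as [d [Hd H]].
exists d. split; auto. intros s Hs Hst. specialize (H s Hs). rewrite Rplus_0_l in H.
replace t with ((t - s) + s) at 2 by ring. rewrite semigroup_add by (auto; lra).
rewrite Cmod_minus_sym.
assert (Hh1 : h <= e / (L + 1)) by apply Rmin_l.
assert (Hh2 : h <= (1 - Cmod z) / 2) by apply Rmin_r.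
eapply Rle_trans; [apply HLip; try lra|].
- replace (phi s z) with ((phi s z - z) + z)%C by ring.
  eapply Rle_trans; [apply Cmod_triangle|]. lra.
- apply Rle_trans with ((L + 1) * (e / (L + 1))); [|right; field; lra].
  apply Rmult_le_compat; try lra. apply Cmod_ge_0.
Qed.

(** Both sides are the right derivative at s = 0 of phi_t (phi_s z) = phi_s (phi_t z). *)
Lemma generator_derivative t z : 0 <= t -> disk z ->
  (C_derive (phi t) z * G z)%C = G (phi t z).
Proof using phi_sg G_gen.
intros Ht Hz.
assert (Hc : cderiv (phi t) (phi 0 z) (C_derive (phi t) z))
  by (rewrite semigroup_0 by auto; now apply semigroup_cderiv).
apply (deriv_along_right_unique (fun s => phi s (phi t z)) 0).
- assert (D := deriv_along_comp (RtoC_at_right 0) _ _ _ _ Hc (generator_right_deriv_0 z Hz)).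
  revert D. apply deriv_along_ext.
  + apply at_right_iff. exists 1. split; [lra|]. intros s Hs. rewrite Rplus_0_l.
    rewrite <- !semigroup_add by (auto; lra). f_equal. ring.
  + now rewrite !semigroup_0 by (try apply semigroup_disk; auto).
- now apply generator_right_deriv_0, semigroup_disk.
Qed.

(** The bound on G is asked for only in the ball of radius r: since K t < r, the local mean value
    inequality keeps the orbit there. *)
Lemma semigroup_close z t K r :
  disk z -> 0 <= t -> 0 <= K -> K * t < r ->
  (forall w, disk w -> Cmod (w - z) <= r -> Cmod (G w) <= K) ->
  Cmod (phi t z - z) <= K * t.
Proof using phi_sg G_gen.
intros Hz Ht HK Hr HG.
assert (H := right_mean_value_local (fun s => phi s z) 0 t K r).
cbv beta in H. rewrite Rminus_0_r, semigroup_0 in H by auto. apply H; auto; try lra.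
- intros s Hs Hsr. apply deriv_right_slope with (G (phi s z)).
  + apply semigroup_right_deriv; auto; lra.
  + apply HG; auto. apply semigroup_disk; auto; lra.
- intros s Hs. apply semigroup_left_cont; auto; lra.
Qed.

(* Truncating [|phi_s z|] at [r'] keeps only the part of the orbit where the speed
   is at most [K]. *)
Lemma semigroup_stays_near_circle z t K r r' :
  disk z -> 0 <= t -> 0 <= K -> r' < Cmod z -> K * t < r' - r ->
  (forall w, Cmod w <= r' -> disk w -> Cmod (G w) <= K) ->
  r < Cmod (phi t z).
Proof using phi_sg G_gen.
intros Hz Ht HK Hr' Hr HG.
set (u := fun s => RtoC (Rmin (Cmod (phi s z)) r')).
assert (Hu : forall s s', Cmod (u s - u s') <= Cmod (phi s z - phi s' z)).
{ intros s s'. unfold u. rewrite <- RtoC_minus, Cmod_R.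
  eapply Rle_trans; [apply Rmin_lipschitz | apply Cmod_lipschitz]. }
assert (H : Cmod (u t - u 0) <= K * (t - 0)).
{ apply right_mean_value; auto; try lra.
  - intros s Hs e He.
    assert (D := semigroup_right_deriv s z (proj1 Hs) Hz).
    destruct (Rle_lt_dec (Cmod (phi s z)) r') as [Hle|Hgt].
    + assert (HGs : Cmod (G (phi s z)) <= K) by (apply HG; auto; apply semigroup_disk; auto; lra).
      destruct (deriv_right_slope _ _ _ _ D HGs e He) as [d [Hd Hd']].
      exists d. split; auto. intros h Hh. eapply Rle_trans; [apply Hu|]. now apply Hd'.
    (* Strictly beyond r' the truncated modulus is constant for a short time, whatever the speed of
       the orbit. *)
    + assert (Hc := deriv_along_cont (RtoC_at_right s) _ _ D).
      assert (He' : 0 < Cmod (phi s z) - r') by lra.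
      destruct (proj1 (at_right_iff _ _) (proj1 (filterlim_C _ _ _) Hc _ He')) as [d [Hd Hd']].
      exists d. split; auto. intros h Hh. specialize (Hd' h Hh).
      assert (L := Cmod_lipschitz (phi (s + h) z) (phi s z)).
      apply Rle_lt_trans with (2 := Hd') in L. apply Rabs_def2 in L.
      unfold u. rewrite !Rmin_right by lra.
      replace (RtoC r' - RtoC r')%C with (RtoC 0) by ring. rewrite Cmod_0.
      apply Rmult_le_pos; lra.
  - intros s Hs e He. destruct (semigroup_left_cont s z ltac:(lra) Hz e He) as [d [Hd Hd']].
    exists d. split; auto. intros h Hh Hhs. eapply Rle_trans; [apply Hu|]. now apply Hd'. }
unfold u in H. rewrite <- RtoC_minus, Cmod_R, semigroup_0 in H by auto.
rewrite (Rmin_right (Cmod z) r') in H by lra.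
rewrite Rabs_minus_sym in H. assert (H' := Rle_abs (r' - Rmin (Cmod (phi t z)) r')).
assert (Rmin (Cmod (phi t z)) r' <= Cmod (phi t z)) by apply Rmin_l. lra.
Qed.

Lemma flow_right_deriv (H : C -> C) t z l :
  0 <= t -> disk z -> cderiv H (phi t z) l ->
  deriv_along (at_right t) RtoC (fun s => H (phi s z)) t (l * G (phi t z))%C.
Proof using phi_sg G_gen.
intros Ht Hz Hl. apply (deriv_along_comp (RtoC_at_right t) H (fun s => phi s z)); auto.
now apply semigroup_right_deriv.
Qed.

End semigroup_flow.

(** * Functions with nonnegative real part and the generator *)

Lemma disk_of_dist c w rho : rho <= 1 - Cmod c -> Cmod (w - c) < rho -> disk w.
Proof.
intros H Hw. unfold disk. replace w with ((w - c) + c)%C by ring.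
eapply Rle_lt_trans; [apply Cmod_triangle|]. lra.
Qed.

Lemma Re_le_Cmod (z : C) : Re z <= Cmod z.
Proof. eapply Rle_trans; [apply Rle_abs | apply re_le_Cmod]. Qed.

Lemma Cmod_from_sum (a c : C) M : Cmod (a + Cconj c) <= M -> Cmod a <= M + Cmod c.
Proof.
intros H. replace a with ((a + Cconj c) + - Cconj c)%C by ring.
eapply Rle_trans; [apply Cmod_triangle|]. rewrite Cmod_opp, Cmod_conj. lra.
Qed.

Section positive_real_part.

Context (P : C -> C).
Hypothesis P_an : analytic P.
Hypothesis P_pos : forall z, disk z -> 0 <= Re (P z).

Lemma herglotz_disk c w r : r < 1 - Cmod c -> Cmod (w - c) < r ->
  Cmod (P w + Cconj (P c)) <= 2 * Re (P c) * (r / (r - Cmod (w - c))).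
Proof using P_an P_pos.
intros Hr Hw.
assert (H := herglotz (1 - Cmod c) (fun v => P (c + v)%C) r (w - c)
  (analytic_shift P c _ P_an (Rle_refl _)) Hr Hw).
cbv beta in H. replace (c + (w - c))%C with w in H by ring.
replace (c + 0)%C with c in H by ring. apply H.
intros v Hv. apply P_pos. apply (disk_of_dist c) with (1 - Cmod c); [lra|].
now replace (c + v - c)%C with v by ring.
Qed.

(** Herglotz on the radius (1 + |z|) / 2 gives the factor 2 (1 + |z|) / (1 - |z|) <= 4 / (1 - |z|);
    removing conj (P 0) costs one more |P 0|. *)
Lemma positive_growth z : disk z -> Cmod (P z) <= 5 * Cmod (P 0) / (1 - Cmod z).
Proof using P_an P_pos.
unfold disk. intros Hz. assert (Hz0 := Cmod_ge_0 z).
assert (E0 : Cmod (z - 0) = Cmod z) by (f_equal; ring).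
assert (H := herglotz_disk 0 z ((1 + Cmod z) / 2)).
rewrite E0, Cmod_0 in H. specialize (H ltac:(lra) ltac:(lra)).
apply Cmod_from_sum in H. eapply Rle_trans; [exact H|].
assert (HR := Re_le_Cmod (P 0)). assert (H0 := P_pos 0 ltac:(unfold disk; rewrite Cmod_0; lra)).
assert (HP0 := Cmod_ge_0 (P 0)).
replace ((1 + Cmod z) / 2 / ((1 + Cmod z) / 2 - Cmod z))
  with ((1 + Cmod z) / (1 - Cmod z)) by (field; lra).
apply Rmult_le_reg_r with (1 - Cmod z); [lra|].
replace (5 * Cmod (P 0) / (1 - Cmod z) * (1 - Cmod z)) with (5 * Cmod (P 0)) by (field; lra).
replace ((2 * Re (P 0) * ((1 + Cmod z) / (1 - Cmod z)) + Cmod (P 0)) * (1 - Cmod z))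
  with (2 * Re (P 0) * (1 + Cmod z) + Cmod (P 0) * (1 - Cmod z)) by (field; lra).
nra.
Qed.

(** Herglotz on the circle of radius 3/4 (1 - |c|) about c has ratio at most 3, hence 2 * 3 + 1 =
    7. *)
Lemma positive_harnack c w : disk c -> Cmod (w - c) <= (1 - Cmod c) / 2 ->
  Cmod (P w) <= 7 * Cmod (P c).
Proof using P_an P_pos.
unfold disk. intros Hc Hw. assert (H := herglotz_disk c w (3 / 4 * (1 - Cmod c))).
specialize (H ltac:(lra) ltac:(lra)). apply Cmod_from_sum in H.
eapply Rle_trans; [exact H|]. assert (HR := Re_le_Cmod (P c)).
assert (H0 := P_pos c Hc).
assert (3 / 4 * (1 - Cmod c) / (3 / 4 * (1 - Cmod c) - Cmod (w - c)) <= 3).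
{ apply Rmult_le_reg_r with (3 / 4 * (1 - Cmod c) - Cmod (w - c)); [lra|].
  unfold Rdiv at 1. rewrite Rmult_assoc, Rinv_l by lra. lra. }
nra.
Qed.

Lemma positive_zero_local c w : P c = 0 -> Cmod (w - c) < 1 - Cmod c -> P w = 0.
Proof using P_an P_pos.
intros Hc Hw.
assert (H := herglotz_disk c w ((Cmod (w - c) + (1 - Cmod c)) / 2)).
specialize (H ltac:(lra) ltac:(lra)). apply Cmod_from_sum in H.
rewrite Hc, Cmod_0, re_RtoC in H. apply Cmod_eq_0. apply Rle_antisym; [lra | apply Cmod_ge_0].
Qed.

(** A chain of disks leads the zero to the origin. With d = 1 - |c| <= 1/2, passing from c to c (1 -
    d / 2) raises the distance to the circle to 3/2 d - d^2 / 2 >= 5/4 d, so n steps suffice. *)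
Lemma positive_zero_origin n c :
  disk c -> P c = 0 -> 1 / 2 < (5 / 4) ^ n * (1 - Cmod c) -> P 0 = 0.
Proof using P_an P_pos.
assert (Base : forall c, P c = 0 -> 1 / 2 < 1 - Cmod c -> P 0 = 0).
{ intros c' Hc Hd. apply (positive_zero_local c'); auto.
  replace (0 - c')%C with (- c')%C by ring. rewrite Cmod_opp. lra. }
revert c. induction n as [|n IH]; intros c Hc HP Hn.
- apply (Base c); auto. simpl in Hn. lra.
- destruct (Rlt_le_dec (1 / 2) (1 - Cmod c)) as [Hd|Hd]; [now apply (Base c)|].
  unfold disk in Hc. set (d := 1 - Cmod c) in *.
  assert (E : Cmod (c * RtoC (1 - d / 2)) = Cmod c * (1 - d / 2))
    by (rewrite Cmod_mult, Cmod_R, Rabs_pos_eq; lra).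
  assert (Hc0 := Cmod_ge_0 c).
  assert (Ec : Cmod c = 1 - d) by (unfold d; ring).
  apply (IH (c * RtoC (1 - d / 2))%C).
  + unfold disk. rewrite E, Ec. nra.
  + apply (positive_zero_local c); auto. fold d.
    replace (c * RtoC (1 - d / 2) - c)%C with (- (c * RtoC (d / 2)))%C
      by (rewrite RtoC_minus; ring).
    rewrite Cmod_opp, Cmod_mult, Cmod_R, Rabs_pos_eq, Ec by lra. nra.
  + rewrite E, Ec. simpl in Hn.
    assert (0 < (5 / 4) ^ n) by (apply pow_lt; lra).
    assert (5 / 4 * d <= 1 - (1 - d) * (1 - d / 2)) by nra. nra.
Qed.

Lemma positive_zero_everywhere c z : disk c -> P c = 0 -> disk z -> P z = 0.
Proof using P_an P_pos.
intros Hc HP Hz. apply (positive_zero_local 0).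
- destruct (Pow_x_infinity (5 / 4)) with (b := / (1 - Cmod c)) as [N HN].
  + rewrite Rabs_pos_eq; lra.
  + specialize (HN N (Nat.le_refl _)). rewrite Rabs_pos_eq in HN by (apply pow_le; lra).
    apply (positive_zero_origin N c); auto. unfold disk in Hc.
    assert (/ (1 - Cmod c) * (1 - Cmod c) = 1) by (field; lra). nra.
- rewrite Cmod_0. replace (z - 0)%C with z by ring. unfold disk in Hz. lra.
Qed.

End positive_real_part.

Section boundary_generator.

Context (P G : C -> C) (b : C).
Hypothesis P_an : analytic P.
Hypothesis P_pos : forall z, disk z -> 0 <= Re (P z).
Hypothesis b_circle : Cmod b = 1.
Hypothesis G_eq : forall z, disk z -> G z = ((Cconj b * z - 1) * (z - b) * P z)%C.

Lemma generator_square z : disk z -> G z = (Cconj b * ((z - b) * (z - b)) * P z)%C.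
Proof using b_circle G_eq.
intros Hz. rewrite G_eq by auto.
assert (E : (b * Cconj b)%C = 1) by (rewrite <- Cmod2_conj, b_circle; f_equal; ring).
replace (Cconj b * z - 1)%C with (Cconj b * (z - b))%C.
- ring.
- replace (Cconj b * (z - b))%C with (Cconj b * z - b * Cconj b)%C by ring. now rewrite E.
Qed.

Lemma generator_Cmod z : disk z -> Cmod (G z) = Cmod (z - b) * Cmod (z - b) * Cmod (P z).
Proof using b_circle G_eq.
intros Hz. rewrite generator_square by auto. rewrite !Cmod_mult, Cmod_conj, b_circle. ring.
Qed.

Lemma generator_analytic : holo 1 G.
Proof using P_an b_circle G_eq.
intros z Hz. destruct (proj1 (analytic_holo P) P_an z Hz) as [l Hl].
eexists. apply (deriv_along_ext (F := locally z) (i := fun w => w)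
  (fun w => Cconj b * ((w - b) * (w - b)) * P w)%C).
- apply locally_Cmod. exists (1 - Cmod z). split; [lra|]. intros w Hw.
  symmetry. apply generator_square. apply (disk_of_dist z w (1 - Cmod z)); auto. lra.
- symmetry. now apply generator_square.
- apply cderiv_mult; [|exact Hl]. apply cderiv_scal.
  apply cderiv_mult; (apply cderiv_minus; [apply cderiv_id | apply cderiv_const]).
Qed.

Lemma generator_bound r z : r < 1 -> disk z -> Cmod z <= r ->
  Cmod (G z) <= 20 * Cmod (P 0) / (1 - r).
Proof using P_an P_pos b_circle G_eq.
intros Hr Hz Hzr. rewrite generator_Cmod by auto.
assert (HP := positive_growth P P_an P_pos z Hz).
assert (Hb : Cmod (z - b) <= 2).
{ eapply Rle_trans; [apply Cmod_triangle|]. rewrite Cmod_opp, b_circle.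
  unfold disk in Hz. lra. }
assert (H1 := Cmod_ge_0 (z - b)). assert (H2 := Cmod_ge_0 (P z)). assert (H3 := Cmod_ge_0 (P 0)).
assert (5 * Cmod (P 0) / (1 - Cmod z) <= 5 * Cmod (P 0) / (1 - r)).
{ apply Rmult_le_compat_l; [lra|]. apply Rinv_le_contravar; lra. }
replace (20 * Cmod (P 0) / (1 - r)) with (4 * (5 * Cmod (P 0) / (1 - r))) by (field; lra).
apply Rmult_le_compat; nra.
Qed.

Lemma radial_distance r : 0 <= r < 1 -> Cmod (RtoC r * b) = r /\ Cmod (RtoC r * b - b) = 1 - r.
Proof using b_circle.
intros Hr. split.
- rewrite Cmod_mult, Cmod_R, b_circle, Rabs_pos_eq; lra.
- replace (RtoC r * b - b)%C with (- (RtoC (1 - r) * b))%C by (rewrite RtoC_minus; ring).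
  rewrite Cmod_opp, Cmod_mult, Cmod_R, b_circle, Rabs_pos_eq; lra.
Qed.

Lemma generator_radial r : 0 <= r < 1 -> Cmod (G (RtoC r * b)%C) <= 5 * Cmod (P 0) * (1 - r).
Proof using P_an P_pos b_circle G_eq.
intros Hr. destruct (radial_distance r Hr) as [E1 E2].
assert (Hz : disk (RtoC r * b)) by (unfold disk; lra).
rewrite generator_Cmod, E2 by auto.
assert (HP := positive_growth P P_an P_pos _ Hz). rewrite E1 in HP.
replace (5 * Cmod (P 0) * (1 - r))
  with ((1 - r) * (1 - r) * (5 * Cmod (P 0) / (1 - r))) by (field; lra).
apply Rmult_le_compat_l; nra.
Qed.

(** Here |w - b| <= 3/2 |r b - b| and Harnack costs 7, so the factor is 7 * 9/4 <= 16. *)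
Lemma generator_radial_harnack r w : 0 <= r < 1 ->
  Cmod (w - RtoC r * b) <= (1 - r) / 2 -> Cmod (G w) <= 16 * Cmod (G (RtoC r * b)%C).
Proof using P_an P_pos b_circle G_eq.
intros Hr Hw. destruct (radial_distance r Hr) as [E1 E2].
assert (Hz : disk (RtoC r * b)) by (unfold disk; lra).
assert (Hdw : disk w) by (apply (disk_of_dist (RtoC r * b) w (1 - r)); lra).
rewrite !generator_Cmod, E2 by auto.
assert (HP : Cmod (P w) <= 7 * Cmod (P (RtoC r * b)%C))
  by (apply positive_harnack; auto; rewrite E1; lra).
assert (Hwb : Cmod (w - b) <= 3 / 2 * (1 - r)).
{ eapply Rle_trans; [apply (Cmod_dist_triangle w (RtoC r * b) b)|]. lra. }
assert (H1 := Cmod_ge_0 (w - b)). assert (H2 := Cmod_ge_0 (P w)).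
assert (Cmod (w - b) * Cmod (w - b) <= 9 / 4 * ((1 - r) * (1 - r))) by nra.
apply Rle_trans with (9 / 4 * ((1 - r) * (1 - r)) * (7 * Cmod (P (RtoC r * b)%C))).
- apply Rmult_le_compat; nra.
- assert (0 <= (1 - r) * (1 - r) * Cmod (P (RtoC r * b)%C)) by (apply Rmult_le_pos; nra). nra.
Qed.

(** A zero of G is a zero of P, as |z - b| > 0 inside the disk. Then P and G vanish identically, and
    orbits of speed 0 do not move. *)
Lemma generator_nonzero (phi : R -> C -> C) z :
  semigroup phi -> infinitesimal_generator phi G -> nontrivial phi -> disk z -> G z <> 0.
Proof using P_an P_pos b_circle G_eq.
intros Hsg HG [t [Ht [w [Hw Hne]]]] Hz E.
assert (HPz : P z = 0).
{ apply Cmod_eq_0. assert (E' := generator_Cmod z Hz). rewrite E, Cmod_0 in E'.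
  assert (Hb : 0 < Cmod (z - b)).
  { assert (H := Cmod_minus_ge b z). rewrite Cmod_minus_sym in H. unfold disk in Hz. lra. }
  symmetry in E'. apply Rmult_integral in E'. destruct E' as [E'|E']; auto. nra. }
apply Hne, Ceq_minus, Cmod_eq_0, Rle_antisym; [|apply Cmod_ge_0].
replace 0 with (0 * t) by ring.
apply (semigroup_close phi G Hsg HG w t 0 1); auto; try lra.
intros v Hv _. rewrite generator_Cmod, (positive_zero_everywhere P P_an P_pos z v), Cmod_0; auto.
lra.
Qed.

End boundary_generator.

(** * Lacunary power series *)

Lemma choice_of_exists {A B : Type} (Q : A -> B -> Prop) :
  (forall x, exists y, Q x y) -> exists f, forall x, Q x (f x).
Proof.
intros H. exists (fun x => proj1_sig (constructive_indefinite_description _ (H x))).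
intros x. exact (proj2_sig (constructive_indefinite_description _ (H x))).
Qed.

Fixpoint csum (f : nat -> C) (K : nat) : C :=
  match K with O => RtoC 0 | S K' => (csum f K' + f K')%C end.

Fixpoint rsum (f : nat -> R) (K : nat) : R :=
  match K with O => 0 | S K' => rsum f K' + f K' end.

Lemma Cmod_csum_le f g K : (forall k, Cmod (f k) <= g k) -> Cmod (csum f K) <= rsum g K.
Proof.
intros H. induction K as [|K IH]; simpl; [rewrite Cmod_0; lra|].
eapply Rle_trans; [apply Cmod_triangle|]. specialize (H K). lra.
Qed.

Lemma csum_limit_ex f g B :
  (forall k, Cmod (f k) <= g k) -> (forall K, rsum g K <= B) ->
  exists l, filterlim (csum f) eventually (locally l).
Proof.
intros Hf HB.
assert (Hg : forall k, 0 <= g k) by (intros k; eapply Rle_trans; [apply Cmod_ge_0 | apply Hf]).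
assert (Hsum : forall n, sum_n g n = rsum g (S n)).
{ induction n; [rewrite sum_O; simpl; ring|]. rewrite sum_Sn, IHn. reflexivity. }
assert (Eg : ex_series g).
{ destruct (ex_finite_lim_seq_incr (sum_n g) B) as [l Hl].
  - intros n. rewrite sum_Sn. unfold plus; simpl. specialize (Hg (S n)). lra.
  - intros n. rewrite Hsum. apply HB.
  - exists l. exact Hl. }
destruct (ex_series_le (K := R_AbsRing) (V := C_R_CompleteNormedModule) f g) as [l Hl].
- intros k. change (norm (V := C_R_NormedModule) (f k) <= g k). rewrite norm_C_R. apply Hf.
- exact Eg.
- exists l. intros P HP. specialize (Hl P HP). destruct Hl as [N HN].
  exists (S N). intros m Hm. destruct m as [|m]; [lia|].
  specialize (HN m ltac:(lia)).
  replace (csum f (S m)) with (sum_n (G := C_R_CompleteNormedModule) f m); auto.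
  clear. induction m; [rewrite sum_O; simpl; ring|]. rewrite sum_Sn, IHm. reflexivity.
Qed.

(** The remainders satisfy R_(n+1) = w R_n + n z^(n-1) (w - z)^2, and n^2 + n <= (n + 1)^2.
    Multiplying by s^2 on the left stands for the exponent n - 2 on the right. *)
Lemma pow_taylor_bound (z w : C) (s : R) (n : nat) :
  0 <= s -> Cmod z <= s -> Cmod w <= s ->
  s * s * Cmod (w ^ n - z ^ n - RtoC (INR n) * z ^ pred n * (w - z)) <=
  INR n ^ 2 * s ^ n * (Cmod (w - z) * Cmod (w - z)).
Proof.
intros Hs Hz Hw. set (D := Cmod (w - z) * Cmod (w - z)).
assert (HD : 0 <= D) by (apply Rmult_le_pos; apply Cmod_ge_0).
induction n as [|n IH].
- simpl. replace (1 - 1 - 0 * 1 * (w - z))%C with (RtoC 0) by ring. rewrite Cmod_0. lra.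
- assert (Hstep : (w ^ S n - z ^ S n - RtoC (INR (S n)) * z ^ pred (S n) * (w - z))%C =
    (w * (w ^ n - z ^ n - RtoC (INR n) * z ^ pred n * (w - z)) +
     RtoC (INR n) * z ^ pred n * ((w - z) * (w - z)))%C).
  { rewrite S_INR, RtoC_plus, !Cpow_S. destruct n as [|n].
    - simpl. ring.
    - change (pred (S (S n))) with (S n). change (pred (S n)) with n.
      rewrite !(Cpow_S z n). ring. }
  rewrite Hstep.
  set (E := (w ^ n - z ^ n - RtoC (INR n) * z ^ pred n * (w - z))%C) in *.
  assert (Hn0 := pos_INR n). assert (Hsn : 0 <= s ^ n) by now apply pow_le.
  assert (T1 : Cmod (w * E) <= s * Cmod E).
  { rewrite Cmod_mult. apply Rmult_le_compat_r; auto. apply Cmod_ge_0. }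
  assert (T2 : s * s * Cmod (RtoC (INR n) * z ^ pred n * ((w - z) * (w - z))) <=
     INR n * s ^ S n * D).
  { rewrite !Cmod_mult, Cmod_R, Rabs_pos_eq, Cmod_pow by auto. fold D.
    replace (s * s * (INR n * Cmod z ^ pred n * D)) with (INR n * D * (s * s * Cmod z ^ pred n)) by ring.
    replace (INR n * s ^ S n * D) with (INR n * D * s ^ S n) by ring.
    destruct n as [|n]; [simpl; lra|].
    apply Rmult_le_compat_l; [now apply Rmult_le_pos|].
    change (s * s * Cmod z ^ n <= s * (s * s ^ n)). rewrite Rmult_assoc.
    apply Rmult_le_compat_l; auto. apply Rmult_le_compat_l; auto.
    apply pow_incr. split; [apply Cmod_ge_0 | auto]. }
  apply Rle_trans with (s * (s * s * Cmod E) + INR n * s ^ S n * D).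
  + eapply Rle_trans; [apply Rmult_le_compat_l; [nra | apply Cmod_triangle]|].
    rewrite Rmult_plus_distr_l.
    apply Rplus_le_compat; auto.
    replace (s * (s * s * Cmod E)) with (s * s * (s * Cmod E)) by ring.
    apply Rmult_le_compat_l; [nra | auto].
  + apply Rle_trans with (s * (INR n ^ 2 * s ^ n * D) + INR n * s ^ S n * D).
    * apply Rplus_le_compat_r. now apply Rmult_le_compat_l.
    * rewrite S_INR. simpl (s ^ S n).
      replace (s * (INR n ^ 2 * s ^ n * D) + INR n * (s * s ^ n) * D)
        with ((INR n ^ 2 + INR n) * (s * s ^ n * D)) by ring.
      replace ((INR n + 1) ^ 2 * (s * s ^ n) * D) with ((INR n + 1) ^ 2 * (s * s ^ n * D)) by ring.
      apply Rmult_le_compat_r; [|nra]. apply Rmult_le_pos; auto. now apply Rmult_le_pos.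
Qed.

Lemma csum_minus_scal (f g : nat -> C) (p : nat -> C) (c : C) K :
  (csum f K - csum g K - csum p K * c)%C = csum (fun k => f k - g k - p k * c)%C K.
Proof. induction K as [|K IH]; simpl; [ring|]. rewrite <- IH. ring. Qed.

Lemma rsum_scal c f K : rsum (fun k => c * f k) K = c * rsum f K.
Proof. induction K as [|K IH]; simpl; [ring|]. rewrite IH. ring. Qed.

Lemma rsum_le f g K : (forall k, (k < K)%nat -> f k <= g k) -> rsum f K <= rsum g K.
Proof.
intros H. induction K as [|K IH]; simpl; [lra|].
assert (H1 := H K ltac:(lia)). assert (IH' := IH ltac:(intros; apply H; lia)). lra.
Qed.

(** The weight n_k^2 in the hypothesis dominates the series, its termwise derivative and the
    second-order remainder, so the derivative is obtained directly from the Taylor bound. *)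
Lemma lacunary_series (a : nat -> R) (n : nat -> nat) :
  (forall k, 0 <= a k) -> (forall k, (1 <= n k)%nat) ->
  (forall s, 0 <= s < 1 -> exists B, forall K,
     rsum (fun k => a k * (INR (n k) ^ 2 * s ^ n k)) K <= B) ->
  exists h h' : C -> C, forall z, disk z ->
    filterlim (csum (fun k => RtoC (a k) * z ^ n k)%C) eventually (locally (h z)) /\
    filterlim (csum (fun k => RtoC (a k) * (RtoC (INR (n k)) * z ^ pred (n k)))%C)
      eventually (locally (h' z)) /\
    cderiv h z (h' z).
Proof.
intros Ha Hn HB.
assert (Hn1 : forall k, 1 <= INR (n k)) by (intros k; apply (le_INR 1), Hn).
assert (Hex : forall z, exists l, disk z ->
  filterlim (csum (fun k => RtoC (a k) * z ^ n k)%C) eventually (locally l)).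
{ intros z. destruct (Rlt_le_dec (Cmod z) 1) as [Hz|Hz].
  2:{ exists (RtoC 0). intros H. unfold disk in H. lra. }
  destruct (HB (Cmod z)) as [B HBz]; [split; [apply Cmod_ge_0 | auto]|].
  destruct (csum_limit_ex (fun k => RtoC (a k) * z ^ n k)%C
    (fun k => a k * (INR (n k) ^ 2 * Cmod z ^ n k)) B) as [l Hl]; [|exact HBz|].
  - intros k. rewrite Cmod_mult, Cmod_R, Rabs_pos_eq, Cmod_pow by auto.
    apply Rmult_le_compat_l; auto.
    assert (0 <= Cmod z ^ n k) by apply pow_le, Cmod_ge_0. specialize (Hn1 k).
    assert (1 <= INR (n k) ^ 2) by nra. nra.
  - now exists l. }
assert (Hex' : forall z, exists l, disk z ->
  filterlim (csum (fun k => RtoC (a k) * (RtoC (INR (n k)) * z ^ pred (n k)))%C)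
    eventually (locally l)).
{ intros z. destruct (Rlt_le_dec (Cmod z) 1) as [Hz|Hz].
  2:{ exists (RtoC 0). intros H. unfold disk in H. lra. }
  assert (Hz0 := Cmod_ge_0 z). set (s := (1 + Cmod z) / 2).
  destruct (HB s) as [B HBz]; [unfold s; lra|].
  destruct (csum_limit_ex (fun k => RtoC (a k) * (RtoC (INR (n k)) * z ^ pred (n k)))%C
     (fun k => 2 * (a k * (INR (n k) ^ 2 * s ^ n k))) (2 * B)) as [l Hl].
  - intros k. rewrite !Cmod_mult, !Cmod_R, !Rabs_pos_eq, Cmod_pow by (auto; apply pos_INR).
    replace (2 * (a k * (INR (n k) ^ 2 * s ^ n k)))
      with (a k * (INR (n k) * (2 * INR (n k) * s ^ n k))) by ring.
    apply Rmult_le_compat_l; auto. apply Rmult_le_compat_l; [apply pos_INR|].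
    specialize (Hn1 k). specialize (Hn k). destruct (n k) as [|m] eqn:En; [lia|].
    change (pred (S m)) with m.
    assert (Cmod z ^ m <= s ^ m) by (apply pow_incr; unfold s; lra).
    assert (0 <= Cmod z ^ m) by now apply pow_le.
    assert (Hs : 1 / 2 <= s) by (unfold s; lra).
    change (s ^ S m) with (s * s ^ m).
    apply Rle_trans with (s ^ m); auto.
    apply Rle_trans with (2 * 1 * (1 / 2 * s ^ m)); [lra|].
    apply Rmult_le_compat; nra.
  - intros K. rewrite rsum_scal. specialize (HBz K). lra.
  - now exists l. }
destruct (choice_of_exists _ Hex) as [h Hh]. destruct (choice_of_exists _ Hex') as [h' Hh'].
exists h, h'. intros z Hz. split; [auto|]. split; [auto|].
apply cderiv_eps. intros e He. unfold disk in Hz. assert (Hz0 := Cmod_ge_0 z).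
set (s := (1 + Cmod z) / 2). destruct (HB s) as [B HBs]; [unfold s; lra|].
assert (HB0 : 0 <= B) by exact (HBs O).
assert (Hs : 1 / 2 <= s) by (unfold s; lra).
(* The first bound keeps w in the disk of radius s; the second makes the remainder 4 B |w - z|^2 at
   most e |w - z|. The 4 bounds 1 / s^2, as s >= 1/2. *)
set (d := Rmin ((1 - Cmod z) / 2) (e / (4 * B + 1))).
exists d. split; [apply Rmin_pos; [lra | apply Rdiv_lt_0_compat; lra]|].
intros w Hw.
assert (Hw1 : Cmod (w - z) < (1 - Cmod z) / 2) by (eapply Rlt_le_trans; [exact Hw | apply Rmin_l]).
assert (Hw2 : Cmod (w - z) < e / (4 * B + 1)) by (eapply Rlt_le_trans; [exact Hw | apply Rmin_r]).
assert (Hws : Cmod w <= s).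
{ replace w with ((w - z) + z)%C by ring. eapply Rle_trans; [apply Cmod_triangle|]. unfold s. lra. }
assert (Hzs : Cmod z <= s) by (unfold s; lra).
assert (Hwd : disk w) by (unfold disk, s in *; lra).
assert (Hlim := filterlim_Cminus _ _ _ _ (filterlim_Cminus _ _ _ _ (Hh w Hwd) (Hh z Hz))
  (filterlim_Cmult _ _ _ _ (Hh' z Hz) (filterlim_const (w - z)%C))).
assert (Hb : Cmod (h w - h z - h' z * (w - z) - 0) <= 4 * B * (Cmod (w - z) * Cmod (w - z))).
{ apply (Cmod_limit_le _ _ _ _ O Hlim). intros K _.
  match goal with |- Cmod (?X - RtoC 0)%C <= _ => replace (X - RtoC 0)%C with X by ring end.
  rewrite csum_minus_scal.
  apply Rle_trans with (rsum (fun k => 4 * (Cmod (w - z) * Cmod (w - z)) *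
     (a k * (INR (n k) ^ 2 * s ^ n k))) K).
  - apply Cmod_csum_le. intros k.
    replace (RtoC (a k) * w ^ n k - RtoC (a k) * z ^ n k -
        RtoC (a k) * (RtoC (INR (n k)) * z ^ pred (n k)) * (w - z))%C
      with (RtoC (a k) * (w ^ n k - z ^ n k - RtoC (INR (n k)) * z ^ pred (n k) * (w - z)))%C by ring.
    rewrite Cmod_mult, Cmod_R, Rabs_pos_eq by auto.
    assert (T := pow_taylor_bound z w s (n k) ltac:(lra) Hzs Hws).
    match type of T with _ * ?Y <= _ => set (X := Y) in * end.
    assert (HX : 0 <= X) by apply Cmod_ge_0.
    set (D := Cmod (w - z) * Cmod (w - z)) in *.
    replace (4 * D * (a k * (INR (n k) ^ 2 * s ^ n k)))
      with (a k * (4 * (INR (n k) ^ 2 * s ^ n k * D))) by ring.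
    apply Rmult_le_compat_l; auto.
    assert (1 / 4 * X <= s * s * X) by (apply Rmult_le_compat_r; [exact HX | clear - Hs; nra]). clear - T HX H. lra.
  - rewrite rsum_scal.
    assert (0 <= Cmod (w - z) * Cmod (w - z)) by (apply Rmult_le_pos; apply Cmod_ge_0).
    specialize (HBs K). nra. }
replace (h w - h z - h' z * (w - z) - 0)%C with (h w - h z - h' z * (w - z))%C in Hb by ring.
eapply Rle_trans; [exact Hb|].
rewrite <- Rmult_assoc. apply Rmult_le_compat_r; [apply Cmod_ge_0|].
apply Rle_trans with ((4 * B + 1) * (e / (4 * B + 1))).
- apply Rmult_le_compat; try lra. apply Cmod_ge_0.
- right. field. lra.
Qed.

(** Write q = p^4 and 1 / p = 1 + y. Bernoulli gives p^n <= 1 / (n y), hence n^2 q^n <= 1 / (n^2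
    y^4). *)
Lemma square_geometric_small q eta : 0 < q < 1 -> 0 < eta ->
  exists n, (1 <= n)%nat /\ INR n ^ 2 * q ^ n <= eta.
Proof.
intros Hq Heta.
set (p := sqrt (sqrt q)).
assert (Hp : 0 < p) by (apply sqrt_lt_R0, sqrt_lt_R0; lra).
assert (Hpq : (p * p) * (p * p) = q).
{ unfold p. rewrite sqrt_sqrt by apply sqrt_pos. apply sqrt_sqrt. lra. }
assert (Hp1 : p < 1).
{ apply Rnot_le_lt. intros H1. assert (1 <= p * p) by nra. nra. }
set (y := / p - 1).
assert (Hy : 0 < y) by (unfold y; assert (1 < / p) by (rewrite <- Rinv_1 at 1; apply Rinv_lt_contravar; lra); lra).
destruct (INR_unbounded (/ (eta * (y * y * (y * y))) + 1)) as [n Hn].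
assert (Hy4 : 0 < y * y * (y * y)) by (repeat apply Rmult_lt_0_compat; auto).
assert (Hi : 0 < / (eta * (y * y * (y * y)))) by (apply Rinv_0_lt_compat, Rmult_lt_0_compat; auto).
assert (Hn1 : 1 < INR n) by lra.
exists n. split; [apply INR_le; simpl; lra|].
assert (Hpn : INR n * y * p ^ n <= 1).
{ assert (H := poly n y Hy). replace (1 + y) with (/ p) in H by (unfold y; ring).
  rewrite pow_inv in H. assert (Hpn : 0 < p ^ n) by now apply pow_lt.
  apply Rmult_le_reg_r with (/ p ^ n); [now apply Rinv_0_lt_compat|].
  rewrite Rmult_assoc, Rinv_r by lra. lra. }
rewrite <- Hpq, !Rpow_mult_distr.
assert (Hpn0 : 0 < p ^ n) by now apply pow_lt.
set (x := INR n * y * p ^ n) in *.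
assert (Hx : 0 <= x) by (unfold x; repeat apply Rmult_le_pos; lra).
assert (Hx4 : x * x * (x * x) <= 1).
{ assert (x * x <= 1) by nra. nra. }
apply Rmult_le_reg_r with (INR n ^ 2 * (y * y * (y * y))).
- apply Rmult_lt_0_compat; auto. apply pow_lt. lra.
- replace (INR n ^ 2 * (p ^ n * p ^ n * (p ^ n * p ^ n)) * (INR n ^ 2 * (y * y * (y * y))))
    with (x * x * (x * x)) by (unfold x; ring).
  eapply Rle_trans; [exact Hx4|].
  assert (Hlow : / (eta * (y * y * (y * y))) <= INR n ^ 2) by nra.
  apply Rle_trans with (eta * (y * y * (y * y)) * / (eta * (y * y * (y * y)))).
  + rewrite Rinv_r; [lra|]. apply Rgt_not_eq, Rmult_lt_0_compat; auto.
  + replace (eta * (INR n ^ 2 * (y * y * (y * y)))) with (eta * (y * y * (y * y)) * INR n ^ 2) by ring.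
    apply Rmult_le_compat_l; auto. apply Rlt_le, Rmult_lt_0_compat; auto.
Qed.

(** * Weights *)

Lemma Cmod_RtoC_pos r : 0 <= r -> Cmod (RtoC r) = r.
Proof. intros H. now rewrite Cmod_R, Rabs_pos_eq. Qed.

Lemma disk_RtoC s : 0 <= s < 1 -> disk (RtoC s).
Proof. intros H. unfold disk. rewrite Cmod_RtoC_pos; lra. Qed.

Lemma weighted_norm_ge v f z : disk z -> Rbar_le (v z * Cmod (f z)) (weighted_norm v f).
Proof.
intros Hz. unfold weighted_norm. destruct (Lub_Rbar_correct (fun x : R =>
  exists z : C, disk z /\ x = v z * Cmod (f z))) as [H _].
apply H. now exists z.
Qed.

Lemma weighted_norm_le v f B :
  (forall z, disk z -> v z * Cmod (f z) <= B) -> Rbar_le (weighted_norm v f) B.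
Proof.
intros H. unfold weighted_norm. destruct (Lub_Rbar_correct (fun x : R =>
  exists z : C, disk z /\ x = v z * Cmod (f z))) as [_ H'].
apply H'. intros x [z [Hz ->]]. now apply H.
Qed.

Lemma weighted_norm_finite v f :
  Rbar_lt (weighted_norm v f) p_infty <->
  exists B, forall z, disk z -> v z * Cmod (f z) <= B.
Proof.
split.
- intros H. assert (Hge := weighted_norm_ge v f).
  destruct (weighted_norm v f) as [B| |]; simpl in *; try easy.
  + exists B. exact Hge.
  + exfalso. apply (Hge 0). unfold disk. rewrite Cmod_0. lra.
- intros [B HB]. eapply Rbar_le_lt_trans; [now apply weighted_norm_le with (B := B)|]. easy.
Qed.

Lemma operator_bound v phi :
  Rbar_lt (Rbar_lub (fun y : Rbar => exists t : R,
     0 <= t <= 1 /\ y = op_norm v (weighted_comp phi t))) p_infty ->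
  exists M, 0 < M /\ forall t f N, 0 <= t <= 1 -> analytic f -> 0 < N ->
    (forall z, disk z -> v z * Cmod (f z) <= N) ->
    forall z, disk z -> v z * Cmod (C_derive (phi t) z * f (phi t z)) <= M * N.
Proof.
intros Hlt.
set (L := Rbar_lub _) in Hlt.
assert (HL : forall t f, 0 <= t <= 1 -> analytic f ->
  (forall z, disk z -> v z * Cmod (f z) <= 1) ->
  forall z, disk z -> Rbar_le (v z * Cmod (C_derive (phi t) z * f (phi t z))) L).
{ intros t f Ht Hf Hb z Hz.
  eapply Rbar_le_trans; [apply (weighted_norm_ge v (weighted_comp phi t f) z Hz)|].
  apply Rbar_le_trans with (op_norm v (weighted_comp phi t)).
  - unfold op_norm. apply (proj1 (proj2_sig (Rbar_ex_lub _))). exists f.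
    assert (Hn : Rbar_le (weighted_norm v f) 1) by now apply weighted_norm_le.
    repeat split; auto. eapply Rbar_le_lt_trans; [exact Hn|easy].
  - apply (proj1 (proj2_sig (Rbar_ex_lub _))). now exists t. }
assert (HM : exists M, 0 < M /\ forall x : R, Rbar_le x L -> x <= M).
{ destruct L as [l| |]; try easy.
  - exists (Rmax l 1). split; [eapply Rlt_le_trans; [|apply Rmax_r]; lra|].
    intros x Hx. eapply Rle_trans; [exact Hx | apply Rmax_l].
  - exists 1. split; [lra|]. easy. }
destruct HM as [M [HM0 HM]]. exists M. split; auto.
intros t f N Ht Hf HN Hb z Hz.
assert (HNi : 0 < / N) by now apply Rinv_0_lt_compat.
assert (H := HL t (fun w => RtoC (/ N) * f w)%C Ht).
assert (Han : analytic (fun w => RtoC (/ N) * f w)%C).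
{ apply analytic_holo. intros w Hw. destruct (proj1 (analytic_holo f) Hf w Hw) as [l Hl].
  eexists. apply cderiv_scal, Hl. }
assert (Hb1 : forall w, disk w -> v w * Cmod (RtoC (/ N) * f w) <= 1).
{ intros w Hw. rewrite Cmod_mult, Cmod_RtoC_pos by lra. specialize (Hb w Hw).
  apply Rmult_le_reg_l with N; auto.
  replace (N * (v w * (/ N * Cmod (f w)))) with (v w * Cmod (f w)) by (field; lra). lra. }
assert (Hx := HM _ (H Han Hb1 z Hz)).
cbv beta in Hx.
replace (C_derive (phi t) z * (RtoC (/ N) * f (phi t z)))%C
  with (RtoC (/ N) * (C_derive (phi t) z * f (phi t z)))%C in Hx by ring.
rewrite (Cmod_mult (RtoC (/ N))), Cmod_RtoC_pos in Hx by lra.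
apply Rmult_le_reg_l with (/ N); auto.
replace (/ N * (M * N)) with M by (field; lra). lra.
Qed.

Lemma to_circle_small (f : C -> R) : filterlim f to_circle (locally 0) ->
  forall e, 0 < e -> exists rho, 0 <= rho < 1 /\
    forall z, rho < Cmod z < 1 -> Rabs (f z) < e.
Proof.
intros Hf e He.
assert (H : to_circle (fun z => Rabs (f z) < e)).
{ apply (Hf (fun x => Rabs x < e)). exists (mkposreal e He).
  intros y Hy. change (Rabs (y - 0) < e) in Hy. now rewrite Rminus_0_r in Hy. }
destruct H as [d Hd]. exists (Rmax 0 (1 - d)). split.
- split; [apply Rmax_l | apply Rmax_lub_lt; [lra|]]. assert (Hdp := cond_pos d). lra.
- intros z Hz. assert (H1 := Rmax_r 0 (1 - d)).
  apply (Hd (Cmod z)); auto; try lra.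
  change (Rabs (Cmod z - 1) < d). rewrite Rabs_left; lra.
Qed.

Section weights.

Context (v : C -> R).
Hypothesis v_weight : weight v.
Hypothesis v_typical : typical v.

Lemma weight_pos z : disk z -> 0 < v z.
Proof using v_weight. apply v_weight. Qed.

Lemma weight_bounded : exists B, 0 < B /\ forall z, disk z -> v z <= B.
Proof using v_weight.
destruct v_weight as [[B HB] _]. exists (Rmax B 1). split.
- eapply Rlt_le_trans; [|apply Rmax_r]. lra.
- intros z Hz. eapply Rle_trans; [now apply HB | apply Rmax_l].
Qed.

Lemma weight_radial z : disk z -> v z = v (RtoC (Cmod z)).
Proof using v_weight.
intros Hz. assert (H0 := Cmod_ge_0 z).
apply v_weight; auto.
- apply disk_RtoC. unfold disk in Hz. lra.
- now rewrite Cmod_RtoC_pos.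
Qed.

Lemma weight_small e : 0 < e -> exists rho, 0 <= rho < 1 /\ forall z, rho < Cmod z < 1 -> v z < e.
Proof using v_typical.
intros He. destruct (to_circle_small v v_typical e He) as [rho [Hr H]].
exists rho. split; auto. intros z Hz. eapply Rle_lt_trans; [apply Rle_abs | now apply H].
Qed.

(** a is the inverse of the supremum of v (s) s^n over [0, 1), and r is a point where more than half
    of it is reached. *)
Lemma weighted_monomial_peak n :
  exists a r, 0 < a /\ 0 <= r < 1 /\
    (forall s, 0 <= s < 1 -> v (RtoC s) * (a * s ^ n) <= 1) /\
    1 / 2 <= v (RtoC r) * (a * r ^ n).
Proof using v_weight.
destruct weight_bounded as [B [HB0 HB]].
destruct (completeness (fun x => exists s, 0 <= s < 1 /\ x = v (RtoC s) * s ^ n)) as [N [Hub Hlub]].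
- exists B. intros x [s [Hs ->]].
  assert (Hv := HB _ (disk_RtoC s Hs)). assert (Hv0 := weight_pos _ (disk_RtoC s Hs)).
  assert (0 <= s ^ n) by (apply pow_le; lra).
  assert (s ^ n <= 1) by (rewrite <- (pow1 n); apply pow_incr; lra). nra.
- exists (v (RtoC 0) * 0 ^ n), 0. split; [lra | auto].
- assert (HN : 0 < N).
  { apply Rlt_le_trans with (v (RtoC (1 / 2)) * (1 / 2) ^ n).
    - apply Rmult_lt_0_compat; [apply weight_pos, disk_RtoC; lra | apply pow_lt; lra].
    - apply Hub. exists (1 / 2). split; [lra | auto]. }
  assert (HNi : 0 < / N) by now apply Rinv_0_lt_compat.
  assert (Hr : exists r, 0 <= r < 1 /\ N / 2 < v (RtoC r) * r ^ n).
  { apply NNPP. intros Hno. assert (N <= N / 2); [|lra]. apply Hlub.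
    intros x [s [Hs ->]]. apply Rnot_lt_le. intros Hlt. apply Hno. now exists s. }
  destruct Hr as [r [Hr Hpk]]. exists (/ N), r. repeat split; auto; try lra.
  + intros s Hs. apply Rmult_le_reg_l with N; auto.
    replace (N * (v (RtoC s) * (/ N * s ^ n))) with (v (RtoC s) * s ^ n) by (field; lra).
    rewrite Rmult_1_r. apply Hub. now exists s.
  + apply Rmult_le_reg_l with N; auto.
    replace (N * (v (RtoC r) * (/ N * r ^ n))) with (v (RtoC r) * r ^ n) by (field; lra). lra.
Qed.

(** Normalization at the intermediate radius sigma gives a sigma^n <= 1 / v (sigma), so a n^2 rho^n
    <= n^2 (rho / sigma)^n / v (sigma) is small for a suitable n. The peak must then lie beyond
    rho. *)
Lemma weighted_monomial rho e : 0 < rho < 1 -> 0 < e ->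
  exists n a r, (1 <= n)%nat /\ 0 < a /\ rho < r < 1 /\
    (forall s, 0 <= s < 1 -> v (RtoC s) * (a * s ^ n) <= 1) /\
    1 / 2 <= v (RtoC r) * (a * r ^ n) /\
    a * (INR n ^ 2 * rho ^ n) <= e.
Proof using v_weight.
intros Hrho He. destruct weight_bounded as [B [HB0 HB]].
set (sigma := (1 + rho) / 2).
assert (Hs : 0 <= sigma < 1) by (unfold sigma; lra).
assert (Hv := weight_pos _ (disk_RtoC sigma Hs)).
(* With a rho^n <= 1 / (4 B), the weighted monomial is at most 1/4 on |z| <= rho, too small for a
   peak of height 1/2. *)
set (e' := Rmin e (1 / (4 * B))).
assert (He' : 0 < e') by (apply Rmin_pos; auto; apply Rdiv_lt_0_compat; lra).
assert (L1 : e' <= e) by apply Rmin_l.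
assert (L2 : B * e' <= 1 / 4).
{ apply Rle_trans with (B * (1 / (4 * B))); [apply Rmult_le_compat_l; [lra | apply Rmin_r]|].
  right. field. lra. }
destruct (square_geometric_small (rho / sigma) (v (RtoC sigma) * e')) as [n [Hn Hsm]].
{ split; [apply Rdiv_lt_0_compat; unfold sigma; lra|].
  apply Rmult_lt_reg_r with sigma; [unfold sigma; lra|].
  unfold Rdiv. rewrite Rmult_assoc, Rinv_l by (unfold sigma; lra). unfold sigma. lra. }
{ now apply Rmult_lt_0_compat. }
destruct (weighted_monomial_peak n) as [a [r [Ha [Hr [Hle Hpk]]]]].
assert (Hsn : 0 < sigma ^ n) by (apply pow_lt; unfold sigma; lra).
assert (Hsmall : a * (INR n ^ 2 * rho ^ n) <= e').
{ specialize (Hle sigma Hs).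
  replace (rho ^ n) with ((rho / sigma) ^ n * sigma ^ n)
    by (rewrite <- Rpow_mult_distr; f_equal; field; unfold sigma; lra).
  assert (0 <= a * sigma ^ n) by (apply Rmult_le_pos; lra).
  replace (a * (INR n ^ 2 * ((rho / sigma) ^ n * sigma ^ n)))
    with (a * sigma ^ n * (INR n ^ 2 * (rho / sigma) ^ n)) by ring.
  apply Rle_trans with (a * sigma ^ n * (v (RtoC sigma) * e')).
  - now apply Rmult_le_compat_l.
  - replace (a * sigma ^ n * (v (RtoC sigma) * e'))
      with (v (RtoC sigma) * (a * sigma ^ n) * e') by ring. nra. }
exists n, a, r. repeat split; auto; try lra.
apply Rnot_le_lt. intros Hrr.
assert (Hn1 : 1 <= INR n) by now apply (le_INR 1).
assert (Hrn : r ^ n <= rho ^ n) by (apply pow_incr; lra).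
assert (Hrn0 : 0 <= r ^ n) by (apply pow_le; lra).
assert (a * r ^ n <= e').
{ eapply Rle_trans; [|exact Hsmall]. apply Rmult_le_compat_l; [lra|].
  assert (1 <= INR n ^ 2) by nra. nra. }
assert (Hvr := HB _ (disk_RtoC r Hr)). assert (Hvr0 := weight_pos _ (disk_RtoC r Hr)).
assert (0 <= a * r ^ n) by (apply Rmult_le_pos; lra).
assert (v (RtoC r) * (a * r ^ n) <= B * e') by (apply Rmult_le_compat; lra). lra.
Qed.

End weights.

(** A stands for the sum of the coefficients chosen so far and r for the last peak. Beyond rho the
    earlier terms weigh at most 1/8, and below rho the new term is negligible. *)
Lemma lacunary_step v A r e : weight v -> typical v -> 0 <= A -> 0 <= r < 1 -> 0 < e ->
  exists n a r' rho, (1 <= n)%nat /\ 0 < a /\ 1 / 2 <= rho /\ rho < r' < 1 /\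
    (1 + r) / 2 <= rho /\
    (forall s, 0 <= s < 1 -> v (RtoC s) * (a * s ^ n) <= 1) /\
    1 / 2 <= v (RtoC r') * (a * r' ^ n) /\
    a * (INR n ^ 2 * rho ^ n) <= e /\
    (forall s, rho <= s < 1 -> v (RtoC s) * A <= 1 / 8).
Proof.
intros Hv Ht HA Hr He.
destruct (weight_small v Ht (1 / (8 * (A + 1)))) as [rho0 [Hrho0 Hsm]].
{ apply Rdiv_lt_0_compat; lra. }
set (rho := Rmax ((1 + r) / 2) ((1 + rho0) / 2)).
assert (H1 : (1 + r) / 2 <= rho) by apply Rmax_l.
assert (H2 : (1 + rho0) / 2 <= rho) by apply Rmax_r.
assert (H3 : rho < 1) by (apply Rmax_lub_lt; lra).
destruct (weighted_monomial v Hv rho e) as [n [a [r' [Hn [Ha [Hr' [Hle [Hpk Hs]]]]]]]]; [lra|auto|].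
exists n, a, r', rho. repeat split; auto; try lra.
intros s Hs'. assert (Hvs := Hsm (RtoC s)). rewrite Cmod_RtoC_pos in Hvs by lra.
specialize (Hvs ltac:(lra)).
apply Rle_trans with (1 / (8 * (A + 1)) * A); [apply Rmult_le_compat_r; lra|].
apply Rmult_le_reg_r with (8 * (A + 1)); [lra|].
replace (1 / (8 * (A + 1)) * A * (8 * (A + 1))) with A by (field; lra). lra.
Qed.

Lemma lacunary_sequence v e : weight v -> typical v -> (forall k : nat, 0 < e k) ->
  exists (n : nat -> nat) (a r rho : nat -> R),
    (forall k, (1 <= n k)%nat /\ 0 < a k /\ 1 / 2 <= rho k /\ rho k < r k < 1 /\
       (1 + r k) / 2 <= rho (S k)) /\
    (forall k s, 0 <= s < 1 -> v (RtoC s) * (a k * s ^ n k) <= 1) /\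
    (forall k, 1 / 2 <= v (RtoC (r k)) * (a k * r k ^ n k)) /\
    (forall k, a k * (INR (n k) ^ 2 * rho k ^ n k) <= e k) /\
    (forall k s, rho k <= s < 1 -> v (RtoC s) * rsum a k <= 1 / 8).
Proof.
intros Hv Ht He.
(* The state of the recursion is the pair formed by the sum of the previous coefficients and the
   last peak. *)
set (ok := fun x : R * R => 0 <= fst x /\ 0 <= snd x < 1).
assert (F : forall (k : nat) (x : {x | ok x}), {y : nat * R * R * R |
  let '(n, a, r', rho) := y in
  (1 <= n)%nat /\ 0 < a /\ 1 / 2 <= rho /\ rho < r' < 1 /\
    (1 + snd (proj1_sig x)) / 2 <= rho /\
    (forall s, 0 <= s < 1 -> v (RtoC s) * (a * s ^ n) <= 1) /\
    1 / 2 <= v (RtoC r') * (a * r' ^ n) /\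
    a * (INR n ^ 2 * rho ^ n) <= e k /\
    (forall s, rho <= s < 1 -> v (RtoC s) * fst (proj1_sig x) <= 1 / 8)}).
{ intros k [[A r] [HA Hr]]. apply constructive_indefinite_description. simpl in *.
  destruct (lacunary_step v A r (e k) Hv Ht HA Hr (He k)) as [n [a [r' [rho H]]]].
  exists (n, a, r', rho). exact H. }
set (nn := fun y : nat * R * R * R => fst (fst (fst y))).
set (aa := fun y : nat * R * R * R => snd (fst (fst y))).
set (rr := fun y : nat * R * R * R => snd (fst y)).
assert (Hok : forall k x, ok (fst (proj1_sig x) + aa (proj1_sig (F k x)), rr (proj1_sig (F k x)))).
{ intros k x. destruct (F k x) as [[[[n a] r'] rho] H]. destruct x as [[A r] [HA Hr]].
  unfold ok, aa, rr. simpl in *. decompose [and] H. split; [|split]; lra. }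
assert (ok0 : ok (0, 0)) by (unfold ok; simpl; lra).
set (st := nat_rect (fun _ => {x | ok x}) (exist ok (0, 0) ok0)
  (fun k x => exist ok _ (Hok k x))).
set (y := fun k => proj1_sig (F k (st k))).
assert (Hsum : forall k, fst (proj1_sig (st k)) = rsum (fun k => aa (y k)) k).
{ induction k as [|k IH]; [reflexivity|]. simpl rsum. rewrite <- IH. reflexivity. }
assert (Hsnd : forall k, snd (proj1_sig (st (S k))) = rr (y k)) by reflexivity.
exists (fun k => nn (y k)), (fun k => aa (y k)), (fun k => rr (y k)), (fun k => snd (y k)).
assert (H : forall k, let '(n, a, r', rho) := y k in
  (1 <= n)%nat /\ 0 < a /\ 1 / 2 <= rho /\ rho < r' < 1 /\
    (1 + snd (proj1_sig (st k))) / 2 <= rho /\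
    (forall s, 0 <= s < 1 -> v (RtoC s) * (a * s ^ n) <= 1) /\
    1 / 2 <= v (RtoC r') * (a * r' ^ n) /\
    a * (INR n ^ 2 * rho ^ n) <= e k /\
    (forall s, rho <= s < 1 -> v (RtoC s) * fst (proj1_sig (st k)) <= 1 / 8)).
{ intros k. exact (proj2_sig (F k (st k))). }
split; [|split; [|split; [|split]]]; intros k; assert (Hk := H k).
- assert (Hk1 := H (S k)). rewrite Hsnd in Hk1.
  destruct (y k) as [[[n a] r'] rho]. destruct (y (S k)) as [[[n1 a1] r1] rho1].
  unfold nn, aa, rr in *. simpl in *. tauto.
- destruct (y k) as [[[n a] r'] rho]. unfold nn, aa. simpl in *. tauto.
- destruct (y k) as [[[n a] r'] rho]. unfold nn, aa, rr. simpl in *. tauto.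
- destruct (y k) as [[[n a] r'] rho]. unfold nn, aa, rr. simpl in *. tauto.
- rewrite Hsum in Hk. destruct (y k) as [[[n a] r'] rho] eqn:E.
  simpl. tauto.
Qed.

Lemma rsum_split f m p : rsum f (m + p) = rsum f m + rsum (fun j => f (m + j)%nat) p.
Proof.
induction p as [|p IH]; [rewrite Nat.add_0_r; simpl; ring|].
rewrite Nat.add_succ_r. simpl. rewrite IH. ring.
Qed.

Lemma csum_split f m p : csum f (m + p) = (csum f m + csum (fun j => f (m + j)%nat) p)%C.
Proof.
induction p as [|p IH]; [rewrite Nat.add_0_r; simpl; ring|].
rewrite Nat.add_succ_r. simpl. rewrite IH. ring.
Qed.

Lemma rsum_nonneg f K : (forall k, 0 <= f k) -> 0 <= rsum f K.
Proof. intros H. induction K as [|K IH]; simpl; [lra|]. specialize (H K). lra. Qed.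

Lemma rsum_mono f K L : (forall k, 0 <= f k) -> (K <= L)%nat -> rsum f K <= rsum f L.
Proof.
intros H HKL. replace L with (K + (L - K))%nat by lia. rewrite rsum_split.
assert (H1 := rsum_nonneg (fun j => f (K + j)%nat) (L - K) (fun j => H _)). lra.
Qed.

Lemma rsum_term_le f k K : (forall j, 0 <= f j) -> (k < K)%nat -> f k <= rsum f K.
Proof.
intros H HkK. apply Rle_trans with (rsum f (S k)); [|apply rsum_mono; auto].
simpl. assert (H1 := rsum_nonneg f k H). lra.
Qed.

Lemma rsum_geometric m p : rsum (fun j => (1 / 2) ^ (m + j)) p <= 2 * (1 / 2) ^ m - 2 * (1/2) ^ (m + p).
Proof.
induction p as [|p IH]; [rewrite Nat.add_0_r; simpl; lra|].
rewrite Nat.add_succ_r. simpl. lra.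
Qed.

Lemma pow_le_1 x k : 0 <= x <= 1 -> x ^ k <= 1.
Proof. intros H. rewrite <- (pow1 k). now apply pow_incr. Qed.

Lemma exp_INR_mult n x : exp (INR n * x) = exp x ^ n.
Proof.
induction n as [|n IH]; [simpl; rewrite Rmult_0_l; apply exp_0|].
rewrite S_INR, Rmult_plus_distr_r, exp_plus, IH, Rmult_1_l. simpl. ring.
Qed.

(** For r >= 1/2, 1 / r <= 1 + 2 (1 - r) <= exp (2 (1 - r)). *)
Lemma inverse_power_bound r n K :
  1 / 2 <= r < 1 -> (1 - r) * INR n <= K -> (/ r) ^ n <= exp (2 * K).
Proof.
intros Hr HK.
apply Rle_trans with (exp (2 * (1 - r)) ^ n).
- apply pow_incr. split; [apply Rlt_le, Rinv_0_lt_compat; lra|].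
  apply Rle_trans with (1 + 2 * (1 - r)); [|apply exp_ineq1_le].
  apply Rmult_le_reg_r with r; [lra|]. rewrite Rinv_l by lra. nra.
- rewrite <- exp_INR_mult.
  destruct (Req_dec (INR n * (2 * (1 - r))) (2 * K)) as [->|Hne]; [lra|].
  apply Rlt_le, exp_increasing. assert (H := pos_INR n). nra.
Qed.

(* A lacunary series [sum a_k z^(n_k)] of normalized monomials with well separated
   peaks [r_k]. Quasi-normality applied to it bounds [(1 - r_k) n_k], which makes
   the dominant term at [r_k] comparable on the larger disk of radius
   [(1 + r_k) / 2]. *)
Lemma peak_function v : weight v -> typical v -> quasi_normal v ->
  exists h, analytic h /\ (forall z, disk z -> v z * Cmod (h z) <= 2) /\
    exists K, 0 < K /\ forall rho, rho < 1 -> exists r, rho < r < 1 /\ 1 / 2 <= r /\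
      forall z, Cmod z = r -> 1 / 4 <= v z * Cmod (h z) /\
        forall w, Cmod w <= (1 + r) / 2 -> v z * Cmod (h w) <= K.
Proof.
intros Hv Ht Hqn.
destruct (weight_bounded v Hv) as [B [HB0 HB]].
assert (HBi : 0 < 1 / (16 * B)) by (apply Rdiv_lt_0_compat; lra).
(* These errors sum to at most 1 / (8 B), so that the tail, multiplied by a weight at most B, stays
   below 1/8. *)
destruct (lacunary_sequence v (fun k => 1 / (16 * B) * (1 / 2) ^ k) Hv Ht)
  as [n [a [r [rho [H1 [H2 [H3 [H4 H5]]]]]]]].
{ intros k. apply Rmult_lt_0_compat; auto. apply pow_lt; lra. }
assert (Ha : forall k, 0 <= a k) by (intros k; apply Rlt_le, H1).
assert (Hn : forall k, (1 <= n k)%nat) by (intros k; apply H1).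
assert (Hn1 : forall k, 1 <= INR (n k)) by (intros k; apply (le_INR 1), Hn).
assert (Hrho : forall k, 1 / 2 <= rho k /\ rho k < r k < 1 /\ (1 + r k) / 2 <= rho (S k))
  by (intros k; destruct (H1 k) as [_ [_ H]]; tauto).
assert (Hrho_mono : forall k j, rho k <= rho (k + j)%nat).
{ intros k. induction j as [|j IH]; [rewrite Nat.add_0_r; lra|].
  rewrite Nat.add_succ_r. assert (Hk := Hrho (k + j)%nat). lra. }
assert (Hrho_lim : forall k, 1 - rho k <= (1 / 2) ^ k).
{ induction k as [|k IH]; simpl; [destruct (Hrho O); lra|]. assert (Hk := Hrho k). lra. }
assert (Hfind : forall s, s < 1 -> exists k, s < rho k).
{ intros s Hs. destruct (pow_lt_1_zero (1 / 2)) with (y := 1 - s) as [N HN];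
    [rewrite Rabs_pos_eq; lra | lra |].
  exists N. specialize (HN N (Nat.le_refl _)). specialize (Hrho_lim N).
  rewrite Rabs_pos_eq in HN by (apply pow_le; lra). lra. }
assert (Htail : forall k s p, 0 <= s <= rho k ->
  rsum (fun j => a (k + j)%nat * (INR (n (k + j)%nat) ^ 2 * s ^ n (k + j)%nat)) p <= 1 / (8 * B)).
{ intros k s p Hs.
  apply Rle_trans with (rsum (fun j => 1 / (16 * B) * (1 / 2) ^ (k + j)) p).
  - apply rsum_le. intros j _. eapply Rle_trans; [|apply H4].
    apply Rmult_le_compat_l; auto. apply Rmult_le_compat_l; [apply pow2_ge_0|].
    apply pow_incr. specialize (Hrho_mono k j). lra.
  - rewrite rsum_scal. assert (Hg := rsum_geometric k p).
    assert (0 <= (1 / 2) ^ (k + p)) by (apply pow_le; lra).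
    assert ((1 / 2) ^ k <= 1) by (apply pow_le_1; lra).
    replace (1 / (8 * B)) with (1 / (16 * B) * 2) by (field; lra).
    apply Rmult_le_compat_l; lra. }
assert (Hterm : forall k s, 0 <= s -> a k * s ^ n k <= a k * (INR (n k) ^ 2 * s ^ n k)).
{ intros k s Hs. apply Rmult_le_compat_l; auto.
  assert (0 <= s ^ n k) by now apply pow_le. specialize (Hn1 k).
  assert (1 <= INR (n k) ^ 2) by nra. nra. }
destruct (lacunary_series a n Ha Hn) as [h [h' Hh]].
{ intros s Hs. destruct (Hfind s (proj2 Hs)) as [k0 Hk0].
  exists (rsum (fun k => a k * (INR (n k) ^ 2 * s ^ n k)) k0 + 1 / (8 * B)). intros K.
  eapply Rle_trans; [apply (rsum_mono _ K (k0 + K)); [|lia]|].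
  - intros k. apply Rmult_le_pos; auto. apply Rmult_le_pos; [apply pow2_ge_0 | apply pow_le; lra].
  - rewrite rsum_split. apply Rplus_le_compat_l. apply Htail. lra. }
assert (Hvtail : forall x k z p, 0 <= x <= B -> Cmod z <= rho k ->
  x * Cmod (csum (fun j => RtoC (a (k + j)%nat) * z ^ n (k + j)%nat)%C p) <= 1 / 8).
{ intros x k z p Hx Hz.
  replace (1 / 8) with (B * (1 / (8 * B))) by (field; lra).
  apply Rmult_le_compat; try lra; [apply Cmod_ge_0|].
  eapply Rle_trans; [|apply (Htail k (Cmod z) p); split; [apply Cmod_ge_0 | auto]].
  apply Cmod_csum_le. intros j. rewrite Cmod_mult, Cmod_RtoC_pos, Cmod_pow by auto.
  apply (Hterm (k + j)%nat (Cmod z)), Cmod_ge_0. }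
(* The radius s of the weight and the point z are independent: later the weight is taken at a peak
   while the point ranges over a larger disk. *)
assert (Hvhead : forall x k s z, 0 <= s -> rho k <= s < 1 -> x = v (RtoC s) -> Cmod z <= 1 ->
  x * Cmod (csum (fun j => RtoC (a j) * z ^ n j)%C k) <= 1 / 8).
{ intros x k s z Hs0 Hs -> Hz. eapply Rle_trans; [|apply (H5 k s Hs)].
  apply Rmult_le_compat_l; [apply Rlt_le, weight_pos, disk_RtoC; auto; lra|].
  apply Cmod_csum_le. intros j. rewrite Cmod_mult, Cmod_RtoC_pos, Cmod_pow by auto.
  rewrite <- (Rmult_1_r (a j)) at 2. apply Rmult_le_compat_l; auto.
  apply pow_le_1. split; [apply Cmod_ge_0 | auto]. }
assert (Hlimit : forall x z q M N, disk z -> 0 < x ->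
  (forall p, x * Cmod (csum (fun j => RtoC (a j) * z ^ n j)%C (N + p) - q) <= M) ->
  x * Cmod (h z - q) <= M).
{ intros x z q M N Hz Hx H. destruct (Hh z Hz) as [Hl _].
  assert (Hq : Cmod (h z - q) <= M / x).
  { apply (Cmod_limit_le _ _ _ _ N Hl). intros K HK.
    specialize (H (K - N)%nat). replace (N + (K - N))%nat with K in H by lia.
    apply Rmult_le_reg_l with x; auto. replace (x * (M / x)) with M by (field; lra). auto. }
  apply (Rmult_le_compat_l x) in Hq; [|lra].
  replace (x * (M / x)) with M in Hq by (field; lra). auto. }
exists h.
assert (Han : analytic h).
{ apply analytic_holo. intros z Hz. exists (h' z). now apply Hh. }
assert (Hhb : forall z, disk z -> v z * Cmod (h z) <= 2).
{ intros z Hz. assert (Hz0 := Cmod_ge_0 z). assert (Hvz := weight_pos v Hv z Hz).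
  assert (HvB := HB z Hz). unfold disk in Hz.
  replace (h z) with (h z - 0)%C by ring.
  destruct (Rlt_le_dec (Cmod z) (rho O)) as [Hlt|Hge].
  - apply (Hlimit _ _ _ _ O); auto. intros p.
    replace (csum (fun j => RtoC (a j) * z ^ n j)%C (0 + p) - 0)%C
      with (csum (fun j => RtoC (a (0 + j)%nat) * z ^ n (0 + j)%nat)%C p) by (simpl; ring).
    eapply Rle_trans; [apply Hvtail; lra | lra].
  (* On this annulus the head and the tail weigh at most 1/8 each, and the k-th monomial at most
     1. *)
  - assert (Hk : exists k, rho k <= Cmod z < rho (S k)).
    { destruct (Hfind (Cmod z) Hz) as [k1 Hk1]. revert Hk1.
      induction k1 as [|k1 IH]; intros Hk1; [lra|].
      destruct (Rlt_le_dec (Cmod z) (rho k1)); [auto|]. exists k1. lra. }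
    destruct Hk as [k Hk].
    apply (Hlimit _ _ _ _ (S k)); auto. intros p. rewrite csum_split. simpl csum at 1.
    replace (Cminus _ 0) with ((csum (fun j => RtoC (a j) * z ^ n j) k + RtoC (a k) * z ^ n k) +
      csum (fun j => RtoC (a (S k + j)%nat) * z ^ n (S k + j)%nat) p)%C by (simpl; ring).
    assert (T1 := Hvhead (v z) k (Cmod z) z Hz0 ltac:(lra) (weight_radial v Hv z Hz) ltac:(lra)).
    assert (T2 := Hvtail (v z) (S k) z p ltac:(lra) ltac:(lra)).
    assert (T3 := H2 k (Cmod z) ltac:(lra)). rewrite <- (weight_radial v Hv z Hz) in T3.
    set (X := csum _ k) in *. set (Y := csum _ p) in *.
    assert (T := Cmod_triangle (X + RtoC (a k) * z ^ n k) Y).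
    assert (T' := Cmod_triangle X (RtoC (a k) * z ^ n k)).
    rewrite Cmod_mult, Cmod_RtoC_pos, Cmod_pow in T' by auto.
    apply Rle_trans with (v z * (Cmod X + a k * Cmod z ^ n k + Cmod Y)); [|nra].
    apply Rmult_le_compat_l; lra. }
split; auto. split; auto.
assert (Hd := proj1 (weighted_norm_finite _ _) (proj1 (Hqn h Han)
  (conj Han (proj2 (weighted_norm_finite v h) (ex_intro _ 2 Hhb))))).
destruct Hd as [D HD].
(* At the positive point r_k all terms of h' are nonnegative, so the k-th one is at most |h' (r_k)|.
   Up to the factor r_k it is n_k times a monomial of weighted size at least 1/2. *)
assert (Hpeak : forall k, (1 - r k) * INR (n k) <= 2 * D).
{ intros k. destruct (Hrho k) as [Hr1 [Hr2 _]].
  assert (Hdk : disk (RtoC (r k))) by (apply disk_RtoC; lra).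
  specialize (HD _ Hdk). cbv beta in HD.
  destruct (Hh _ Hdk) as [_ [Hl' Hcd]].
  rewrite (is_C_derive_unique h _ (h' (RtoC (r k)))) in HD by now apply is_derive_cderiv.
  rewrite Cmod_RtoC_pos in HD by lra.
  set (T := a k * (INR (n k) * r k ^ pred (n k))).
  assert (HT : T <= Cmod (h' (RtoC (r k)))).
  { apply le_epsilon. intros e He.
    destruct (proj1 (filterlim_C _ _ _) Hl' e He) as [N HN].
    specialize (HN (Nat.max N (S k)) (Nat.le_max_l _ _)).
    set (K := Nat.max N (S k)) in *.
    assert (Hreal : forall L, csum (fun k0 => RtoC (a k0) * (RtoC (INR (n k0)) *
        RtoC (r k) ^ pred (n k0)))%C L =
        RtoC (rsum (fun k0 => a k0 * (INR (n k0) * r k ^ pred (n k0))) L)).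
    { induction L as [|L IH]; simpl; [reflexivity|].
      rewrite IH, RtoC_plus, !RtoC_mult, RtoC_pow. reflexivity. }
    rewrite Hreal in HN.
    assert (Hnn : forall j, 0 <= a j * (INR (n j) * r k ^ pred (n j))).
    { intros j. apply Rmult_le_pos; auto. apply Rmult_le_pos; [apply pos_INR | apply pow_le; lra]. }
    assert (HTs : T <= rsum (fun k0 => a k0 * (INR (n k0) * r k ^ pred (n k0))) K).
    { apply (rsum_term_le (fun k0 => a k0 * (INR (n k0) * r k ^ pred (n k0)))); auto.
      unfold K. lia. }
    assert (Tr := Cmod_minus_ge (RtoC (rsum (fun k0 => a k0 * (INR (n k0) * r k ^ pred (n k0))) K))
      (h' (RtoC (r k)))).
    rewrite Cmod_RtoC_pos in Tr by (apply rsum_nonneg; auto). lra. }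
  assert (Hvr := weight_pos v Hv _ Hdk).
  assert (H3k := H3 k).
  assert (Hpow : r k ^ n k = r k * r k ^ pred (n k)).
  { specialize (Hn k). destruct (n k); [lia | reflexivity]. }
  assert (Hprod : (1 - r k ^ 2) * v (RtoC (r k)) * T <= D).
  { eapply Rle_trans; [|exact HD]. apply Rmult_le_compat_l; auto.
    apply Rmult_le_pos; [|lra]. nra. }
  assert (HnT : INR (n k) * (v (RtoC (r k)) * (a k * r k ^ n k)) = r k * (v (RtoC (r k)) * T)).
  { unfold T. rewrite Hpow. ring. }
  assert (Hn0 := Hn1 k).
  assert (INR (n k) * (1 / 2) <= r k * (v (RtoC (r k)) * T)).
  { rewrite <- HnT. apply Rmult_le_compat_l; lra. }
  assert (HvT : 0 <= v (RtoC (r k)) * T).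
  { apply Rmult_le_pos; [lra|]. unfold T. apply Rmult_le_pos; auto.
    apply Rmult_le_pos; [lra | apply pow_le; lra]. }
  assert ((1 - r k) * (INR (n k) * (1 / 2)) <= (1 - r k ^ 2) * (v (RtoC (r k)) * T)).
  { apply Rle_trans with ((1 - r k) * (r k * (v (RtoC (r k)) * T))).
    - apply Rmult_le_compat_l; lra.
    - replace (1 - r k ^ 2) with ((1 - r k) * (1 + r k)) by ring.
      rewrite Rmult_assoc. apply Rmult_le_compat_l; [lra|].
      apply Rmult_le_compat_r; lra. }
  lra. }
(* The exponential bounds the k-th term on the larger disk, 1/4 the head and the tail together. The
   tail estimate still applies there because (1 + r_k) / 2 <= rho_(k+1). *)
exists (exp (2 * (2 * D)) + 1 / 4). split; [assert (He := exp_pos (2 * (2 * D))); lra|].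
intros s Hs. destruct (Hfind s Hs) as [k Hk]. exists (r k).
destruct (Hrho k) as [Hr1 [Hr2 Hr3]]. split; [lra|]. split; [lra|].
intros z Hz.
assert (Hdz : disk z) by (unfold disk; lra).
assert (Hvz := weight_pos v Hv z Hdz). assert (HvB := HB z Hdz).
assert (Hvr := weight_radial v Hv z Hdz). rewrite Hz in Hvr.
split.
- assert (Hdiff : v z * Cmod (h z - RtoC (a k) * z ^ n k) <= 1 / 4).
  { apply (Hlimit _ _ _ _ (S k)); auto. intros p. rewrite csum_split. simpl csum at 1.
    replace (Cminus _ (RtoC (a k) * z ^ n k)) with (csum (fun j => RtoC (a j) * z ^ n j) k +
      csum (fun j => RtoC (a (S k + j)%nat) * z ^ n (S k + j)%nat) p)%C by (simpl; ring).
    assert (T1 := Hvhead (v z) k (r k) z ltac:(lra) ltac:(lra) Hvr ltac:(lra)).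
    assert (T2 := Hvtail (v z) (S k) z p ltac:(lra) ltac:(lra)).
    eapply Rle_trans; [apply Rmult_le_compat_l; [lra | apply Cmod_triangle]|]. lra. }
  assert (T3 := H3 k). rewrite <- Hvr in T3.
  assert (Tr := Cmod_minus_ge (RtoC (a k) * z ^ n k) (h z)).
  rewrite Cmod_minus_sym, Cmod_mult, Cmod_RtoC_pos, Cmod_pow, Hz in Tr by auto.
  assert (v z * (a k * r k ^ n k - Cmod (h z)) <= 1 / 4).
  { eapply Rle_trans; [|exact Hdiff]. apply Rmult_le_compat_l; lra. }
  lra.
- intros w Hw.
  assert (Hdw : disk w) by (unfold disk; lra). assert (Hw0 := Cmod_ge_0 w).
  replace (h w) with (h w - 0)%C by ring.
  apply (Hlimit _ _ _ _ (S k)); auto. intros p. rewrite csum_split. simpl csum at 1.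
  replace (Cminus _ 0) with ((csum (fun j => RtoC (a j) * w ^ n j) k + RtoC (a k) * w ^ n k) +
      csum (fun j => RtoC (a (S k + j)%nat) * w ^ n (S k + j)%nat) p)%C by (simpl; ring).
  assert (T1 := Hvhead (v z) k (r k) w ltac:(lra) ltac:(lra) Hvr ltac:(lra)).
  assert (T2 := Hvtail (v z) (S k) w p ltac:(lra) ltac:(lra)).
  assert (T3 := H2 k (r k) ltac:(lra)). rewrite <- Hvr in T3.
  assert (T4 := inverse_power_bound (r k) (n k) _ ltac:(lra) (Hpeak k)).
  (* Since |w| <= 1 = r_k * (1 / r_k), the term exceeds its value at the peak radius by at most (1 /
     r_k)^(n_k). *)
  assert (T5 : v z * (a k * Cmod w ^ n k) <= exp (2 * (2 * D))).
  { apply Rle_trans with (v z * (a k * r k ^ n k) * (/ r k) ^ n k).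
    - replace (v z * (a k * r k ^ n k) * (/ r k) ^ n k)
        with (v z * (a k * (r k * / r k) ^ n k)) by (rewrite Rpow_mult_distr; ring).
      apply Rmult_le_compat_l; [lra|]. apply Rmult_le_compat_l; auto.
      rewrite Rinv_r by lra. apply pow_incr. unfold disk in Hdw. lra.
    - rewrite <- (Rmult_1_l (exp _)). apply Rmult_le_compat; try lra.
      + apply Rmult_le_pos; [lra|]. apply Rmult_le_pos; auto. apply pow_le; lra.
      + apply pow_le, Rlt_le, Rinv_0_lt_compat. lra. }
  set (X := csum _ k) in *. set (Y := csum _ p) in *.
  assert (T := Cmod_triangle (X + RtoC (a k) * w ^ n k) Y).
  assert (T' := Cmod_triangle X (RtoC (a k) * w ^ n k)).
  rewrite Cmod_mult, Cmod_RtoC_pos, Cmod_pow in T' by auto.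
  apply Rle_trans with (v z * (Cmod X + a k * Cmod w ^ n k + Cmod Y)); [|lra].
  apply Rmult_le_compat_l; lra.
Qed.

(** * The inclusion *)

Lemma weighted_bound_local v f N r : weight v -> analytic f ->
  (forall z, disk z -> v z * Cmod (f z) <= N) -> 0 < r < 1 ->
  exists B, 0 <= B /\ forall z, Cmod z <= r -> Cmod (f z) <= B.
Proof.
intros Hv Hf HN Hr.
assert (Hvr := weight_pos v Hv _ (disk_RtoC r ltac:(lra))).
assert (HB : forall z, Cmod z = r -> Cmod (f z) <= N / v (RtoC r)).
{ intros z Hz. assert (Hdz : disk z) by (unfold disk; lra).
  specialize (HN z Hdz). rewrite (weight_radial v Hv z Hdz), Hz in HN.
  apply Rmult_le_reg_l with (v (RtoC r)); auto.
  replace (v (RtoC r) * (N / v (RtoC r))) with N by (field; lra). auto. }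
exists (N / v (RtoC r)). split.
- eapply Rle_trans; [apply Cmod_ge_0 | apply (HB (RtoC r)), Cmod_RtoC_pos; lra].
- intros z Hz. apply (max_modulus 1 f r); auto. now apply analytic_holo.
Qed.

Lemma weighted_lipschitz_local v f N r : weight v -> analytic f ->
  (forall z, disk z -> v z * Cmod (f z) <= N) -> 0 <= r < 1 ->
  exists L, 0 <= L /\ forall z w, Cmod z <= r -> Cmod w <= r ->
    Cmod (f w - f z) <= L * Cmod (w - z).
Proof.
intros Hv Hf HN Hr. set (r' := (1 + r) / 2).
destruct (weighted_bound_local v f N r' Hv Hf HN) as [B [HB0 HB]]; [unfold r'; lra|].
exists (B * r' / ((r' - r) * (r' - r))). split.
- apply Rmult_le_pos; [apply Rmult_le_pos; unfold r'; lra|].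
  apply Rlt_le, Rinv_0_lt_compat, Rmult_lt_0_compat; unfold r'; lra.
- intros z w Hz Hw. apply (cauchy_lipschitz 1); auto.
  + now apply analytic_holo.
  + unfold r'; lra.
  + intros u Hu. apply HB. lra.
Qed.

Lemma analytic_dilation f rho : analytic f -> 0 < rho < 1 -> analytic (fun z => f (RtoC rho * z)%C).
Proof.
intros Hf Hrho. apply analytic_holo. intros z Hz.
destruct (proj1 (analytic_holo f) Hf (RtoC rho * z)%C) as [l Hl].
- rewrite Cmod_mult, Cmod_RtoC_pos by lra. assert (H := Cmod_ge_0 z). nra.
- eexists. apply (cderiv_comp f (fun z => RtoC rho * z)%C); [exact Hl|].
  apply cderiv_scal, cderiv_id.
Qed.

(** v need not be monotone, so v z |f (rho z)| cannot be read off at the point rho z. The maximum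
    principle on the circle through z compares it with values of f where the weight is the same. *)
Lemma dilation_dense v f e : weight v -> Hv_zero v f -> 0 < e ->
  exists rho, 0 < rho < 1 /\ forall z, disk z -> v z * Cmod (f z - f (RtoC rho * z)%C) <= e.
Proof.
intros Hv [[Hf Hfin] Hlim] He.
destruct (proj1 (weighted_norm_finite v f) Hfin) as [N HN].
destruct (weight_bounded v Hv) as [B [HB0 HB]].
destruct (to_circle_small _ Hlim (e / 2)) as [r1 [Hr1 Hsmall]]; [lra|].
destruct (weighted_lipschitz_local v f N r1 Hv Hf HN Hr1) as [L [HL0 HL]].
set (d := Rmin (1 / 2) (e / (B * L + 1))).
assert (HBL : 0 <= B * L) by (apply Rmult_le_pos; lra).
assert (Hd : 0 < d) by (apply Rmin_pos; [lra | apply Rdiv_lt_0_compat; lra]).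
assert (Hd1 : d <= 1 / 2) by apply Rmin_l.
assert (Hd2 : (B * L + 1) * d <= e).
{ apply Rle_trans with ((B * L + 1) * (e / (B * L + 1))).
  - apply Rmult_le_compat_l; [lra | apply Rmin_r].
  - right. field. lra. }
exists (1 - d). split; [lra|]. intros z Hz.
assert (Hz0 := Cmod_ge_0 z). assert (Hvz := weight_pos v Hv z Hz). assert (HvB := HB z Hz).
unfold disk in Hz.
assert (Hrz : Cmod (RtoC (1 - d) * z) = (1 - d) * Cmod z)
  by (rewrite Cmod_mult, Cmod_RtoC_pos; lra).
destruct (Rle_lt_dec (Cmod z) r1) as [Hle|Hlt].
- assert (H := HL (RtoC (1 - d) * z)%C z ltac:(nra) Hle).
  replace (z - RtoC (1 - d) * z)%C with (RtoC d * z)%C in H by (rewrite RtoC_minus; ring).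
  rewrite Cmod_mult, Cmod_RtoC_pos in H by lra.
  apply Rle_trans with (B * (L * (d * Cmod z))).
  + apply Rmult_le_compat; try lra. apply Cmod_ge_0.
  + assert (d * Cmod z <= d * 1) by (apply Rmult_le_compat_l; lra).
    assert (B * L * (d * Cmod z) <= B * L * (d * 1)) by (apply Rmult_le_compat_l; lra). lra.
- assert (Hpt : forall u, Cmod u = Cmod z -> Cmod (f u) <= e / 2 / v z).
  { intros u Hu. assert (Hdu : disk u) by (unfold disk; lra).
    assert (H := Hsmall u ltac:(lra)). assert (H' := Rle_abs (v u * Cmod (f u))).
    rewrite (weight_radial v Hv u Hdu), Hu, <- (weight_radial v Hv z Hz) in *.
    apply Rmult_le_reg_l with (v z); auto.
    replace (v z * (e / 2 / v z)) with (e / 2) by (field; lra). lra. }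
  assert (H1 := Hpt z eq_refl).
  assert (H2 : Cmod (f (RtoC (1 - d) * z)%C) <= e / 2 / v z).
  { apply (max_modulus 1 f (Cmod z)); auto; [now apply analytic_holo | lra|].
    rewrite Hrz. nra. }
  apply Rle_trans with (v z * (e / 2 / v z + e / 2 / v z)); [|right; field; lra].
  apply Rmult_le_compat_l; [lra|].
  eapply Rle_trans; [apply Cmod_triangle|]. rewrite Cmod_opp. lra.
Qed.

Section inclusion.

Context (v : C -> R) (phi : R -> C -> C) (G : C -> C) (M : R).
Hypothesis v_weight : weight v.
Hypothesis v_typical : typical v.
Hypothesis phi_sg : semigroup phi.
Hypothesis G_gen : infinitesimal_generator phi G.
Hypothesis G_bound : forall r, r < 1 -> exists K, 0 <= K /\
  forall w, disk w -> Cmod w <= r -> Cmod (G w) <= K.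
Hypothesis M_pos : 0 < M.
Hypothesis T_bound : forall t f N, 0 <= t <= 1 -> analytic f -> 0 < N ->
  (forall z, disk z -> v z * Cmod (f z) <= N) ->
  forall z, disk z -> v z * Cmod (C_derive (phi t) z * f (phi t z)) <= M * N.

Lemma weighted_derivative_small e : 0 < e ->
  exists r', 0 < r' < 1 /\ exists t0, 0 < t0 /\ forall t z, 0 <= t < t0 -> r' < Cmod z < 1 ->
    v z * Cmod (C_derive (phi t) z) <= e /\ v z <= e.
Proof using v_weight v_typical phi_sg G_gen G_bound M_pos T_bound.
intros He. set (k := Rmin e (e / (2 * M))).
assert (Hk : 0 < k) by (apply Rmin_pos; auto; apply Rdiv_lt_0_compat; lra).
assert (Hk1 : k <= e) by apply Rmin_l.
assert (Hk2 : 2 * M * k <= e).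
{ apply Rle_trans with (2 * M * (e / (2 * M))); [apply Rmult_le_compat_l; [lra | apply Rmin_r]|].
  right. field. lra. }
destruct (weight_small v v_typical k Hk) as [rho [Hrho Hsm]].
destruct (weighted_monomial v v_weight ((1 + rho) / 2) 1)
  as [n [a [r [Hn [Ha [Hr [Hle [Hpk _]]]]]]]]; [lra | lra|].
assert (Hvr : v (RtoC r) < k) by (apply Hsm; rewrite Cmod_RtoC_pos; lra).
assert (Hvr0 := weight_pos v v_weight _ (disk_RtoC r ltac:(lra))).
assert (Hrn : 0 < r ^ n) by (apply pow_lt; lra).
assert (Har : 1 <= 2 * k * (a * r ^ n)).
{ assert (0 < a * r ^ n) by now apply Rmult_lt_0_compat. nra. }
set (r' := (1 + r) / 2).
destruct (G_bound r') as [K [HK HGK]]; [unfold r'; lra|].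
exists r'. split; [unfold r'; lra|].
(* At speed at most K, an orbit needs a time of at least (r' - r) / K to cross from |z| = r' down to
   |z| = r. *)
exists (Rmin 1 ((r' - r) / (K + 1))). split.
{ apply Rmin_pos; [lra|]. apply Rdiv_lt_0_compat; unfold r'; lra. }
intros t z [Ht0 Ht] Hz.
assert (Ht1 : t < 1) by (eapply Rlt_le_trans; [exact Ht | apply Rmin_l]).
assert (Ht2 : K * t < r' - r).
{ assert (Hq : t < (r' - r) / (K + 1)) by (eapply Rlt_le_trans; [exact Ht | apply Rmin_r]).
  apply (Rmult_lt_compat_r (K + 1)) in Hq; [|lra].
  replace ((r' - r) / (K + 1) * (K + 1)) with (r' - r) in Hq by (field; lra). nra. }
assert (Hdz : disk z) by (unfold disk; lra).
assert (Hvz := weight_pos v v_weight z Hdz).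
split; [|apply Rlt_le; eapply Rlt_le_trans; [apply Hsm; unfold r' in *; lra | auto]].
assert (Hphi : r < Cmod (phi t z))
  by (apply (semigroup_stays_near_circle phi G phi_sg G_gen z t K r r'); auto; lra).
assert (Hm := T_bound t (fun w => RtoC a * w ^ n)%C 1 ltac:(lra)).
assert (Han : analytic (fun w => RtoC a * w ^ n)%C).
{ apply analytic_holo. intros w _. eexists. apply cderiv_scal, cderiv_pow. }
assert (Hb1 : forall w, disk w -> v w * Cmod (RtoC a * w ^ n) <= 1).
{ intros w Hw. rewrite Cmod_mult, Cmod_RtoC_pos, Cmod_pow, (weight_radial v v_weight w Hw) by lra.
  apply Hle. split; [apply Cmod_ge_0 | exact Hw]. }
specialize (Hm Han ltac:(lra) Hb1 z Hdz). cbv beta in Hm.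
rewrite !Cmod_mult, Cmod_RtoC_pos, Cmod_pow in Hm by lra.
assert (Hpow : r ^ n <= Cmod (phi t z) ^ n) by (apply pow_incr; lra).
set (X := Cmod (C_derive (phi t) z)) in *. assert (HX : 0 <= X) by apply Cmod_ge_0.
assert (HvX : 0 <= v z * X) by (apply Rmult_le_pos; lra).
assert (v z * X * (a * r ^ n) <= M).
{ apply Rle_trans with (v z * (X * (a * Cmod (phi t z) ^ n))); [|lra].
  rewrite Rmult_assoc. apply Rmult_le_compat_l; [lra|]. apply Rmult_le_compat_l; auto.
  apply Rmult_le_compat_l; lra. }
assert (v z * X * 1 <= v z * X * (2 * k * (a * r ^ n))) by (apply Rmult_le_compat_l; lra).
assert (v z * X * (a * r ^ n) * (2 * k) <= M * (2 * k)) by (apply Rmult_le_compat_r; lra).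
lra.
Qed.

Lemma derivative_near_1 r' : 0 < r' < 1 ->
  exists K t0, 0 <= K /\ 0 < t0 /\ forall t z, 0 <= t < t0 -> Cmod z <= r' ->
    Cmod (phi t z - z) <= K * t /\ Cmod (C_derive (phi t) z - 1) <= K * t.
Proof using phi_sg G_gen G_bound.
(* G is bounded on radius r3, so phi_t - id is O(t) on radius r2. Cauchy's estimate turns this into
   a derivative bound on radius r', with s in between leaving room for increments around z. *)
intros Hr'. set (r2 := (1 + r') / 2). set (r3 := (1 + r2) / 2).
destruct (G_bound r3) as [K [HK HGK]]; [unfold r3, r2; lra|].
set (s := (r' + r2) / 2). set (c := 1 * r2 / ((r2 - s) * (r2 - s))).
assert (Hc : 0 <= c).
{ apply Rmult_le_pos; [unfold r2; lra|].
  apply Rlt_le, Rinv_0_lt_compat, Rmult_lt_0_compat; unfold s, r2; lra. }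
exists (K * (1 + c)), ((r3 - r2) / (K + 1)).
assert (HKc : 0 <= K * c) by (apply Rmult_le_pos; auto).
split; [lra|]. split; [apply Rdiv_lt_0_compat; unfold r3, r2; lra|].
intros t z [Ht0 Ht] Hz.
assert (Ht2 : K * t < r3 - r2).
{ apply (Rmult_lt_compat_r (K + 1)) in Ht; [|lra].
  replace ((r3 - r2) / (K + 1) * (K + 1)) with (r3 - r2) in Ht by (field; lra). nra. }
assert (Hclose : forall w, Cmod w <= r2 -> Cmod (phi t w - w) <= K * t).
{ intros w Hw. apply (semigroup_close phi G phi_sg G_gen w t K (r3 - r2)); auto.
  - unfold disk, r2 in *. lra.
  - intros u Hu Huw. apply HGK; auto. replace u with ((u - w) + w)%C by ring.
    eapply Rle_trans; [apply Cmod_triangle|]. lra. }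
assert (Hs : r' < s < r2) by (unfold s, r2; lra).
assert (H1 : Cmod (phi t z - z) <= K * t) by (apply Hclose; lra).
split; [assert (0 <= K * c * t) by (apply Rmult_le_pos; auto); lra|].
assert (Hdz : disk z) by (unfold disk; lra).
assert (Hder : cderiv (fun w => phi t w - w)%C z (C_derive (phi t) z - 1)%C).
{ apply cderiv_minus; [now apply semigroup_cderiv | apply cderiv_id]. }
apply Rle_trans with (K * t * c).
2:{ assert (0 <= K * t) by (apply Rmult_le_pos; auto). lra. }
assert (HKtc : 0 <= K * t * c) by (apply Rmult_le_pos; [apply Rmult_le_pos|]; auto).
apply (cderiv_bound _ _ _ _ HKtc Hder).
exists (s - r'). split; [lra|]. intros w Hw.
replace (K * t * c) with (K * t * r2 / ((r2 - s) * (r2 - s))) by (unfold c; field; lra).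
apply (cauchy_lipschitz 1 (fun w => phi t w - w)%C); try lra.
- intros u Hu. eexists. apply cderiv_minus; [now apply semigroup_cderiv | apply cderiv_id].
- unfold s, r2; lra.
- intros u Hu. apply Hclose. lra.
- replace w with ((w - z) + z)%C by ring. eapply Rle_trans; [apply Cmod_triangle|]. lra.
Qed.

Lemma bounded_lipschitz_continuity g B L e :
  0 <= B -> 0 <= L -> (forall z, disk z -> Cmod (g z) <= B) ->
  (forall z w, disk z -> disk w -> Cmod (g w - g z) <= L * Cmod (w - z)) -> 0 < e ->
  exists t0, 0 < t0 /\ forall t z, 0 <= t < t0 -> disk z ->
    v z * Cmod (C_derive (phi t) z * g (phi t z) - g z) <= e.
Proof using v_weight v_typical phi_sg G_gen G_bound M_pos T_bound.
intros HB HL Hg HgL He.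
destruct (weight_bounded v v_weight) as [V [HV0 HV]].
(* Near the circle the two terms v |phi_t'| B and v B are estimated separately, each by e1 B <= e /
   2. *)
set (e1 := e / (2 * (B + 1))).
assert (He1 : 0 < e1) by (apply Rdiv_lt_0_compat; lra).
destruct (weighted_derivative_small e1 He1) as [r' [Hr' [t1 [Ht1 Hfar]]]].
destruct (derivative_near_1 r' Hr') as [K [t2 [HK [Ht2 Hnear]]]].
assert (HKB : 0 <= V * K * (B + L)) by (repeat apply Rmult_le_pos; lra).
set (t3 := e / (V * K * (B + L) + 1)).
assert (Ht3 : 0 < t3) by (apply Rdiv_lt_0_compat; lra).
exists (Rmin t1 (Rmin t2 t3)). split; [repeat apply Rmin_pos; auto|].
intros t z [Ht0 Ht] Hz.
assert (Lt1 : t < t1) by (eapply Rlt_le_trans; [exact Ht | apply Rmin_l]).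
assert (Lt23 : t < Rmin t2 t3) by (eapply Rlt_le_trans; [exact Ht | apply Rmin_r]).
assert (Lt2 : t < t2) by (eapply Rlt_le_trans; [exact Lt23 | apply Rmin_l]).
assert (Lt3 : t < t3) by (eapply Rlt_le_trans; [exact Lt23 | apply Rmin_r]).
assert (Hvz := weight_pos v v_weight z Hz). assert (HvV := HV z Hz).
assert (Hpz := semigroup_disk phi phi_sg t z Ht0 Hz).
destruct (Rle_lt_dec (Cmod z) r') as [Hle|Hlt].
- destruct (Hnear t z (conj Ht0 Lt2) Hle) as [N1 N2].
  replace (C_derive (phi t) z * g (phi t z) - g z)%C
    with ((C_derive (phi t) z - 1) * g (phi t z) + (g (phi t z) - g z))%C by ring.
  assert (HKt : 0 <= K * t) by now apply Rmult_le_pos.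
  apply Rle_trans with (V * (K * t * B + L * (K * t))).
  + apply Rmult_le_compat; try lra; [apply Cmod_ge_0|].
    eapply Rle_trans; [apply Cmod_triangle|]. rewrite Cmod_mult.
    apply Rplus_le_compat.
    * apply Rmult_le_compat; auto; apply Cmod_ge_0.
    * eapply Rle_trans; [now apply HgL|]. apply Rmult_le_compat_l; auto.
  + apply Rle_trans with ((V * K * (B + L) + 1) * t3).
    * replace (V * (K * t * B + L * (K * t))) with (V * K * (B + L) * t) by ring.
      apply Rmult_le_compat; lra.
    * unfold t3. right. field. lra.
- destruct (Hfar t z (conj Ht0 Lt1) (conj Hlt Hz)) as [F1 F2].
  apply Rle_trans with (v z * (Cmod (C_derive (phi t) z) * B + B)).
  + apply Rmult_le_compat_l; [lra|].
    eapply Rle_trans; [apply Cmod_triangle|]. rewrite Cmod_opp, Cmod_mult.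
    apply Rplus_le_compat; auto. apply Rmult_le_compat_l; [apply Cmod_ge_0 | auto].
  + apply Rle_trans with (e1 * B + e1 * B); [nra|].
    apply Rle_trans with (2 * (B + 1) * e1); [lra|]. unfold e1. right. field. lra.
Qed.

Lemma Hv_zero_strongly_continuous f : Hv_zero v f -> strong_continuity_space phi v f.
Proof using v_weight v_typical phi_sg G_gen G_bound M_pos T_bound.
intros Hf. assert (Hf' := Hf). destruct Hf' as [[Han Hfin] _].
split; [split; auto|]. intros eps. assert (Heps := cond_pos eps).
(* Replacing f by its dilation g costs M e inside T_t and e outside, together eps / 4; the Lipschitz
   function g costs another eps / 4. The total eps / 2 leaves the strict inequality. *)
set (e := eps / (4 * (M + 1))).
assert (He : 0 < e) by (apply Rdiv_lt_0_compat; lra).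
destruct (proj1 (weighted_norm_finite v f) Hfin) as [N HN].
destruct (dilation_dense v f e v_weight Hf He) as [rho [Hrho Hd]].
set (g := fun z => f (RtoC rho * z)%C).
assert (Hrz : forall z, disk z -> Cmod (RtoC rho * z) <= rho).
{ intros z Hz. unfold disk in Hz. rewrite Cmod_mult, Cmod_RtoC_pos by lra.
  assert (H := Cmod_ge_0 z). nra. }
destruct (weighted_bound_local v f N rho v_weight Han HN Hrho) as [B [HB0 HB]].
destruct (weighted_lipschitz_local v f N rho v_weight Han HN ltac:(lra)) as [L [HL0 HL]].
destruct (bounded_lipschitz_continuity g B L (eps / 4) HB0 HL0) as [t0 [Ht0 Hg]].
{ intros z Hz. apply HB. auto. }
{ intros z w Hz Hw. unfold g. eapply Rle_trans; [apply HL; auto|].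
  apply Rmult_le_compat_l; auto.
  replace (RtoC rho * w - RtoC rho * z)%C with (RtoC rho * (w - z))%C by ring.
  rewrite Cmod_mult, Cmod_RtoC_pos by lra. assert (H := Cmod_ge_0 (w - z)). nra. }
{ lra. }
apply at_right_iff. exists (Rmin t0 1). split; [apply Rmin_pos; lra|].
intros t Ht. rewrite Rplus_0_l.
assert (L1 := Rmin_l t0 1). assert (L2 := Rmin_r t0 1).
apply Rbar_le_lt_trans with (eps / 2); [|simpl; lra].
apply weighted_norm_le. intros z Hz. unfold weighted_comp.
assert (Hvz := weight_pos v v_weight z Hz).
assert (Han' : analytic (fun z => f z - g z)%C).
{ apply analytic_holo. intros w Hw.
  destruct (proj1 (analytic_holo f) Han w Hw) as [l Hl].
  destruct (proj1 (analytic_holo g) (analytic_dilation f rho Han Hrho) w Hw) as [m Hm].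
  eexists. apply cderiv_minus; eassumption. }
assert (E1 := T_bound t (fun z => f z - g z)%C e ltac:(lra) Han' He Hd z Hz). cbv beta in E1.
assert (E2 := Hg t z ltac:(lra) Hz). assert (E3 := Hd z Hz).
rewrite Cmod_minus_sym in E3. change (f (RtoC rho * z)%C) with (g z) in E3.
replace (C_derive (phi t) z * f (phi t z) - f z)%C
  with (C_derive (phi t) z * (f (phi t z) - g (phi t z)) +
        (C_derive (phi t) z * g (phi t z) - g z) + (g z - f z))%C by ring.
assert (Tr : Cmod (C_derive (phi t) z * (f (phi t z) - g (phi t z)) +
        (C_derive (phi t) z * g (phi t z) - g z) + (g z - f z))%C <=
   Cmod (C_derive (phi t) z * (f (phi t z) - g (phi t z))) +
   Cmod (C_derive (phi t) z * g (phi t z) - g z) + Cmod (g z - f z)).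
{ repeat (apply Cmod_le_plus; [|lra]). lra. }
apply (Rmult_le_compat_l (v z)) in Tr; [|lra].
assert (Hee : (M + 1) * e = eps / 4) by (unfold e; field; lra). lra.
Qed.

End inclusion.

(** * Properness of the inclusion *)

Section averaged_function.

Context (v : C -> R) (phi : R -> C -> C) (G h H : C -> C) (M : R).
Hypothesis v_weight : weight v.
Hypothesis phi_sg : semigroup phi.
Hypothesis G_gen : infinitesimal_generator phi G.
Hypothesis G_holo : holo 1 G.
Hypothesis G_nonzero : forall z, disk z -> G z <> 0.
Hypothesis M_pos : 0 < M.
Hypothesis h_bound : forall t z, 0 <= t <= 1 -> disk z ->
  v z * Cmod (C_derive (phi t) z * h (phi t z)) <= M.
Hypothesis H_primitive : forall z, disk z -> cderiv H z (h z).

(* Equals [\int_0^d T_t h dt], as [d/dt H (phi_t z) = G z * T_t h z]. *)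
Definition averaged (d : R) (z : C) : C := ((H (phi d z) - H z) / G z)%C.

Lemma primitive_left_cont t z : 0 < t -> disk z -> left_cont (fun s => H (phi s z)) t.
Proof using phi_sg G_gen H_primitive.
intros Ht Hz. apply (left_cont_comp H (fun s => phi s z)).
- eapply cderiv_cont, H_primitive, semigroup_disk; eauto; lra.
- now apply (semigroup_left_cont phi G).
Qed.

(** The right derivative of H (phi_t z) is h (phi_t z) G (phi_t z) = G z * T_t h z, of modulus at
    most |G z| M / v z. The lemma thus bounds the integral of T_t h over [a, c] by the length of the
    interval. *)
Lemma primitive_increment z a c : disk z -> 0 <= a <= c -> c <= 1 ->
  v z * Cmod ((H (phi c z) - H (phi a z)) / G z) <= M * (c - a).
Proof using v_weight phi_sg G_gen G_nonzero M_pos h_bound H_primitive.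
intros Hz Hac Hc. assert (Hvz := weight_pos v v_weight z Hz).
assert (HG := G_nonzero z Hz). assert (HG0 := proj1 (Cmod_gt_0 _) HG).
assert (Hmv : Cmod (H (phi c z) - H (phi a z)) <= Cmod (G z) * (M / v z) * (c - a)).
{ apply (right_mean_value (fun s => H (phi s z))); auto.
  - apply Rmult_le_pos; [lra|]. apply Rlt_le, Rdiv_lt_0_compat; lra.
  - intros t Ht. assert (Hd : disk (phi t z)) by (apply semigroup_disk; auto; lra).
    apply deriv_right_slope with (h (phi t z) * G (phi t z))%C.
    + apply (flow_right_deriv phi G phi_sg G_gen); auto; lra.
    + rewrite <- (generator_derivative phi G phi_sg G_gen t z) by (auto; lra).
      replace (h (phi t z) * (C_derive (phi t) z * G z))%C
        with (G z * (C_derive (phi t) z * h (phi t z)))%C by ring.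
      rewrite Cmod_mult. apply Rmult_le_compat_l; [lra|].
      apply Rmult_le_reg_l with (v z); auto.
      replace (v z * (M / v z)) with M by (field; lra). apply h_bound; auto; lra.
  - intros t Ht. apply primitive_left_cont; auto; lra. }
rewrite Cmod_div by auto.
apply Rmult_le_reg_l with (Cmod (G z) / v z); [now apply Rdiv_lt_0_compat|].
replace (Cmod (G z) / v z * (v z * (Cmod (H (phi c z) - H (phi a z)) / Cmod (G z))))
  with (Cmod (H (phi c z) - H (phi a z))) by (field; lra).
eapply Rle_trans; [exact Hmv|]. right. field. lra.
Qed.

Lemma averaged_analytic d : 0 <= d -> analytic (averaged d).
Proof using phi_sg G_holo G_nonzero H_primitive.
intros Hd. apply analytic_holo. intros z Hz. destruct (G_holo z Hz) as [l Hl].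
eexists. apply (cderiv_mult (fun w => H (phi d w) - H w)%C (fun w => / G w)%C).
- apply cderiv_minus; [|now apply H_primitive].
  apply (cderiv_comp H (phi d)); [apply H_primitive; now apply semigroup_disk|].
  now apply semigroup_cderiv.
- apply (cderiv_comp (fun w => / w)%C G); [|exact Hl]. now apply cderiv_inv, G_nonzero.
Qed.

Lemma averaged_strongly_continuous d : 0 <= d <= 1 / 2 ->
  strong_continuity_space phi v (averaged d).
Proof using v_weight phi_sg G_gen G_holo G_nonzero M_pos h_bound H_primitive.
intros Hd. split; [split|].
- apply averaged_analytic; lra.
- apply weighted_norm_finite. exists (M * (d - 0)). intros z Hz. unfold averaged.
  rewrite <- (semigroup_0 phi phi_sg z Hz) at 3.
  apply primitive_increment; auto; lra.
- intros eps. assert (Heps := cond_pos eps).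
  apply at_right_iff. exists (Rmin (1 / 2) (eps / (4 * M))).
  split; [apply Rmin_pos; [lra | apply Rdiv_lt_0_compat; lra]|].
  intros t Ht. rewrite Rplus_0_l.
  assert (L1 := Rmin_l (1 / 2) (eps / (4 * M))). assert (L2 := Rmin_r (1 / 2) (eps / (4 * M))).
  apply Rbar_le_lt_trans with (eps / 2); [|simpl; lra].
  apply weighted_norm_le. intros z Hz. unfold weighted_comp, averaged.
  assert (Hvz := weight_pos v v_weight z Hz).
  assert (HG := G_nonzero z Hz).
  assert (HGt := G_nonzero (phi t z) (semigroup_disk phi phi_sg t z ltac:(lra) Hz)).
  assert (Hgd := generator_derivative phi G phi_sg G_gen t z ltac:(lra) Hz).
  assert (HD : C_derive (phi t) z <> 0).
  { intros E. rewrite E, Cmult_0_l in Hgd. auto. }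
  rewrite <- (semigroup_add phi phi_sg d t z) by (auto; lra).
  rewrite <- Hgd.
  (* The integral over [t, d + t] minus that over [0, d] is the one over [d, d + t] minus that over
     [0, t]. As d and t are at most 1/2, all times stay in [0, 1]. *)
  replace (C_derive (phi t) z * ((H (phi (d + t)%R z) - H (phi t z)) /
      (C_derive (phi t) z * G z)) - (H (phi d z) - H z) / G z)%C
    with ((H (phi (d + t)%R z) - H (phi d z)) / G z + - ((H (phi t z) - H z) / G z))%C
    by (field; auto).
  assert (I1 := primitive_increment z d (d + t) Hz ltac:(lra) ltac:(lra)).
  assert (I2 := primitive_increment z 0 t Hz ltac:(lra) ltac:(lra)).
  rewrite semigroup_0 in I2 by auto.
  assert (HMt : M * t <= eps / 4).
  { apply Rle_trans with (M * (eps / (4 * M))); [apply Rmult_le_compat_l; lra|].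
    right. field. lra. }
  eapply Rle_trans; [apply Rmult_le_compat_l; [lra | apply Cmod_triangle]|].
  rewrite Cmod_opp, Rmult_plus_distr_l.
  replace (M * (d + t - d)) with (M * t) in I1 by ring. lra.
Qed.

(* Near [z] the vector field satisfies [|G| <= 16 |G z|] and [|G z| <= p (1 - |z|)], so the
   orbit of [z] stays hyperbolically close to [z] during a time independent of [z]. *)
Lemma averaged_at_peak p K r z d :
  0 <= p -> 0 < K -> 0 <= r < 1 -> Cmod z = r ->
  Cmod (G z) <= p * (1 - r) ->
  (forall w, Cmod (w - z) <= (1 - r) / 2 -> Cmod (G w) <= 16 * Cmod (G z)) ->
  1 / 4 <= v z * Cmod (h z) ->
  (forall w, Cmod w <= (1 + r) / 2 -> v z * Cmod (h w) <= K) ->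
  0 < d -> d * (16384 * K * p + 64 * p + 1) <= 1 -> holo 1 h ->
  d / 8 <= v z * Cmod (averaged d z).
Proof using v_weight phi_sg G_gen G_holo G_nonzero H_primitive.
intros Hp HK Hr Hzr HGz HGw Hh1 HhK Hd Hdp Hh.
assert (Hz : disk z) by (unfold disk; lra).
assert (Hvz := weight_pos v v_weight z Hz).
assert (HG0 := proj1 (Cmod_gt_0 _) (G_nonzero z Hz)).
set (gz := Cmod (G z)) in *.
assert (HKp : 0 <= K * p) by (apply Rmult_le_pos; lra).
(* This keeps the orbit within (1 - r) / 4 of z up to time d; the next bound, 16384 being 8 * 2048,
   makes the drift of the integrand at most 1/8 against the value 1/4 at the peak. *)
assert (Hdp1 : 64 * p * d < 1) by nra.
assert (Hdp2 : 2048 * K * p * d <= 1 / 8) by nra.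
assert (Hclose : forall t, 0 <= t <= d -> Cmod (phi t z - z) <= 16 * gz * t /\ 16 * gz * t < (1 - r) / 4).
{ intros t Ht.
  assert (Hsmall : 16 * gz * t < (1 - r) / 4).
  { apply Rle_lt_trans with (16 * (p * (1 - r)) * d).
    - apply Rmult_le_compat; lra.
    - replace (16 * (p * (1 - r)) * d) with ((64 * p * d) * ((1 - r) / 4)) by field.
      rewrite <- (Rmult_1_l ((1 - r) / 4)) at 2. apply Rmult_lt_compat_r; lra. }
  split; auto. apply (semigroup_close phi G phi_sg G_gen z t (16 * gz) ((1 - r) / 4)); auto; try lra.
  intros w _ Hw. apply HGw. lra. }
(* g (phi_t z) is the right derivative of H (phi_t z). It is bounded by 16 |G z| K / v z on radius
   (1 - r) / 2 about z, and Cauchy's estimate on half that radius multiplies this by 8 / (1 - r),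
   hence 128. *)
set (g := fun w => (G w * h w)%C).
assert (Hg : forall w, Cmod (w - z) <= (1 - r) / 4 ->
  Cmod (g w - g z) <= 128 * gz * (K / v z) / (1 - r) * Cmod (w - z)).
{ intros w Hw.
  assert (Hgh : holo (1 - r) (fun u => g (z + u)%C)).
  { rewrite <- Hzr. apply analytic_shift; [|lra]. apply analytic_holo. now apply holo_mult. }
  assert (Lip := cauchy_lipschitz (1 - r) (fun u => g (z + u)%C) ((1 - r) / 2) ((1 - r) / 4)
    (16 * gz * (K / v z)) 0 (w - z)%C Hgh ltac:(lra)).
  cbv beta in Lip. replace (z + (w - z))%C with w in Lip by ring.
  replace (z + 0)%C with z in Lip by ring. replace (w - z - 0)%C with (w - z)%C in Lip by ring.
  replace (128 * gz * (K / v z) / (1 - r))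
    with (16 * gz * (K / v z) * ((1 - r) / 2) /
      (((1 - r) / 2 - (1 - r) / 4) * ((1 - r) / 2 - (1 - r) / 4))) by (field; lra).
  apply Lip; auto.
  - intros u Hu. unfold g. rewrite Cmod_mult.
    apply Rmult_le_compat; try apply Cmod_ge_0.
    + apply HGw. replace (z + u - z)%C with u by ring. lra.
    + apply Rmult_le_reg_l with (v z); auto.
      replace (v z * (K / v z)) with K by (field; lra). apply HhK.
      eapply Rle_trans; [apply Cmod_triangle|]. lra.
  - rewrite Cmod_0. lra. }
(* The Lipschitz constant times the displacement 16 p (1 - r) d: the factors 1 - r cancel, which is
   what makes d independent of the peak. *)
set (m := 2048 * K * p * d * gz / v z).
assert (Hm : forall t, 0 <= t <= d -> Cmod (g (phi t z) - g z) <= m).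
{ intros t Ht. destruct (Hclose t Ht) as [C1 C2].
  eapply Rle_trans; [apply Hg; lra|].
  apply Rle_trans with (128 * gz * (K / v z) / (1 - r) * (16 * (p * (1 - r)) * d)).
  - apply Rmult_le_compat_l.
    + assert (0 < K / v z) by (now apply Rdiv_lt_0_compat).
      apply Rmult_le_pos; [apply Rmult_le_pos; lra|]. apply Rlt_le, Rinv_0_lt_compat; lra.
    + eapply Rle_trans; [exact C1|]. apply Rmult_le_compat; lra.
  - unfold m. right. field. lra. }
(* Subtracting the linear motion leaves the slope g (phi_t z) - g z, so that U d - U 0 is G z times
   the difference between the average and d h z. *)
set (U := fun t => (H (phi t z) + RtoC t * (- g z))%C).
assert (HU : Cmod (U d - U 0) <= m * (d - 0)).
{ assert (Hm0 : 0 <= m) by (eapply Rle_trans; [apply Cmod_ge_0 | apply (Hm 0); lra]).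
  apply right_mean_value; auto; try lra.
  - intros t Ht. assert (Hdt : disk (phi t z)) by (apply semigroup_disk; auto; lra).
    apply deriv_right_slope with (g (phi t z) - g z)%C; [|apply Hm; lra].
    apply (deriv_along_eq _ (h (phi t z) * G (phi t z) + - g z)%C); [unfold g; ring|].
    apply deriv_along_plus.
    + apply (flow_right_deriv phi G phi_sg G_gen); auto; lra.
    + exists (fun _ => (- g z)%C). split; [apply filterlim_const|].
      apply filter_forall. intros s. ring.
  - intros t Ht. apply left_cont_plus; [apply primitive_left_cont; auto; lra|].
    apply (left_cont_comp (fun w => w * - g z)%C RtoC); [|apply left_cont_RtoC].
    apply filterlim_Cmult; [apply filterlim_id | apply filterlim_const]. }
unfold U in HU. rewrite semigroup_0, Rminus_0_r in HU by auto.
assert (HGn := G_nonzero z Hz).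
assert (Hav : Cmod (averaged d z - RtoC d * h z) <= m * d / gz).
{ unfold averaged.
  replace ((H (phi d z) - H z) / G z - RtoC d * h z)%C
    with ((H (phi d z) + RtoC d * - g z - (H z + RtoC 0 * - g z)) / G z)%C
    by (unfold g; field; auto).
  rewrite Cmod_div by auto. fold gz. unfold Rdiv. apply Rmult_le_compat_r; auto.
  apply Rlt_le, Rinv_0_lt_compat. lra. }
replace (m * d / gz) with (2048 * K * p * d * d / v z) in Hav by (unfold m; field; lra).
assert (Hlow := Cmod_minus_ge (RtoC d * h z) (averaged d z)).
rewrite Cmod_minus_sym, Cmod_mult, Cmod_RtoC_pos in Hlow by lra.
assert (Hlow' : d * Cmod (h z) - 2048 * K * p * d * d / v z <= Cmod (averaged d z)) by lra.
apply (Rmult_le_compat_l (v z)) in Hlow'; [|lra].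
replace (v z * (d * Cmod (h z) - 2048 * K * p * d * d / v z))
  with (d * (v z * Cmod (h z) - 2048 * K * p * d)) in Hlow' by (field; lra).
eapply Rle_trans; [|exact Hlow'].
apply Rle_trans with (d * (1 / 8)); [lra|]. apply Rmult_le_compat_l; lra.
Qed.

End averaged_function.

Theorem theorem24 (v : C -> R)
    (v_weight : weight v) (v_typical : typical v) (v_qn : quasi_normal v)
    (phi : R -> C -> C) (phi_semigroup : semigroup phi)
    (phi_nontrivial : nontrivial phi)
    (b : C) (b_dw : denjoy_wolff_point phi b) (b_circle : Cmod b = 1)
    (T_bounded : forall t : R, 0 <= t -> bounded_operator v (weighted_comp phi t))
    (T_sup : Rbar_lt
       (Rbar_lub (fun y : Rbar => exists t : R,
          0 <= t <= 1 /\ y = op_norm v (weighted_comp phi t)))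
       p_infty) :
  (forall f : C -> C, Hv_zero v f -> strong_continuity_space phi v f) /\
  (exists f : C -> C, strong_continuity_space phi v f /\ ~ Hv_zero v f).
Proof.
destruct b_dw as [_ [G [P [G_gen [P_an [P_pos G_eq]]]]]].
destruct (operator_bound v phi T_sup) as [M [M_pos T_bound]].
assert (HP0 := Cmod_ge_0 (P 0)).
split.
- intros f Hf. apply (Hv_zero_strongly_continuous v phi G M); auto.
  intros r Hr. exists (20 * Cmod (P 0) / (1 - r)). split.
  + apply Rmult_le_pos; [lra|]. apply Rlt_le, Rinv_0_lt_compat. lra.
  + intros w Hw Hwr. now apply (generator_bound P G b).
- destruct (peak_function v v_weight v_typical v_qn) as [h [h_an [h_bd [K [K_pos peak]]]]].
  assert (h_holo := proj1 (analytic_holo h) h_an).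
  destruct (holo_primitive 1 h h_holo) as [H HH].
  set (p := 5 * Cmod (P 0)).
  assert (Hp : 0 <= p) by (unfold p; lra).
  assert (HKp : 0 <= 16384 * K * p) by (repeat apply Rmult_le_pos; lra).
  set (q := 16384 * K * p + 64 * p + 1).
  assert (Hq : 1 <= q) by (unfold q; lra).
  (* The bound 1/2 serves strong continuity, the bound 1 / q the lower estimate at every peak. *)
  set (d := Rmin (1 / 2) (1 / q)).
  assert (Hd : 0 < d) by (apply Rmin_pos; [lra | apply Rdiv_lt_0_compat; lra]).
  assert (Hd2 : d <= 1 / 2) by apply Rmin_l.
  assert (Hdq : d * q <= 1).
  { apply Rle_trans with (1 / q * q); [apply Rmult_le_compat_r; [lra | apply Rmin_r]|].
    right. field. lra. }
  assert (G_holo := generator_analytic P G b P_an b_circle G_eq).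
  assert (G_nz : forall z, disk z -> G z <> 0)
    by (intros z Hz; now apply (generator_nonzero P G b P_an P_pos b_circle G_eq phi)).
  exists (averaged phi G H d). split.
  (* h has weighted norm at most 2, hence the bound 2 M for T_t h. *)
  + apply (averaged_strongly_continuous v phi G h H (M * 2)); auto; try lra.
    intros t z Ht Hz. apply T_bound; auto; lra.
  + intros [_ Hlim].
    (* Some peak radius r lies beyond any rho < 1, and at r b the weighted modulus is at least d /
       8, so it cannot tend to 0. *)
    destruct (to_circle_small _ Hlim (d / 8)) as [rho [Hrho Hsmall]]; [lra|].
    destruct (peak rho (proj2 Hrho)) as [r [Hr [Hr2 Hpk]]].
    destruct (radial_distance b b_circle r) as [E1 E2]; [lra|].
    destruct (Hpk _ E1) as [Hpk1 Hpk2].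
    assert (Hbig : d / 8 <= v (RtoC r * b)%C * Cmod (averaged phi G H d (RtoC r * b)%C)).
    { apply (averaged_at_peak v phi G h H) with p K r; auto; try lra.
      - unfold p. apply (generator_radial P G b); auto; lra.
      - intros w Hw. apply (generator_radial_harnack P G b); auto; lra. }
    specialize (Hsmall (RtoC r * b)%C). rewrite E1 in Hsmall.
    specialize (Hsmall ltac:(lra)).
    assert (Habs := Rle_abs (v (RtoC r * b)%C * Cmod (averaged phi G H d (RtoC r * b)%C))).
    lra.
Qed.
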